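(* Let $\mu\ge 0$, $\kappa>\mu/2$, and let $w\in C([0,\infty))\cap C^1(0,\infty)$ be real-valued such that, for some $r_0>0$, $\delta>0$, $2w(r)=\frac{\mu}{r}+\widetilde w(r)$ with $|\widetilde w(r)|\lesssim r^{-1-\delta}$ for $r\ge r_0$. Let $f_0\in C^1([0,\infty))$, $f_1\in C^0([0,\infty))$ satisfy $$|f_0(r)|\le \langle r\rangle^{-\kappa},\qquad |f_0'(r)|+|f_1(r)|\le \langle r\rangle^{-\kappa-1}\qquad (r\ge 0),$$ and put $\varphi(r)=rf_0(r)$, $\psi(r)=rf_1(r)$. Set $\nu=\kappa-\mu/2-1$. Let $T(\varepsilon)$ be the lifespan of the integral equation $$u(t,r)=\varepsilon u_L(t,r)+\frac12\iint_{\Delta_-(t,r)}E_-(t-\sigma,r,y)\,\frac{|u(\sigma,y)|^p}{y^{p-1}}\,dy\,d\sigma .$$ If $1<p\le p_S(3+\mu)$ or $1<p<p_F(\kappa)$, then there exist $C>0$ and $\varepsilon_0>0$ such that for any $\varepsilon\in(0,\varepsilon_0]$ $$T(\varepsilon)\ge\begin{cases}\exp(C\varepsilon^{-p(p-1)}) & (p=p_S(3+\mu)\text{ and }p\nu>1),\\ C\varepsilon^{-2p(p-1)/\gamma_S(p,3+\mu)} & (1<p<p_S(3+\mu)\text{ and }p\nu>1),\\ \exp(C\varepsilon^{-(p-1)}) & (p=p_S(3+\mu)\text{ and }p\nu=1),\\ C\,b(\varepsilon) & (1<p<p_S(3+\mu)\text{ and }p\nu=1),\\ C\varepsilon^{-(p-1)/\gamma_F(p,\kappa)}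 & (1<p<p_F(\kappa)\text{ and }p\nu<1).\end{cases}$$ Here $\gamma_F(p,\kappa)=2-(p-1)\kappa$, and (for $1<p<p_S(3+\mu)$) $b(\varepsilon)>0$ is defined by $$b(\varepsilon)\{\log(1+b(\varepsilon))\}^{2(p-1)/\gamma_S(p,3+\mu)}=\varepsilon^{-2p(p-1)/\gamma_S(p,3+\mu)} .$$
   Context: Notation: $\langle s\rangle=\sqrt{1+s^2}$; $A\lesssim B$ means $A\le CB$ with a constant $C>0$. $\gamma_S(p,n):=2+(n+1)p-(n-1)p^2$; for real $n>1$, $p_S(n)$ is the positive root of $\gamma_S(p,n)=0$; $p_F(\kappa)=1+2/\kappa$. $W(r)=\int_0^r w(\tau)\,d\tau$ and, for $t,r\ge0$, $y\ge t-r$, $$E_-(t,r,y)=e^{-W(r)}e^{2W((y-t+r)/2)}e^{-W(y)}.$$ $$\Delta_-(t,r)=\{(\sigma,y)\in(0,\infty)\times(0,\infty):\ |t-r|<\sigma+y<t+r,\ \sigma-y<t-r\}.$$ The free solution is $$u_L(t,r)=\frac12\int_{|t-r|}^{t+r}E_-(t,r,y)\big(\psi(y)+\varphi'(y)+w(y)\varphi(y)\big)dy+\chi(r-t)E_-(t,r,r-t)\varphi(r-t),$$ with $\chi(s)=1$ for $s\ge0$ and $\chi(s)=0$ for $s<0$. The lifespan $T(\varepsilon)\in(0,\infty]$ is the maximal existence time, i.e. the supremum of all $T>0$ such that the integral equation has a continuous solution $u$ on $[0,T)\times(0,\infty)$. (The integral equation is the integral form, for $u=rU$, of the radial Cauchy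 problem $(\partial_t^2+2w(r)\partial_t-\Delta+V(r))U=|U|^p$ on $\mathbb R^3$ with $V=-w'+w^2$, $U(0)=\varepsilon f_0$, $\partial_tU(0)=\varepsilon f_1$.) *)

(* Defs.v *)
From HB Require Import structures.
From mathcomp Require Import all_boot all_order all_algebra.
From mathcomp Require Import all_classical all_reals all_analysis.
From mathcomp Require Import ring lra.

Set Implicit Arguments.
Unset Strict Implicit.
Unset Printing Implicit Defensive.

Import Order.TTheory GRing.Theory Num.Theory.
Import numFieldNormedType.Exports.

Local Open Scope classical_set_scope.
Local Open Scope ring_scope.

Section Defs.
Context {R : realType}.
Implicit Types (f w : R -> R) (p n kappa mu eps t r y x : R).

Definition japanese (s : R) : R := Num.sqrt (1 + s ^+ 2).

Definition gamma_S p n : R := 2 + (n + 1) * p - (n - 1) * p ^+ 2.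

(* [get] picks the unique such p when 1 < n, see [p_SP] *)
Definition p_S n : R := get [set p : R | 0 < p /\ gamma_S p n = 0].

Definition gamma_F p kappa : R := 2 - (p - 1) * kappa.

Definition p_F kappa : R := 1 + 2 / kappa.

(* the equation has exactly one positive solution when 1 < p, 0 < eps and
   0 < gamma_S p n, its left-hand side being an increasing bijection of
   the positive half-line *)
Definition b_crit p n eps : R :=
  get [set b : R | 0 < b /\
    b * ln (1 + b) `^ (2 * (p - 1) / gamma_S p n)
      = eps `^ (- (2 * p * (p - 1) / gamma_S p n))].

(* Functions on the closed half-line are represented by total functions whose
   values at negative arguments play no role; the derivative is hence taken
   within the half-line, so that it is the one-sided derivative at 0. *)
Definition diffquot_half f x : set_system R :=
  (fun y => (f y - f x) / (y - x)) @ within `[0, +oo[ (x^').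

Definition derive_half f x : R := lim (diffquot_half f x).

Definition C0_half f : Prop := {within `[0, +oo[, continuous f}.

Definition C1_half f : Prop :=
  (forall x, 0 <= x -> cvg (diffquot_half f x)) /\ C0_half (derive_half f).

Definition C1_pos f : Prop :=
  forall x, 0 < x -> derivable f x 1 /\ {for x, continuous (derive1 f)}.

Definition primW w r : R := \int[lebesgue_measure]_(s in `[0, r]) w s.

(* only used for t - r <= y, where all arguments of [primW] are nonnegative *)
Definition E_minus w t r y : R :=
  expR (- primW w r) * expR (2 * primW w ((y - t + r) / 2))
    * expR (- primW w y).

Definition Delta_minus t r : set (R * R) :=
  [set z | [/\ 0 < z.1, 0 < z.2, `|t - r| < z.1 + z.2 < t + r
             & z.1 - z.2 < t - r]].

Definition chi (s : R) : R := if 0 <= s then 1 else 0.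

Definition u_L w (phi psi : R -> R) t r : R :=
  2^-1 * \int[lebesgue_measure]_(y in `[`|t - r|, t + r])
           (E_minus w t r y * (psi y + derive_half phi y + w y * phi y))
  + chi (r - t) * E_minus w t r (r - t) * phi (r - t).

(* The integrand being nonnegative, the double integral is taken in the
   extended reals; the equation forces it to be finite. *)
Definition is_solution w (phi psi : R -> R) p eps (T : R) (u : R * R -> R) :=
  {within [set z | 0 <= z.1 < T /\ 0 < z.2], continuous u} /\
  forall t r, 0 <= t < T -> 0 < r ->
    ((u (t, r))%:E = (eps * u_L w phi psi t r)%:E +
      2^-1%:E *
      \int[(lebesgue_measure \x lebesgue_measure)%E]_(z in Delta_minus t r)
        (E_minus w (t - z.1) r z.2 * (`|u z| `^ p / z.2 `^ (p - 1)))%:E)%E.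

Definition lifespan w (phi psi : R -> R) p eps : \bar R :=
  ereal_sup [set T%:E | T in
    [set T : R | 0 < T /\ exists u, is_solution w phi psi p eps T u]].

Lemma p_SP n : 1 < n -> forall p : R, 0 < p -> gamma_S p n = 0 <-> p = p_S n.
Proof.
move=> n1.
have uniq (a b : R) : 0 < a -> 0 < b ->
    gamma_S a n = 0 -> gamma_S b n = 0 -> a = b.
  move=> a0 b0 ha hb.
  have /eqP : (a - b) * (2 + (n - 1) * (a * b)) = 0.
    transitivity (a * gamma_S b n - b * gamma_S a n).
      by rewrite /gamma_S; ring.
    by rewrite ha hb !mulr0 subrr.
  have h : 0 < (n - 1) * (a * b) by rewrite !mulr_gt0 ?subr_gt0.
  rewrite mulf_eq0 subr_eq0 => /orP[/eqP //|/eqP]; lra.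
have [q [q0 hq]] : exists q : R, 0 < q /\ gamma_S q n = 0.
  set D := (n + 1) ^+ 2 + 8 * (n - 1).
  have D0 : 0 <= D by rewrite /D; nra.
  have hD := sqr_sqrtr D0.
  exists ((n + 1 + Num.sqrt D) / (2 * (n - 1))); split.
    by rewrite divr_gt0 ?mulr_gt0 ?subr_gt0 // ltr_wpDr ?sqrtr_ge0//; lra.
  have n10 : n - 1 != 0 by rewrite subr_eq0 gt_eqF.
  set S := Num.sqrt D in hD *.
  have -> : gamma_S ((n + 1 + S) / (2 * (n - 1))) n
      = (D - S ^+ 2) / (4 * (n - 1)) by rewrite /gamma_S /D; field.
  by rewrite hD subrr mul0r.
have [pS0 hpS] : 0 < p_S n /\ gamma_S (p_S n) n = 0.
  exact: (@getPex _ [set p : R | 0 < p /\ gamma_S p n = 0]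
            (ex_intro _ q (conj q0 hq))).
by move=> p p0; split => [hp|->//]; exact: uniq.
Qed.

End Defs.

(* Main.v *)
Require Import Defs.
From mathcomp Require Import all_boot all_order all_algebra.
From mathcomp Require Import all_classical all_reals all_analysis.
From mathcomp Require Import measurable_realfun ring lra.
Import Order.TTheory GRing.Theory Num.Theory.
Import numFieldNormedType.Exports.
Local Open Scope classical_set_scope.
Local Open Scope ring_scope.

(** Radially, with [A = t + r] and [B = |t - r|], the size of [e^(-W)] and
    [e^W] is [(1 + r)^(-mu/2)] and [(1 + r)^(mu/2)], so that on the domain of
    dependence [E_- <= C (1 + r)^(-mu/2) (1 + y)^(mu/2)].  All estimates are then
    carried by the weights
      [(1 + r)^(-mu/2) r (1 + A)^(-1 - a + s) (1 + B)^(-s)],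
    the free solution being bounded by the one with [a = nu].  In the variables
    [sigma] and [alpha = sigma + y] the Duhamel integral of the [p]-th power of
    such a weight splits: the [sigma]-integral yields [T^(1 - p s)], [log T] or
    [1] according to the sign of [1 - p s], and the [alpha]-integral yields a
    weight with [a = q], where [q = (1 + mu/2)(p - 1) - 1] satisfies
    [gamma_S p (3 + mu) = 2 (1 - p q)].
    A function [Phi] with [eps |u_L| <= Phi / 2] and
    [p L(Phi^p) <= Phi / 2], where [L] is the Duhamel operator, confines the
    Picard iterates and makes them contract.  For [p nu < 1] a multiple of
    [eps] times the weight of rate [nu] is such a [Phi]; for [p nu >= 1] one
    adds to it a multiple of [eps^p] times the weight of rate [q]. *)

Set Implicit Arguments.
Unset Strict Implicit.
Unset Printing Implicit Defensive.

(** * One-dimensional integrals *)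

Section Primitives.
Context {R : realType}.
Notation mu := (@lebesgue_measure R).

(** When [p nu >= 1], the hypothesis on [p] forces [q <= 1/p <= nu], so the weight of the nonlinear
    term decays no faster than that of the free solution. One weight of rate [q] and amplitude [eps]
    would only give a smallness condition in [eps^(p-1)]. But the slow part is created by the source
    of the free solution, so its amplitude is of order [eps^p], and it reproduces itself as long as
    [eps^(p(p-1)) D0^(p-1) D1] is small, where [D0] and [D1] are the gains in [T] of the sources of
    rates [nu] and [q]. Here [D0] is [1] if [p nu > 1] and [log T] if [p nu = 1], while [D1] is
    [T^(1-pq)] if [p q < 1] and [log T] if [p q = 1]. The four combinations are the first four
    lifespans: two logarithms multiply to [(log T)^p], whence [exp(C eps^(-(p-1)))], and a logarithm
    beside a power is the origin of [b(eps)]. The exponent [s] is kept apart from the rate [a]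
    because the rates may be negative or zero: the alpha-integral wants [s > a] or [s = a > 0], the
    bracket in [|t - r|] wants [s >= 0], and a power gain in the sigma-integral wants [p s < 1]. *)

Lemma integral_primitive (f F : R -> R) (a b : R) : a <= b ->
  (forall x : R, a <= x <= b -> is_derive x 1 F (f x)) ->
  (forall x : R, a <= x <= b -> {for x, continuous f}) ->
  (\int[mu]_(x in `[a, b]) (f x)%:E = (F b - F a)%:E)%E.
Proof.
rewrite le_eqVlt => /predU1P[<- _ _|ab dF cf].
  by rewrite set_itv1 integral_set1 subrr.
have cF x : a <= x <= b -> {for x, continuous F}.
  move=> /dF h; apply/differentiable_continuous/derivable1_diffP.
  exact: ex_derive.
rewrite EFinB; apply: continuous_FTC2 => //.
- apply: continuous_in_subspaceT => x /[!inE]/=; rewrite in_itv/= => xab.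
  exact: cf.
- split.
  + move=> x; rewrite in_itv/= => /andP[ax xb].
    by apply: ex_derive; apply: dF; rewrite !ltW.
  + by apply: cvg_at_right_filter; apply: cF; rewrite lexx ltW.
  + by apply: cvg_at_left_filter; apply: cF; rewrite lexx ltW.
- move=> x; rewrite in_itv/= => /andP[ax xb].
  by rewrite derive1E; apply: derive_val; apply: dF; rewrite !ltW.
Qed.

Lemma integral_primitive_shift (f F : R -> R) (c a b : R) : a <= b -> 0 < c + a ->
  (forall x : R, 0 < x -> is_derive x 1 F (f x)) ->
  (forall x : R, 0 < x -> {for x, continuous f}) ->
  (\int[mu]_(x in `[a, b]) (f (c + x))%:E = (F (c + b) - F (c + a))%:E)%E.
Proof.
move=> ab ca dF cf.
apply: (@integral_primitive (fun x => f (c + x)) (fun x => F (c + x))) => //.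
- move=> x /andP[ax xb].
  have h : is_derive (c + x) 1 F (f (c + x)) by apply: dF; lra.
  have k : is_derive x (1 : R) (fun x : R => c + x) 1.
    have := is_deriveD (is_derive_cst c x (1 : R)) (is_derive_id x (1 : R)).
    by rewrite add0r.
  have := is_derive1_comp h k; by rewrite mulr1.
- move=> x /andP[ax xb]; apply: continuous_comp.
    by apply: cvgD; [exact: cvg_cst|exact: cvg_id].
  by apply: cf; lra.
Qed.

Lemma integral_primitive_refl (f F : R -> R) (c a b : R) : a <= b -> 0 < c - b ->
  (forall x : R, 0 < x -> is_derive x 1 F (f x)) ->
  (forall x : R, 0 < x -> {for x, continuous f}) ->
  (\int[mu]_(x in `[a, b]) (f (c - x))%:E = (F (c - a) - F (c - b))%:E)%E.
Proof.
move=> ab ca dF cf.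
rewrite (_ : F _ - F _ = - F (c - b) - - F (c - a)); last by rewrite opprK addrC.
apply: (@integral_primitive (fun x => f (c - x)) (fun x => - F (c - x))) => //.
- move=> x /andP[ax xb].
  have h : is_derive (c - x) 1 F (f (c - x)) by apply: dF; lra.
  have k : is_derive x (1 : R) (fun x : R => c - x) (- 1).
    have := is_deriveB (is_derive_cst c x (1 : R)) (is_derive_id x (1 : R)).
    by rewrite add0r.
  have := is_deriveN (@is_derive1_comp _ F (fun x => c - x) _ _ _ h k);
      by rewrite mulrN1 opprK.
- move=> x /andP[ax xb]; apply: continuous_comp.
    by apply: cvgB; [exact: cvg_cst|exact: cvg_id].
  by apply: cf; lra.
Qed.

Lemma powR_continuous_pos (c x : R) : 0 < x -> {for x,
    continuous (fun y : R => y `^ c)}.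
Proof.
move=> x0; apply/differentiable_continuous/derivable1_diffP.
by apply: ex_derive; exact: is_derive1_powR.
Qed.

Lemma is_derive_primitive_powR (c x : R) : c != -1 -> 0 < x ->
  is_derive x 1 (fun x : R => x `^ (c + 1) / (c + 1)) (x `^ c).
Proof.
move=> c1 x0; have c1' : c + 1 != 0 by rewrite addr_eq0.
have h := is_derive1_powR (c + 1) x0.
have := @is_deriveZ _ _ _ _ (c + 1)^-1 _ _ _ h.
rewrite addrK /GRing.scale/= mulrA mulVf// mul1r.
by congr is_derive; apply/funext => y; rewrite mulrC.
Qed.

End Primitives.

(** * Inequalities for real powers *)

Section PowR.
Context {R : realType}.
Implicit Types (a b c e s x y z : R).

Lemma bracket_gt0 x : 0 <= x -> 0 < 1 + x.
Proof. by move=> x0; rewrite ltr_wpDr. Qed.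

Lemma dist_le_add x y : 0 <= x -> 0 <= y -> `|x - y| <= x + y.
Proof. by move=> x0 y0; rewrite ler_norml; apply/andP; split; lra. Qed.

Lemma add_sub_dist_le x y : x + y - `|x - y| <= 2 * y.
Proof. by have := ler_norm (x - y); lra. Qed.

Lemma powRD_gt0 x a b : 0 < x -> x `^ (a + b) = x `^ a * x `^ b.
Proof. by move=> x0; rewrite powRD//; apply/implyP => _; rewrite gt_eqF. Qed.

Lemma powR_antitone x y c : 0 < x -> x <= y -> c <= 0 -> y `^ c <= x `^ c.
Proof.
move=> x0 xy c0; rewrite -[c]opprK !(powRN _ (- c)).
have y0 := lt_le_trans x0 xy.
rewrite lef_pV2 ?posrE ?powR_gt0//.
by apply: ge0_ler_powR; rewrite ?nnegrE ?oppr_ge0// ltW.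
Qed.

Lemma powR_monotone x y c : 0 <= x -> x <= y -> 0 <= c -> x `^ c <= y `^ c.
Proof.
move=> x0 xy c0; apply: ge0_ler_powR; rewrite ?nnegrE//.
exact: le_trans xy.
Qed.

Lemma powR_ge1 x c : 1 <= x -> 0 <= c -> 1 <= x `^ c.
Proof. by move=> x1 c0; rewrite -[leLHS](powRr0 x) ler_powR. Qed.

Lemma powR_le1 x c : 1 <= x -> c <= 0 -> x `^ c <= 1.
Proof. by move=> x1 c0; rewrite -[leRHS](powRr0 x) ler_powR. Qed.

Lemma mul_powR_succ x c : 0 < x -> x * x `^ c = x `^ (1 + c).
Proof. by move=> x0; rewrite powRD_gt0// powRr1// ltW. Qed.

(** The function is [y / (1 + y)] times [(1 + y)^(1 - e)], a product of two nonnegative increasing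
    factors. *)
Lemma mul_powR1D_mono x m e : 0 <= x -> x <= m -> 0 <= e <= 1 ->
  x * (1 + x) `^ (- e) <= m * (1 + m) `^ (- e).
Proof.
move=> x0 xm /andP[e0 e1].
have E y : 0 <= y -> y * (1 + y) `^ (- e) = y / (1 + y) * (1 + y) `^ (1 - e).
  move=> y0; rewrite powRD_gt0; last lra.
  by rewrite powRr1 ?addr_ge0// mulrA divfK//; lra.
rewrite !E//; last exact: le_trans xm.
apply: ler_pM; rewrite ?powR_ge0//.
- by apply: divr_ge0; lra.
- rewrite ler_pdivrMr; last lra.
  rewrite mulrAC ler_pdivlMr; last lra.
  by rewrite !mulrDr !mulr1 [m * x]mulrC lerD2r.
- by apply: powR_monotone; lra.
Qed.

(* The first difference quotient of a negative power is controlled by Bernoulli's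
   inequality for the integer exponent above it. *)
Lemma powRN_sub_le a : 0 < a -> exists2 C : R, 0 < C &
  forall z x, 0 < z -> z <= x ->
    (z `^ (- a) - x `^ (- a)) / a <= C * ((x - z) * x^-1 * z `^ (- a)).
Proof.
move=> a0; pose n := (Num.truncn a).+1.
have an : a <= n%:R by apply: ltW; rewrite truncnS_gt.
exists (n%:R / a); first by rewrite divr_gt0// ltr0n.
move=> z x z0 zx.
have x0 := lt_le_trans z0 zx.
have bern (u : R) k : 0 <= u <= 1 -> 1 - u ^+ k <= k%:R * (1 - u).
  move=> /andP[u0 u1]; elim: k => [|k ih]; first by rewrite expr0 subrr mul0r.
  rewrite exprS -natr1 mulrDl mul1r.
  have : u ^+ k <= 1 by exact: exprn_ile1.
  nra.
(* After division by [z^(-a)] the claim reads [1 - u^a <= n (1 - u)]; as [u <= 1] and [a <= n], the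
   left side is at most [1 - u^n]. *)
pose u := z / x.
have u01 : 0 < u <= 1 by rewrite divr_gt0//= ler_pdivrMr// mul1r.
have [u0 u1] := andP u01.
have ua : u ^+ n <= u `^ a.
  by rewrite -powR_mulrn ?(ltW u0)//; exact: (ger_powR u01 an).
have xz : x `^ (- a) = z `^ (- a) * u `^ a.
  rewrite /u powRM ?invr_ge0 ?ltW// mulrA -powRD_gt0// addNr powRr0 mul1r.
  by rewrite -powR_inv1 ?ltW// -powRrM mulN1r.
rewrite xz -{1}[z `^ _]mulr1 -mulrBr.
rewrite (_ : (x - z) * x^-1 = 1 - u); last first.
  by rewrite mulrBl mulfV// gt_eqF.
rewrite (_ : n%:R / a * _ = z `^ (- a) * (n%:R * (1 - u)) / a); last by ring.
rewrite ler_pM2r ?invr_gt0// ler_pM2l ?powR_gt0//.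
apply: le_trans (bern u n _); first lra.
by rewrite (ltW u0).
Qed.
End PowR.

(** * Integrals of brackets between two characteristics *)

Section Brackets.
Context {R : realType}.
Notation mu := (@lebesgue_measure R).
Implicit Types (a b c e s x y z A B m theta : R).

Lemma measurable_bracket (c : R) d (T : measurableType d) (D : set T)
    (g : T -> R) : measurable_fun D g ->
  measurable_fun D (fun v => (1 + `|g v|) `^ c).
Proof.
move=> mg; apply: (measurableT_comp (measurable_powR c)).
by apply: measurable_funD => //; exact: measurableT_comp.
Qed.

Lemma ge0_le_integralZ d (T : measurableType d)
    (nu : {measure set T -> \bar R}) (D : set T) (f g : T -> R) (k : R) :
  measurable D -> measurable_fun D f -> measurable_fun D g -> 0 <= k ->
  (forall v, D v -> 0 <= g v) -> (forall v, D v -> 0 <= f v <= k * g v) ->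
  (\int[nu]_(v in D) (f v)%:E <= k%:E * \int[nu]_(v in D) (g v)%:E)%E.
Proof.
move=> mD mf mg k0 g0 fg.
rewrite -ge0_integralZl//; last exact/measurable_EFinP.
apply: ge0_le_integral => //.
- by move=> v /fg /andP[? _]; rewrite lee_fin.
- exact/measurable_EFinP.
- by apply/measurable_EFinP; exact: measurable_funM.
- by move=> v /fg /andP[_ ?]; rewrite -EFinM lee_fin.
Qed.

Lemma measurable_bracketD (c : R) (D : set R) : measurable_fun D (fun y : R => (1 +
    y) `^ c).
Proof.
apply: (measurableT_comp (measurable_powR c)).
by apply: measurable_funD.
Qed.

(** Write [x^(1-e) - z^(1-e)] as [x x^(-e) - z z^(-e)] and replace [z^(-e)] by the smaller [x^(-e)].
    Keeping the length [x - z] matters: with [x - z = A - B <= 2 r] it becomes the factor [r] of the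
    weights. *)
Lemma powR_primitive_le e x z : 0 <= e < 1 -> 0 < z -> z <= x ->
  x `^ (- e + 1) / (- e + 1) - z `^ (- e + 1) / (- e + 1) <=
  (1 - e)^-1 * ((x - z) * x `^ (- e)).
Proof.
move=> /andP[e0 e1] z0 zx; have x0 := lt_le_trans z0 zx.
rewrite -mulrBl mulrC (addrC (- e)) ler_pM2l ?invr_gt0; last lra.
rewrite -!mul_powR_succ// mulrBl lerB// ler_pM2l//.
by apply: powR_antitone => //; lra.
Qed.

Lemma integral_powR_shift (d c : R) (a b : R) : a <= b -> 0 < d + a -> c != -1 ->
  (\int[mu]_(x in `[a, b]) ((d + x) `^ c)%:E =
   ((d + b) `^ (c + 1) / (c + 1) - (d + a) `^ (c + 1) / (c + 1))%:E)%E.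
Proof.
move=> ab da c1.
apply: (@integral_primitive_shift _ (fun x => x `^ c)
  (fun x => x `^ (c + 1) / (c + 1))) => // x x0.
- exact: is_derive_primitive_powR.
- exact: powR_continuous_pos.
Qed.

Lemma integral_powR_refl (d c : R) (a b : R) : a <= b -> 0 < d - b -> c != -1 ->
  (\int[mu]_(x in `[a, b]) ((d - x) `^ c)%:E =
   ((d - a) `^ (c + 1) / (c + 1) - (d - b) `^ (c + 1) / (c + 1))%:E)%E.
Proof.
move=> ab da c1.
apply: (@integral_primitive_refl _ (fun x => x `^ c)
  (fun x => x `^ (c + 1) / (c + 1))) => // x x0.
- exact: is_derive_primitive_powR.
- exact: powR_continuous_pos.
Qed.

Lemma integral_bracket_lt1 e A B : 0 <= e < 1 -> 0 <= B -> B <= A ->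
  (\int[mu]_(y in `[B, A]) ((1 + y) `^ (- e))%:E <=
   ((1 - e)^-1 * ((A - B) * (1 + A) `^ (- e)))%:E)%E.
Proof.
move=> he B0 BA; have /andP[e0 e1] := he.
rewrite integral_powR_shift//; [|lra|lra].
rewrite lee_fin (_ : A - B = 1 + A - (1 + B)); last by ring.
by apply: powR_primitive_le => //; lra.
Qed.

Lemma integral_refl_bracket_lt1 e c m : 0 <= e < 1 -> 0 <= m -> m <= c ->
  (\int[mu]_(y in `[0%R, m]) ((1 + c - y) `^ (- e))%:E <=
   ((1 - e)^-1 * (m * (1 + c) `^ (- e)))%:E)%E.
Proof.
move=> he m0 mc; have /andP[e0 e1] := he.
rewrite integral_powR_refl//; [|lra|lra].
rewrite lee_fin subr0 [X in _ * (X * _)](_ : m = 1 + c - (1 + c - m)); last by ring.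
by apply: powR_primitive_le => //; lra.
Qed.

Lemma integral_bracket_gt1 a : 0 < a -> exists2 C : R, 0 < C &
  forall A B, 0 <= B -> B <= A ->
  (\int[mu]_(y in `[B, A]) ((1 + y) `^ (- 1 - a))%:E <=
   (C * ((A - B) * (1 + A)^-1 * (1 + B) `^ (- a)))%:E)%E.
Proof.
move=> a0; have [C C0 CP] := powRN_sub_le a0; exists C => // A B B0 BA.
rewrite integral_powR_shift//; [|lra|lra].
rewrite lee_fin (_ : A - B = 1 + A - (1 + B)); last by ring.
  rewrite (_ : -1 - a + 1 = - a); last by ring.
  rewrite invrN !mulrN opprK addrC -mulrBl.
  by apply: CP; lra.
Qed.

(* [a] is the decay rate along the light cone and [s] the part of it that is
   measured by the distance to the cone; [a = s] is only allowed for [0 < a]. *)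
Definition admissible a s :=
  [/\ 0 <= s, s <= 1 + a & a < s \/ (a = s /\ 0 < a)].

Definition coneweight a s t r : R :=
  r * (1 + (t + r)) `^ (- 1 - a + s) * (1 + `|t - r|) `^ (- s).

(** For [a < s] the part [(1 + y)^(-s)] of the integrand is estimated at [y = B], and what is left
    has an exponent in [(-1, 0]], so that its integral is governed by the upper end. For [a = s > 0]
    the bracket at [A] has exponent [-1] and the difference of negative powers applies. *)
Lemma integral_bracket_admissible a s : admissible a s ->
  exists2 C : R, 0 < C & forall A B, 0 <= B -> B <= A ->
  (\int[mu]_(y in `[B, A]) ((1 + y) `^ (- 1 - a))%:E <=
   (C * ((A - B) * (1 + A) `^ (- 1 - a + s) * (1 + B) `^ (- s)))%:E)%E.
Proof.
move=> [s0 sa [as1|[<- a0]]]; last first.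
  have [C C0 CP] := integral_bracket_gt1 a0; exists C => // A B B0 BA.
  rewrite (_ : - 1 - a + a = -1); last by ring.
  by rewrite powR_inv1; [exact: CP|lra].
exists (1 - (1 + a - s))^-1; first by rewrite invr_gt0; lra.
move=> A B B0 BA.
apply: (@le_trans _ _ (((1 + B) `^ (- s))%:E *
    \int[mu]_(y in `[B, A]) ((1 + y) `^ (- (1 + a - s)))%:E)%E).
  apply: ge0_le_integralZ => //.
  - exact: measurable_bracketD.
  - exact: measurable_bracketD.
  - exact: powR_ge0.
  - by move=> y _; exact: powR_ge0.
  - move=> y; rewrite /= in_itv/= => /andP[By yA]; rewrite powR_ge0/=.
    rewrite (_ : - 1 - a = - s + - (1 + a - s)); last by ring.
    rewrite powRD_gt0; last lra.
    by apply: ler_wpM2r; [exact: powR_ge0|apply: powR_antitone; lra].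
have he : 0 <= 1 + a - s < 1 by lra.
apply: le_trans (lee_wpmul2l _ (integral_bracket_lt1 he B0 BA)) _.
  by rewrite lee_fin powR_ge0.
rewrite -EFinM lee_fin (_ : - 1 - a + s = - (1 + a - s)); last by ring.
by rewrite le_eqVlt; apply/orP; left; apply/eqP; ring.
Qed.

End Brackets.

(** * Integrals across the light cone *)

Section ConeIntegrals.
Context {R : realType}.
Notation mu := (@lebesgue_measure R).
Implicit Types (a b c e s x y z A B m theta : R).

(** The variable [y] stands for the time sigma and [al] for the sum of time and radius, so
    [2 * y - al] is the signed distance to the cone. *)
Let coneJ theta al m :=
  (\int[mu]_(y in `[0%R, m]) ((1 + `|2 * y - al|) `^ (- theta))%:E)%E.

Lemma integral_inv_shift (d a b : R) : a <= b -> 0 < d + a ->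
  (\int[mu]_(x in `[a, b]) ((d + x) `^ (-1))%:E =
   (ln (d + b) - ln (d + a))%:E)%E.
Proof.
move=> ab da.
apply: (@integral_primitive_shift _ (fun x => x `^ (-1)) (@ln R)) => // x x0.
- by rewrite powR_inv1 ?ltW//; exact: is_derive1_ln.
- exact: powR_continuous_pos.
Qed.

Lemma integral_inv_refl (d a b : R) : a <= b -> 0 < d - b ->
  (\int[mu]_(x in `[a, b]) ((d - x) `^ (-1))%:E =
   (ln (d - a) - ln (d - b))%:E)%E.
Proof.
move=> ab da.
apply: (@integral_primitive_refl _ (fun x => x `^ (-1)) (@ln R)) => // x x0.
- by rewrite powR_inv1 ?ltW//; exact: is_derive1_ln.
- exact: powR_continuous_pos.
Qed.

(** The cone is crossed at [y = c]. On either side [|2 y - al|] is twice the distance of [y] to [c];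
    dropping the factor 2 only enlarges the integrand and leaves plain reflected and shifted
    powers. *)
Lemma coneJ_split theta al m (c := al / 2) (c' := Num.min m c) :
  0 <= theta -> 0 <= m -> m <= al ->
  (coneJ theta al m <=
    \int[mu]_(y in `[0%R, c']) ((1 + c - y) `^ (- theta))%:E +
    \int[mu]_(y in `[c', m]) ((1 - c' + y) `^ (- theta))%:E)%E.
Proof.
move=> th0 m0 mal.
have c'm : c' <= m by rewrite ge_min lexx.
have c'c : c' <= c by rewrite ge_min lexx orbT.
have c'0 : 0 <= c' by rewrite le_min m0/= /c; lra.
have mF (D : set R) : measurable_fun D (fun y : R => (1 + `|2 * y - al|) `^ (- theta)).
  by apply: measurable_bracket; apply: measurable_funB => //; exact: measurable_funM.
have mE (D : set R) (g : R -> R) : measurable_fun setT g ->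
    measurable_fun D (fun y : R => (g y) `^ (- theta)).
  move=> mg; apply: measurable_funTS.
  exact: (measurableT_comp (measurable_powR _)).
rewrite /coneJ; have -> : `[0, m]%classic = `[0, c']%classic `|` `]c',
    m]%classic :> set R.
  by rewrite -itv_bndbnd_setU// bnd_simp.
rewrite ge0_integral_setU//=; last 2 first.
- by apply/measurable_EFinP; exact: mF.
- apply/disj_setPS => y [] /=; rewrite !in_itv/= => /andP[_ h1] /andP[h2 _].
  by move: (le_lt_trans h1 h2); rewrite ltxx.
apply: leeD.
- rewrite -[leRHS]mul1e; apply: ge0_le_integralZ => //.
  + exact: mF.
  + by apply: mE; apply: measurable_funB.
  + by move=> y _; exact: powR_ge0.
  + move=> y; rewrite /= in_itv/= => /andP[y0 yc]; rewrite powR_ge0 mul1r/=.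
    apply: powR_antitone; rewrite ?oppr_le0//; first lra.
    have yc2 : y <= al / 2 by exact: le_trans yc c'c.
    by rewrite -addrA lerD2l distrC /c ger0_norm; lra.
- rewrite -[leRHS]mul1e.
  apply: (@le_trans _ _ (1%:E *
     \int[mu]_(y in `]c', m]) ((1 - c' + y) `^ (- theta))%:E)%E).
    apply: ge0_le_integralZ => //.
    + exact: mF.
    + by apply: mE; apply: measurable_funD.
    + by move=> y _; exact: powR_ge0.
    + move=> y; rewrite /= in_itv/= => /andP[y0 yc]; rewrite powR_ge0 mul1r/=.
      apply: powR_antitone; rewrite ?oppr_le0//; first lra.
      rewrite -addrA lerD2l.
      (* If [m <= c] the cone is not reached: [c' = m] and the second interval is empty. *)
      have [mc|cm] := leP m c; first by move: y0; rewrite /c' min_l//; lra.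
      have E : c' = al / 2 by rewrite /c' min_r// ltW.
      by rewrite E in y0 *; rewrite ger0_norm; lra.
  rewrite !mul1e; apply: ge0_subset_integral => //=.
  + by apply/measurable_EFinP; apply: mE; apply: measurable_funD.
  + by move=> y _; rewrite lee_fin powR_ge0.
  + by apply: subset_itvr; rewrite bnd_simp.
Qed.

(** Each side of the cone contributes its length times the bracket at its far end. Below the cone
    this bracket is at least [1 + al / 2]; above it, monotonicity of [x (1 + x)^(-theta)] replaces
    [m - c'] by [m], which then exceeds [al / 2]. The factor [m], rather than [al], keeps the gain
    bounded by the elapsed time. *)
Lemma coneJ_lt1 theta : 0 <= theta < 1 -> exists2 C : R, 0 < C &
  forall al m, 0 <= m -> m <= al ->
  (coneJ theta al m <= (C * (m * (1 + al) `^ (- theta)))%:E)%E.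
Proof.
move=> th; have /andP[th0 th1] := th.
exists (4 * (1 - theta)^-1); first by rewrite mulr_gt0// invr_gt0; lra.
move=> al m m0 mal; pose c := al / 2; pose c' := Num.min m c.
have c'm : c' <= m by rewrite ge_min lexx.
have c'c : c' <= c by rewrite ge_min lexx orbT.
have c'0 : 0 <= c' by rewrite le_min m0/= /c; lra.
apply: (le_trans (coneJ_split th0 m0 mal)); rewrite -/c -/c'.
have := integral_refl_bracket_lt1 th c'0 c'c.
rewrite integral_powR_shift//; [|lra|lra].
rewrite (_ : 1 - c' + m = 1 + (m - c')); last by ring.
rewrite subrK => h.
apply: le_trans (leeD h (le_refl _)) _; rewrite -EFinD lee_fin.
have := @powR_primitive_le _ theta (1 + (m - c')) 1 th ltr01.
rewrite lerDl subr_ge0 => /(_ c'm) h2.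
apply: le_trans (lerD (le_refl _) h2) _.
rewrite -mulrDr [leRHS]mulrAC [leRHS]mulrC ler_pM2l ?invr_gt0; last lra.
have half y : al / 2 <= y -> (1 + y) `^ (- theta) <= 2 * (1 + al) `^ (- theta).
  move=> aly; apply: (@le_trans _ _ ((2^-1 * (1 + al)) `^ (- theta))).
    by apply: powR_antitone; lra.
  rewrite powRM; [|lra|lra]; apply: ler_wpM2r; first exact: powR_ge0.
  rewrite -powR_inv1// -powRrM mulN1r opprK.
  by apply: ler1_powR; lra.
have k1 : c' * (1 + c) `^ (- theta) <= m * (2 * (1 + al) `^ (- theta)).
  apply: ler_pM => //; first exact: powR_ge0.
  by apply: half; rewrite /c.
have k2 : (1 + (m - c') - 1) * (1 + (m - c')) `^ (- theta) <=
          m * (2 * (1 + al) `^ (- theta)).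
  rewrite (_ : 1 + (m - c') - 1 = m - c'); last by ring.
  have [mc|cm] := leP m c.
    rewrite /c' min_l// subrr mul0r; apply: mulr_ge0 => //.
    by apply: mulr_ge0 => //; exact: powR_ge0.
  apply: (@le_trans _ _ (m * (1 + m) `^ (- theta))).
    by apply: mul_powR1D_mono; lra.
  by apply: ler_wpM2l => //; apply: half; move: cm; rewrite /c; lra.
lra.
Qed.

(** The logarithm is taken of [1 + m] and not of [1 + al]: later [m <= T], whereas [al] grows with
    [r]. Below the cone this rests on [1 + c <= (1 + m) (1 + c - c')]. *)
Lemma coneJ_eq1 al m : 0 <= m -> m <= al ->
  (coneJ 1 al m <= (2 * ln (1 + m))%:E)%E.
Proof.
move=> m0 mal; pose c := al / 2; pose c' := Num.min m c.
have c'm : c' <= m by rewrite ge_min lexx.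
have c'c : c' <= c by rewrite ge_min lexx orbT.
have c'0 : 0 <= c' by rewrite le_min m0/= /c; lra.
apply: (le_trans (coneJ_split ler01 m0 mal)); rewrite -/c -/c'.
rewrite integral_inv_refl//; last lra.
rewrite integral_inv_shift//; last lra.
rewrite subr0 subrK ln1 subr0 -EFinD lee_fin.
have h1 : ln (1 + c) - ln (1 + c - c') <= ln (1 + m).
  rewrite lerBlDr -lnM ?posrE; [|lra|lra].
  by rewrite ler_ln ?posrE; nra.
have h2 : ln (1 - c' + m) <= ln (1 + m) by rewrite ler_ln ?posrE; lra.
lra.
Qed.

Lemma coneJ_gt1 theta : 1 < theta -> exists2 C : R, 0 < C &
  forall al m, 0 <= m -> m <= al -> (coneJ theta al m <= C%:E)%E.
Proof.
move=> th1; exists (2 / (theta - 1)); first by rewrite divr_gt0//; lra.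
move=> al m m0 mal; pose c := al / 2; pose c' := Num.min m c.
have c'm : c' <= m by rewrite ge_min lexx.
have c'c : c' <= c by rewrite ge_min lexx orbT.
have c'0 : 0 <= c' by rewrite le_min m0/= /c; lra.
apply: (le_trans (coneJ_split (ltW (lt_trans ltr01 th1)) m0 mal)).
rewrite -/c -/c'.
rewrite integral_powR_refl//; [|lra|lra].
rewrite integral_powR_shift//; [|lra|lra].
rewrite -EFinD lee_fin (_ : - theta + 1 = - (theta - 1)); last by ring.
rewrite invrN !mulrN !opprK.
have th0 : 0 < (theta - 1)^-1 by rewrite invr_gt0; lra.
have P x : 1 <= x -> 0 <= x `^ (- (theta - 1)) / (theta - 1) <= (theta - 1)^-1.
  move=> x1; rewrite mulr_ge0 ?powR_ge0 ?(ltW th0)//=.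
  by rewrite ler_piMl ?(ltW th0)//; apply: powR_le1 => //; lra.
have /andP[a1 a2] : 0 <= (1 + c - 0) `^ (- (theta - 1)) / (theta - 1) <=
    (theta - 1)^-1 by apply: P; lra.
have /andP[a3 a4] : 0 <= (1 + c - c') `^ (- (theta - 1)) / (theta - 1) <=
    (theta - 1)^-1 by apply: P; lra.
have /andP[a5 a6] : 0 <= (1 - c' + m) `^ (- (theta - 1)) / (theta - 1) <=
    (theta - 1)^-1 by apply: P; lra.
have /andP[a7 a8] : 0 <= (1 - c' + c') `^ (- (theta - 1)) / (theta - 1) <=
    (theta - 1)^-1 by apply: P; lra.
by rewrite mulr_natl; lra.
Qed.

(* Away from [y = al] the factor [(1 + al - y)^e] is of size [(1 + al)^e], and
   near [y = al] the other factor is of size [(1 + al)^-theta]. *)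
Lemma integral_cone_le e theta : - 1 < e -> 0 <= theta ->
  exists2 C : R, 0 < C & forall al m J, 0 <= m -> m <= al ->
  (coneJ theta al m <= J%:E)%E ->
  (\int[mu]_(y in `[0%R, m])
     ((1 + `|al - y|) `^ e * (1 + `|2 * y - al|) `^ (- theta))%:E <=
  (C * ((1 + al) `^ e * J + m * (1 + al) `^ (e - theta)))%:E)%E.
Proof.
(* Only a negative [e] makes [(1 + al - y)^e] large near [y = al]; [e0] lets both signs share the
   same majorants [f1] and [f2]. *)
move=> e1 th0; pose e0 := Num.min e 0.
have e0e : e0 <= e by rewrite ge_min lexx.
have e00 : e0 <= 0 by rewrite ge_min lexx orbT.
have e01 : -1 < e0 by rewrite lt_min e1/=; lra.
(* The cut is at [y = 3/4 al]: below it [1 + al - y] is at least a quarter of [1 + al], which costs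
   [K] when [e < 0]; above it [2 y - al >= al / 2], which costs [L]. The factor [M] comes from
   integrating the power [e0 > -1]. *)
pose K := 4 `^ (- e0); pose L : R := 2 `^ theta; pose M := (1 + e0)^-1.
have K1 : 1 <= K by apply: powR_ge1; lra.
have L1 : 1 <= L by apply: powR_ge1; lra.
have M1 : 0 < M by rewrite invr_gt0; lra.
exists (K + L * M); first by apply: addr_gt0; [lra|apply: mulr_gt0; lra].
move=> al m J m0 mal hJ.
have J0 : 0 <= J.
  rewrite -lee_fin; apply: le_trans hJ; apply: integral_ge0 => y _.
  by rewrite lee_fin powR_ge0.
have mF (D : set R) c (g : R -> R) : measurable_fun D g ->
    measurable_fun D (fun y : R => (1 + `|g y|) `^ c).
  by move=> mg; exact: measurable_bracket.
have m1 (D : set R) : measurable_fun D (fun y : R => 2 * y - al).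
  by apply: measurable_funB => //; exact: measurable_funM.
have m2 (D : set R) : measurable_fun D (fun y : R => al - y).
  by apply: measurable_funB.
pose f1 y := K * (1 + al) `^ e * (1 + `|2 * y - al|) `^ (- theta).
pose f2 y := L * (1 + al) `^ (- theta) * (1 + `|al - y|) `^ (- (- e0)).
have f10 y : 0 <= f1 y by rewrite !mulr_ge0 ?powR_ge0//; lra.
have f20 y : 0 <= f2 y by rewrite !mulr_ge0 ?powR_ge0//; lra.
have mf1 (D : set R) : measurable_fun D f1 by apply: measurable_funM => //; exact: mF.
have mf2 (D : set R) : measurable_fun D f2 by apply: measurable_funM => //; exact: mF.
apply: (@le_trans _ _ (1%:E * \int[mu]_(y in `[0%R, m]) (f1 y + f2 y)%:E)%E).
  apply: ge0_le_integralZ => //.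
  - apply: measurable_funM; [apply: mF; exact: m2|apply: mF; exact: m1].
  - by apply: measurable_funD; [exact: mf1|exact: mf2].
  - by move=> y _; rewrite addr_ge0.
  - move=> y; rewrite /= in_itv/= => /andP[y0 ym].
    rewrite mulr_ge0 ?powR_ge0// mul1r/=.
    rewrite ger0_norm; last lra.
    have [ye|ye] := leP y (3 / 4 * al).
    + apply: (@le_trans _ _ (f1 y)); last by rewrite lerDl.
      rewrite /f1; apply: ler_wpM2r; first exact: powR_ge0.
      have [ege0|elt0] := leP 0 e.
        apply: (@le_trans _ _ ((1 + al) `^ e)); first by apply: powR_monotone; lra.
        by rewrite ler_peMl// powR_ge0.
      have -> : K = (4^-1) `^ e.
        rewrite /K /e0 min_l ?(ltW elt0)// -[4^-1]powR_inv1//.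
        by rewrite -powRrM mulN1r.
      rewrite -powRM; [|lra|lra].
      by apply: powR_antitone; lra.
    + apply: (@le_trans _ _ (f2 y + f1 y)); last by rewrite addrC.
      have h : (1 + `|2 * y - al|) `^ (- theta) <= L * (1 + al) `^ (- theta).
        have -> : L = (2^-1) `^ (- theta).
          by rewrite /L -[2^-1]powR_inv1// -powRrM mulN1r opprK.
        rewrite -powRM; [|lra|lra].
        apply: powR_antitone; rewrite ?oppr_le0//; first lra.
        by rewrite ger0_norm; lra.
      have [ege0|elt0] := leP 0 e.
        apply: (@le_trans _ _ (f1 y)); last by rewrite lerDr.
        rewrite /f1; apply: ler_wpM2r; first exact: powR_ge0.
        apply: (@le_trans _ _ ((1 + al) `^ e)); first by apply: powR_monotone; lra.
        by rewrite ler_peMl// powR_ge0.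
      apply: (@le_trans _ _ (f2 y)); last by rewrite lerDl.
      rewrite /f2 [leRHS]mulrC opprK /e0 min_l ?(ltW elt0)//.
      rewrite (ger0_norm (_ : 0 <= al - y)); last lra.
      by apply: ler_wpM2l => //; exact: powR_ge0.
rewrite mul1e.
under eq_integral do rewrite EFinD.
rewrite ge0_integralD//; last 4 first.
- by move=> y _; rewrite lee_fin.
- by apply/measurable_EFinP; exact: mf1.
- by move=> y _; rewrite lee_fin.
- by apply/measurable_EFinP; exact: mf2.
have h1 : (\int[mu]_(y in `[0%R, m]) (f1 y)%:E <= (K * (1 + al) `^ e * J)%:E)%E.
  have k0 : 0 <= K * (1 + al) `^ e by rewrite mulr_ge0 ?powR_ge0//; lra.
  have k0' := k0; rewrite -lee_fin in k0'.
  rewrite EFinM; apply: (le_trans _ (lee_wpmul2l k0' hJ)).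
  apply: ge0_le_integralZ => //.
  - exact: mf1.
  - by apply: mF; exact: m1.
  - by move=> y _; rewrite f10/=.
have h2 : (\int[mu]_(y in `[0%R, m]) (f2 y)%:E <=
    (L * (1 + al) `^ (- theta) * (M * (m * (1 + al) `^ e0)))%:E)%E.
  have k0 : 0 <= L * (1 + al) `^ (- theta) by rewrite mulr_ge0 ?powR_ge0//; lra.
  have he0 : 0 <= - e0 < 1 by lra.
  have := integral_refl_bracket_lt1 he0 m0 mal; rewrite opprK => hh.
  have k0' := k0; rewrite -lee_fin in k0'.
  rewrite EFinM; apply: (le_trans _ (lee_wpmul2l k0' hh)).
  apply: ge0_le_integralZ => //.
  - exact: mf2.
  - apply: (measurableT_comp (measurable_powR _)); exact: measurable_funB.
  - by move=> y _; exact: powR_ge0.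
  - move=> y; rewrite /= in_itv/= => /andP[y0 ym]; rewrite f20/= /f2 opprK.
    by rewrite ger0_norm ?addrA//; lra.
apply: le_trans (leeD h1 h2) _; rewrite -EFinD lee_fin.
have -> : L * (1 + al) `^ (- theta) * (M * (m * (1 + al) `^ e0)) =
    L * M * (m * (1 + al) `^ (e0 - theta)).
  by rewrite powRD_gt0; [ring|lra].
have mono : m * (1 + al) `^ (e0 - theta) <= m * (1 + al) `^ (e - theta).
  by apply: ler_wpM2l => //; apply: ler_powR; lra.
set X := m * _ in mono *; set Y := m * _ in mono *.
have Y0 : 0 <= X by rewrite mulr_ge0 ?powR_ge0.
set Z := (1 + al) `^ e; have Z0 : 0 <= Z * J by rewrite mulr_ge0 ?powR_ge0.
have LM0 : 0 < L * M by apply: mulr_gt0; lra.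
rewrite -mulrA mulrDl !mulrDr.
have : L * M * X <= L * M * Y by rewrite ler_pM2l.
have : 0 <= K * Y by apply: mulr_ge0; lra.
have : 0 <= L * M * (Z * J) by apply: mulr_ge0; lra.
lra.
Qed.

End ConeIntegrals.

(** * Domain of dependence *)

Section ShearedTonelli.
Context {R : realType}.
Notation mu := (@lebesgue_measure R).
Notation mu2 := (mu \x mu)%E.

Lemma lebesgue_measure_shift (c : R) (A : set R) : measurable A ->
  mu ((fun x => c + x) @^-1` A) = mu A.
Proof.
have mc : measurable_fun setT ((fun x => c + x) : measurableTypeR R ->
    measurableTypeR R).
  exact: measurable_funD.
move=> mA; apply/esym.
apply: (@lebesgue_measure_unique _ (pushforward mu ((fun x => c +
    x) : measurableTypeR R -> measurableTypeR R))) => //= _ [[a b]] _ <-.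
rewrite /pushforward.
rewrite (_ : _ @^-1` _ = `]a - c, b - c]%classic); last first.
  apply/seteqP; split=> x /=; rewrite !in_itv/= => /andP[h1 h2].
    by apply/andP; split; lra.
  by apply/andP; split; lra.
rewrite !lebesgue_measure_itv/= !lte_fin ltrD2r.
by case: ifP => // _; rewrite -!EFinB; congr EFin; ring.
Qed.

Lemma ge0_integral_shift (c : R) (f : R -> \bar R) :
  measurable_fun setT f -> (forall x, 0 <= f x)%E ->
  (\int[mu]_x f (c + x)%R = \int[mu]_x f x)%E.
Proof.
move=> mf f0.
pose sh := (fun x => c + x) : measurableTypeR R -> measurableTypeR R.
have mc : measurable_fun setT sh by exact: measurable_funD.
have := @ge0_integral_pushforward _ _ _ _ R sh mc mu setT f measurableT mf.
rewrite preimage_setT => <-; last by move=> y _; exact: f0.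
by apply: eq_measure_integral => A mA _; exact: lebesgue_measure_shift.
Qed.

Lemma measurable_set_lt d (T : measurableType d) (g h : T -> R) :
  measurable_fun setT g -> measurable_fun setT h ->
  measurable [set z | g z < h z].
Proof.
move=> mg mh; have mgh : measurable_fun setT (fun z => g z < h z).
  exact: measurable_fun_ltr.
by have := mgh measurableT [set true] I; rewrite setTI.
Qed.

Lemma measurable_set_le d (T : measurableType d) (g h : T -> R) :
  measurable_fun setT g -> measurable_fun setT h ->
  measurable [set z | g z <= h z].
Proof.
move=> mg mh; have mgh : measurable_fun setT (fun z => g z <= h z).
  exact: measurable_fun_ler.
by have := mgh measurableT [set true] I; rewrite setTI.
Qed.

Lemma measurable_Delta_minus (t r : R) : measurable (Delta_minus t r).
Proof.
rewrite (_ : Delta_minus t r = [set z | 0 < z.1] `&` [set z | 0 < z.2] `&`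
  [set z | `|t - r| < z.1 + z.2] `&` [set z | z.1 + z.2 < t + r] `&`
  [set z | z.1 - z.2 < t - r]); last first.
  by apply/seteqP; split => z /=; rewrite /Delta_minus/=;
    [move=> [? ? /andP[? ?] ?]|move=> [[[[? ?] ?] ->] ?]; split => //; apply/andP].
have m1 := @measurable_fst _ _ R R; have m2 := @measurable_snd _ _ R R.
by repeat apply: measurableI; apply: measurable_set_lt => //;
  [exact: measurable_funD|exact: measurable_funD|exact: measurable_funB].
Qed.

(* The shear [(sigma, y) |-> (sigma, sigma + y)] preserves Lebesgue measure, and
   [sigma < t] on [Delta_minus t r]. *)
Lemma integral_Delta_minus_le (f : R * R -> R) (h : R -> R) (t r : R) :
  0 <= t -> 0 < r -> measurable_fun setT f -> (forall z, 0 <= f z) ->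
  measurable_fun setT h ->
  (forall al, `|t - r| <= al <= t + r ->
    (\int[mu]_(sg in `[0%R, Num.min al t]) (f (sg, al))%:E <= (h al)%:E)%E) ->
  (\int[mu2]_(z in Delta_minus t r) (f (z.1, z.1 + z.2))%:E <=
   \int[mu]_(al in `[(`|t - r|)%R, (t + r)%R]) (h al)%:E)%E.
Proof.
move=> t0 r0 mf f0 mh fh.
have m1 := @measurable_fst _ _ R R; have m2 := @measurable_snd _ _ R R.
pose S : set (R * R) := [set z | `|t - r| <= z.2] `&` [set z | z.2 <= t + r] `&`
  [set z | 0 <= z.1] `&` [set z | z.1 <= Num.min z.2 t].
have mS : measurable S.
  by repeat apply: measurableI; apply: measurable_set_le => //;
    exact: measurable_minr.
pose F : R * R -> \bar R := (fun z => (f z)%:E) \_ S.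
have F0 z : (0 <= F z)%E.
  by rewrite /F patchE; case: ifP => // _; rewrite lee_fin.
have mF : measurable_fun setT F.
  by apply/(measurable_restrictT _ mS)/measurable_EFinP; exact: measurable_funTS.
have msh : measurable_fun setT (fun z : R * R => (z.1, z.1 + z.2)).
  by apply/measurable_fun_pair => //; exact: measurable_funD.
have mFsh : measurable_fun setT (fun z : R * R => F (z.1, z.1 + z.2)).
  exact: (measurableT_comp mF msh).
apply: (@le_trans _ _ (\int[mu2]_z F (z.1, (z.1 + z.2)%R))%E).
  apply: (@le_trans _ _ (\int[mu2]_(z in Delta_minus t r) F (z.1, (z.1 + z.2)%R))%E).
    apply: ge0_le_integral => //.
    - exact: measurable_Delta_minus.
    - by move=> z _; rewrite lee_fin.
    - apply/measurable_EFinP; apply: measurable_funTS.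
      exact: (measurableT_comp mf msh).
    - exact: measurable_funTS.
    - move=> z [h1 h2 /andP[h3 h4] h5]; rewrite /F patchE mem_set//.
      split; last by rewrite /= le_min; apply/andP; split; lra.
      by split; [split; exact: ltW|exact: ltW].
  apply: ge0_subset_integral => //.
  exact: measurable_Delta_minus.
have shift x : (\int[mu]_y F (x, (x + y)%R) = \int[mu]_y F (x, y))%E.
  apply: (@ge0_integral_shift x (fun al => F (x, al))) => //.
  exact: measurableT_comp.
have -> : (\int[mu2]_z F (z.1, (z.1 + z.2)%R) =
           \int[mu]_al \int[mu]_sg F (sg, al))%E.
  rewrite fubini_tonelli1//.
  transitivity (\int[mu]_x \int[mu]_y F (x, y))%E.
    by apply: eq_integral => x _; exact: shift.
  exact: fubini_tonelli.
have mI : measurable (`[(`|t - r|)%R, (t + r)%R] : set R) by exact: measurable_itv.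
rewrite [leRHS]integral_mkcond; apply: ge0_le_integral => //.
- by move=> al _; exact: integral_ge0.
- have := @measurable_fun_fubini_tonelli_G _ _ _ _ R mu F mF F0; exact.
- apply/(measurable_restrictT _ mI)/measurable_EFinP; exact: measurable_funTS.
move=> al _; rewrite patchE.
case: ifPn => [|/negP]; rewrite inE/= in_itv/= => hal.
  have [h1 h2] := andP hal.
  apply: le_trans (fh al hal); rewrite le_eqVlt; apply/orP; left; apply/eqP.
  rewrite [RHS]integral_mkcond; apply: eq_integral => sg _.
  rewrite /F !patchE; case: ifPn => [|/negP]; rewrite inE => hS.
    case: hS => -[_ /= h3] h4.
    by rewrite mem_set//= in_itv/= h3.
  case: ifPn => //; rewrite inE/= in_itv/= => /andP[h3 h4].
  by exfalso; apply: hS.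
rewrite le_eqVlt; apply/orP; left; apply/eqP.
apply: integral0_eq => sg _; rewrite /F patchE; case: ifPn => //.
rewrite inE => -[[[/= h1 h2] _] _]; exfalso; apply: hal.
by rewrite h1.
Qed.

End ShearedTonelli.

(** * Duhamel operator and Picard iteration *)

Section PlaneTopology.
Context {R : realType}.

(** The sigma-algebra of the product is the one generated by rectangles, so an open set has to be
    exhibited as the countable union of the rational boxes that it contains. *)
Lemma open_measurable_prod (U : set (R * R)) : open U -> measurable U.
Proof.
move=> oU.
pose box (q : rat * rat * (rat * rat)) : set (R * R) :=
  `]ratr q.1.1, ratr q.1.2[%classic `*` `]ratr q.2.1, ratr q.2.2[%classic.
rewrite (_ : U = \bigcup_q (if `[< box q `<=` U >] then box q else set0)).
  apply: countable_bigcupT_measurable; first exact: countableP.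
  by move=> q; case: ifP => // _; exact: measurableX.
apply/seteqP; split => [z Uz|z [q _]]; last first.
  by case: ifP => // /asboolP + bz; exact.
have /nbhs_ballP[e /= e0 eU] : nbhs z U by exact: open_nbhs_nbhs.
have [a] : exists a : rat, ratr a \in `]z.1 - e, z.1[.
  by apply: rat_in_itvoo; lra.
have [b] : exists b : rat, ratr b \in `]z.1, z.1 + e[.
  by apply: rat_in_itvoo; lra.
have [c] : exists c : rat, ratr c \in `]z.2 - e, z.2[.
  by apply: rat_in_itvoo; lra.
have [d] : exists d : rat, ratr d \in `]z.2, z.2 + e[.
  by apply: rat_in_itvoo; lra.
rewrite !in_itv/= => /andP[d1 d2] /andP[c1 c2] /andP[b1 b2] /andP[a1 a2].
exists (a, b, (c, d)) => //.
case: ifPn => [_|/asboolP]; first by split; rewrite /= in_itv/=; apply/andP.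
case=> x [/=]; rewrite !in_itv/= => /andP[x1 x2] /andP[x3 x4].
apply: eU; split; rewrite /ball/= ltr_distlC; apply/andP; split; lra.
Qed.

Lemma within_continuous_measurable_prod (D : set (R * R)) (v : R * R -> R) :
  measurable D -> {within D, continuous v} -> measurable_fun D v.
Proof.
move=> mD /continuousP cv; apply: (measurability _ (RGenOpens.measurableE R)).
move=> _ [_ [a [b ->] <-]].
have oab : open (`]a, b[%classic : set R) by exact: interval_open.
have /open_subspaceP[V oV VD] := cv _ oab.
rewrite setIC -VD.
by apply: measurableI => //; exact: open_measurable_prod.
Qed.

(** Dominated convergence speaks of sequences, so continuity of integrals in the base point is
    tested along sequences. A failure at level [e] yields a point in every ball of radius
    [1 / (n + 1)], hence a violating sequence. *)
Lemma cvg_within_seq (f : R * R -> R) (D : set (R * R)) (z : R * R) :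
  (forall a b : nat -> R, (forall n, D (a n, b n)) ->
     a n @[n --> \oo] --> z.1 -> b n @[n --> \oo] --> z.2 ->
     f (a n, b n) @[n --> \oo] --> f z) ->
  f @ within D (nbhs z) --> f z.
Proof.
move=> H; apply/cvgrPdist_lt => e e0; apply: contrapT => nH.
have K n : exists x : R * R, [/\ D x, ball z n.+1%:R^-1 x & e <= `|f z - f x|].
  apply: contrapT => /forallNP h; apply: nH; rewrite near_withinE.
  apply/nbhs_ballP; exists n.+1%:R^-1 => //= x zx Dx.
  by rewrite ltNge; apply/negP => ?; apply: (h x).
have [x /all_and3 [Dx zx ex]] := choice K.
have hx (g : R * R -> R) : (forall n, `|g z - g (x n)| < n.+1%:R^-1) ->
    g (x n) @[n --> \oo] --> g z.
  move=> gx; apply/cvgrPdist_lt => d d0; near=> n.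
  apply: lt_trans (gx n) _; near: n.
  exact: near_infty_natSinv_lt (PosNum d0).
have := H (fun n => (x n).1) (fun n => (x n).2).
have E n : ((x n).1, (x n).2) = x n by case: (x n).
move=> /(_ (fun n => eq_ind_r D (Dx n) (E n))).
move=> /(_ (hx fst _) (hx snd _)).
move=> /(_ (fun n => (zx n).1) (fun n => (zx n).2)) /cvgrPdist_lt /(_ e e0).
case=> N _ /(_ N (leqnn _)) /=; rewrite E => h.
by move: (le_lt_trans (ex N) h); rewrite ltxx.
Unshelve. all: by end_near. Qed.

End PlaneTopology.

Lemma E_minus_ge0 {R : realType} (w : R -> R) t r y : 0 <= E_minus w t r y.
Proof. by apply: mulr_ge0; [apply: mulr_ge0|]; exact: expR_ge0. Qed.

Section Duhamel.
Context {R : realType}.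
Notation mu := (@lebesgue_measure R).
Notation mu2 := (mu \x mu)%E.
Variables (w : R -> R) (p T : R).
Hypothesis cW : continuous (primW w).

Definition strip : set (R * R) := [set z | 0 <= z.1 < T /\ 0 < z.2].

Definition duhamel_integrand (v : R * R -> R) t r (z : R * R) : R :=
  E_minus w (t - z.1) r z.2 * (`|v z| `^ p / z.2 `^ (p - 1)).

(** As a real integral this is [0] when the extended integral is infinite; domination by [Phi]
    excludes that case for the Picard iterates. *)
Definition duhamel (v : R * R -> R) t r : R :=
  \int[mu2]_(z in Delta_minus t r) duhamel_integrand v t r z.

Lemma duhamel_integrand_ge0 v t r z : 0 <= duhamel_integrand v t r z.
Proof.
apply: mulr_ge0; first exact: E_minus_ge0.
by apply: divr_ge0; exact: powR_ge0.
Qed.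

Lemma Delta_minus_strip t r : t < T -> Delta_minus t r `<=` strip.
Proof.
by move=> tT z [z1 z2 /andP[z3 z4] z5]; split => //; apply/andP; split; lra.
Qed.

Lemma measurable_strip : measurable strip.
Proof.
rewrite (_ : strip = [set z | 0 <= z.1] `&` [set z | z.1 < T] `&` [set z | 0 < z.2]).
  have m1 := @measurable_fst _ _ R R; have m2 := @measurable_snd _ _ R R.
  by repeat apply: measurableI; [exact: measurable_set_le|exact: measurable_set_lt..].
apply/seteqP; split => z /=; first by move=> [/andP[]].
by move=> [[h1 h2] h3]; split => //; apply/andP.
Qed.

Lemma E_minus_bounded (rho : R) : exists2 K : R, 0 < K & forall t r y,
  - rho <= r <= rho -> - rho <= y <= rho -> - rho <= (y - t + r) / 2 <= rho ->
  0 <= E_minus w t r y <= K.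
Proof.
have [rho0|rho0] := leP 0 rho; last first.
  by exists 1 => // t r y /andP[h1 h2] h; exfalso; lra.
have hab : - rho <= rho by lra.
have cWi : {within `[- rho, rho], continuous (fun x => `|primW w x|)}.
  apply: continuous_subspaceT => x; apply: cvg_norm; exact: cW.
have [c _ hc] := EVT_max hab cWi.
pose M : R := `|primW w c|.
have WM x : - rho <= x <= rho -> `|primW w x| <= M.
  by move=> hx; apply: hc; rewrite in_itv.
exists (expR M * expR (2 * M) * expR M); first by rewrite !mulr_gt0 ?expR_gt0.
move=> t r y hr hy hs.
rewrite E_minus_ge0/=.
have B x : - rho <= x <= rho -> expR (- primW w x) <= expR M.
  by move=> /WM; rewrite ler_norml => /andP[h1 h2]; rewrite ler_expR; lra.
have e0 := @expR_ge0 R.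
apply: ler_pM; [by apply: mulr_ge0|exact: e0| |exact: B].
apply: ler_pM; [exact: e0|exact: e0|exact: B|].
by rewrite ler_expR ler_pM2l//; apply: le_trans (ler_norm _) (WM _ hs).
Qed.

Lemma E_minus_le (rho : R) : exists2 K : R, 0 < K & forall t r z,
  0 <= t -> 0 < r -> t + r <= rho -> Delta_minus t r z ->
  0 <= E_minus w (t - z.1) r z.2 <= K.
Proof.
have [K K0 HK] := E_minus_bounded rho; exists K => //.
move=> t r z t0 r0 trho [z1 z2 /andP[z3 z4] z5].
have n1 : - (t - r) <= `|t - r| by rewrite -normrN ler_norm.
have n2 : t - r <= `|t - r| by rewrite ler_norm.
have zz : - rho <= z.2 <= rho by apply/andP; split; lra.
have rr : - rho <= r <= rho by apply/andP; split; lra.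
have ss : - rho <= (z.2 - (t - z.1) + r) / 2 <= rho by apply/andP; split; lra.
exact: HK.
Qed.

Lemma cvg_E_minus (I : Type) (F : set_system I) {FF : Filter F}
    (a b c : I -> R) (t r y : R) :
  a n @[n --> F] --> t -> b n @[n --> F] --> r -> c n @[n --> F] --> y ->
  E_minus w (a n) (b n) (c n) @[n --> F] --> E_minus w t r y.
Proof.
move=> at_ br cy; rewrite /E_minus.
have cE (u : I -> R) l : u n @[n --> F] --> l -> expR (u n) @[n --> F] --> expR l.
  by move=> ul; apply: continuous_cvg => //; exact: continuous_expR.
have cP (u : I -> R) l : u n @[n --> F] --> l -> primW w (u n) @[n --> F] --> primW w l.
  by move=> ul; apply: continuous_cvg => //; exact: cW.
apply: cvgM; last by apply: cE; apply: cvgN; exact: cP.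
apply: cvgM; apply: cE; first by apply: cvgN; exact: cP.
apply: cvgM; first exact: cvg_cst.
apply: cP; apply: cvgM; last exact: cvg_cst.
by apply: cvgD => //; apply: cvgB.
Qed.

Lemma measurable_E_minus (t r : R) :
  measurable_fun setT (fun z : R * R => E_minus w (t - z.1) r z.2).
Proof.
have m1 := @measurable_fst _ _ R R; have m2 := @measurable_snd _ _ R R.
have mW : measurable_fun setT (primW w) by exact: continuous_measurable_fun.
have mE : measurable_fun setT (@expR R).
  by apply: continuous_measurable_fun; exact: continuous_expR.
rewrite /E_minus; apply: measurable_funM.
  apply: measurable_funM; first exact: measurable_cst.
  apply: (measurableT_comp mE).
  apply: measurable_funM => //; apply: (measurableT_comp mW).
  apply: measurable_funM => //; apply: measurable_funD => //.
  by apply: measurable_funB => //; apply: measurable_funB.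
apply: (measurableT_comp mE); apply: measurable_funN.
exact: (measurableT_comp mW).
Qed.

Lemma measurable_duhamel_integrand (D : set (R * R)) v t r :
  measurable_fun D v -> measurable_fun D (duhamel_integrand v t r).
Proof.
move=> mv; apply: measurable_funM.
  by apply: measurable_funTS; exact: measurable_E_minus.
apply: measurable_funM.
  apply: (measurableT_comp (measurable_powR p)).
  exact: measurableT_comp.
apply: (measurable_funTS (D := D)).
rewrite (_ : (fun _ => _) = (fun x : R => x `^ (- (p - 1))) \o snd); last first.
  by apply/funext => z /=; rewrite powRN.
by apply: (measurableT_comp (measurable_powR _)); exact: measurable_snd.
Qed.

End Duhamel.

(** * Continuity of the Duhamel integral in the base point *)

Section DuhamelContinuity.
Context {R : realType}.
Notation mu := (@lebesgue_measure R).
Notation mu2 := (mu \x mu)%E.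
Variables (w : R -> R) (p T : R).
Hypothesis cW : continuous (primW w).
Hypothesis p1 : 1 < p.
Notation strip := (strip T).

(** By Tonelli, since every vertical section lies in a single point. *)
Lemma negligible_graph (g : R -> R) (A : set (R * R)) : measurable A ->
  (forall x y, A (x, y) -> y = g x) -> mu2.-negligible A.
Proof.
move=> mA Ag; apply/negligibleP => //.
rewrite /= /product_measure1/=; apply: integral0_eq => x _ /=.
apply/eqP; rewrite -measure_le0 -(lebesgue_measure_set1 (g x)).
apply: le_measure; rewrite ?inE//.
  exact: measurable_xsection.
by move=> y; rewrite xsectionE/= => /Ag ->.
Qed.

Lemma measurable_set_eq d (T' : measurableType d) (g h : T' -> R) :
  measurable_fun setT g -> measurable_fun setT h ->
  measurable [set z | g z = h z].
Proof.
move=> mg mh.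
rewrite (_ : [set _ | _] = [set z | g z <= h z] `&` [set z | h z <= g z]).
  by apply: measurableI; exact: measurable_set_le.
apply/seteqP; split => z /=; first by move=> ->.
by move=> [h1 h2]; apply/eqP; rewrite eq_le h1.
Qed.

(* The sides of the region, off which membership in [Delta_minus] is locally
   constant in the base point. *)
Lemma Delta_minus_boundary_negligible (t r : R) : mu2.-negligible
  ([set z : R * R | z.1 + z.2 = `|t - r|] `|` [set z : R * R | z.1 + z.2 = t + r] `|`
   [set z : R * R | z.1 - z.2 = t - r]).
Proof.
have m1 := @measurable_fst _ _ R R; have m2 := @measurable_snd _ _ R R.
have ms : measurable_fun setT (fun z : R * R => z.1 + z.2) by exact: measurable_funD.
have md : measurable_fun setT (fun z : R * R => z.1 - z.2) by exact: measurable_funB.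
apply: negligibleU; first apply: negligibleU.
- apply: (@negligible_graph (fun x => `|t - r| - x)); first exact: measurable_set_eq.
  by move=> x y /= <-; ring.
- apply: (@negligible_graph (fun x => t + r - x)); first exact: measurable_set_eq.
  by move=> x y /= <-; ring.
- apply: (@negligible_graph (fun x => x - (t - r))); first exact: measurable_set_eq.
  by move=> x y /= <-; ring.
Qed.

Lemma cvg_compare_near (u : nat -> R) (l x : R) : u n @[n --> \oo] --> l ->
  x != l -> \forall n \near \oo,
    ((u n < x) = (l < x)) /\ ((x < u n) = (x < l)).
Proof.
move=> ul; rewrite neq_lt => /orP[xl|lx].
- have h : \forall n \near \oo, x < u n by exact: (cvgr_gt l).
  near=> n; have xn : x < u n by near: n.
  by split; [rewrite !ltNge (ltW xl) (ltW xn)|rewrite xl xn].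
- have h : \forall n \near \oo, u n < x by exact: (cvgr_lt l).
  near=> n; have xn : u n < x by near: n.
  by split; [rewrite lx xn|rewrite !ltNge (ltW lx) (ltW xn)].
Unshelve. all: by end_near. Qed.

(** The constraints [0 < z.1] and [0 < z.2] do not involve the base point; the others are strict
    comparisons with convergent quantities, which are eventually constant away from equality. *)
Lemma indic_Delta_minus_cvg (a b : nat -> R) (t r : R) (z : R * R) :
  a n @[n --> \oo] --> t -> b n @[n --> \oo] --> r ->
  z.1 + z.2 != `|t - r| -> z.1 + z.2 != t + r -> z.1 - z.2 != t - r ->
  \forall n \near \oo, (z \in Delta_minus (a n) (b n)) = (z \in Delta_minus t r).
Proof.
move=> at_ br h1 h2 h3.
have cs : a n + b n @[n --> \oo] --> t + r by exact: cvgD.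
have cd : a n - b n @[n --> \oo] --> t - r by exact: cvgB.
have cn : `|a n - b n| @[n --> \oo] --> `|t - r| by exact: cvg_norm.
have k1 := cvg_compare_near cn h1.
have k2 := cvg_compare_near cs h2.
have k3 := cvg_compare_near cd h3.
near=> n.
have [[e1 _] [_ e2] [_ e3]] : [/\ ((`|a n - b n| < z.1 + z.2) = (`|t - r|
    < z.1 + z.2)) /\ ((z.1 + z.2 < `|a n - b n|) = (z.1 + z.2 < `|t - r|)),
  ((a n + b n < z.1 + z.2) = (t + r < z.1 + z.2)) /\ ((z.1 + z.2 < a n + b n) =
      (z.1 + z.2 < t + r)) &
  ((a n - b n < z.1 - z.2) = (t - r < z.1 - z.2)) /\ ((z.1 - z.2 < a n - b n) =
      (z.1 - z.2 < t - r))].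
  by split; near: n.
by apply/idP/idP; rewrite !inE /Delta_minus/= e1 e2 e3.
Unshelve. all: by end_near. Qed.

(** A box of finite measure containing all the domains with [t + r <= rho], on which a constant is
    an integrable dominating function. *)
Definition square (rho : R) : set (R * R) := `]0, rho[%classic `*` `]0, rho[%classic.

Lemma measurable_square rho : measurable (square rho).
Proof. exact: measurableX. Qed.

Lemma square_fin rho : (mu2 (square rho) < +oo)%E.
Proof.
rewrite product_measure1E//= !lebesgue_measure_itv/=.
by case: ifP => _; rewrite ?mul0e ?ltry// -EFinB -EFinM ltry.
Qed.

Lemma Delta_minus_square t r rho : t + r <= rho -> Delta_minus t r `<=` square rho.
Proof.
move=> h z [z1 z2 /andP[z3 z4] z5].
by split; rewrite /= in_itv/=; apply/andP; split; lra.
Qed.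

Variable Phi : R * R -> R.
Hypothesis Phi_loc : forall rho : R, exists2 C : R, 0 < C &
  forall z, strip z -> z.1 + z.2 <= rho -> Phi z <= C * z.2.

(** The linear bound [Phi z <= C * z.2] defeats the singularity at the axis: [|v|^p <= C^p y^p], and
    after division by [y^(p-1)] a bounded factor [y] remains. *)
Lemma duhamel_integrand_bound (rho : R) : exists2 M : R, 0 < M &
  forall v t r z, (forall z, strip z -> `|v z| <= Phi z) ->
   0 <= t < T -> 0 < r -> t + r <= rho -> Delta_minus t r z ->
   duhamel_integrand w p v t r z <= M.
Proof.
have [rho0|rho0] := ltP 0 rho; last first.
  by exists 1 => // v t r z _ /andP[t0 tT] r0 h; exfalso; lra.
have [K K0 HK] := E_minus_le cW rho.
have [C C0 HC] := Phi_loc rho.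
exists (K * (C `^ p * rho)); first by rewrite !mulr_gt0 ?powR_gt0.
move=> v t r z vPhi /andP[t0 tT] r0 trho zD.
have zs : strip z by exact: Delta_minus_strip zD.
have [z1 z2 /andP[z3 z4] z5] := zD.
have /andP[E0 EK] := HK t r z t0 r0 trho zD.
apply: ler_pM => //; first by rewrite mulr_ge0 ?invr_ge0 ?powR_ge0.
rewrite ler_pdivrMr ?powR_gt0//.
apply: (@le_trans _ _ ((C * z.2) `^ p)).
  apply: powR_monotone => //; last exact: (ltW (lt_trans ltr01 p1)).
  apply: le_trans (vPhi z zs) _; apply: HC => //.
  by apply: le_trans trho; exact: ltW.
rewrite (powRM p (ltW C0) (ltW z2)) -[leRHS]mulrA ler_pM2l ?powR_gt0//.
rewrite -(mulr_powRB1 (ltW z2) (lt_trans ltr01 p1)).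
by rewrite ler_pM2r ?powR_gt0//; lra.
Qed.

(** Bounded convergence on a fixed box: the base point enters through the kernel, which is
    continuous, and through the indicator of the domain, which converges off its sides. *)
Lemma duhamel_continuous (v : R * R -> R) :
  {within strip, continuous v} -> (forall z, strip z -> `|v z| <= Phi z) ->
  {within strip, continuous (fun z => duhamel w p v z.1 z.2)}.
Proof.
move=> cv vPhi; apply/subspace_continuousP => -[t r] [/= /andP[t0 tT] r0].
apply: cvg_within_seq => a b Dab /= at_ br.
have [Mb Mb0 hMb] : exists2 Mb : R, 0 < Mb & forall n, b n <= Mb.
  have [/= M0 [_ HM]] : bounded_fun b by apply: cvg_seq_bounded; apply/cvg_ex; exists r.
  exists (`|M0| + 1); first by apply: ltr_wpDl.
  move=> n; apply: le_trans (ler_norm _) _; apply: (HM (`|M0| + 1)) => //.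
  by apply: le_lt_trans (ler_norm _) _; rewrite ltrDl.
pose rho := T + Mb + r.
have abr n : a n + b n <= rho.
  have [/andP[_ h] _] := Dab n; have := hMb n; rewrite /rho /=; move: h => /=; lra.
have trr : t + r <= rho by rewrite /rho; lra.
have [M M0 HM] := duhamel_integrand_bound rho.
pose f_ n z := (duhamel_integrand w p v (a n) (b n) \_ (Delta_minus (a n) (b n))) z.
pose f z := (duhamel_integrand w p v t r \_ (Delta_minus t r)) z.
have E s q : s + q <= rho -> duhamel w p v s q =
    fine (\int[mu2]_(z in square rho)
       ((duhamel_integrand w p v s q \_ (Delta_minus s q)) z)%:E)%E.
  move=> sq; rewrite /duhamel /Rintegral; congr fine.
  have DQ := Delta_minus_square sq.
  rewrite -{1}(setIidr DQ) integral_mkcondr; apply: eq_integral => z _.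
  by rewrite !patchE; case: ifP.
have mD s q : s < T -> measurable_fun setT (duhamel_integrand w p v s q \_
    (Delta_minus s q)).
  move=> sT; apply/(measurable_restrictT _ (measurable_Delta_minus s q)).
  apply: measurable_duhamel_integrand => //.
  apply: measurable_funS (Delta_minus_strip sT) _; first exact: measurable_strip.
  by apply: within_continuous_measurable_prod => //; exact: measurable_strip.
rewrite [X in _ --> X](E t r)//=.
rewrite (_ : (fun n => duhamel w p v (a n) (b n)) =
   (fun n => fine (\int[mu2]_(z in square rho) (f_ n z)%:E)%E)); last first.
  by apply/funext => n; rewrite (E (a n) (b n)).
apply: fine_cvg.
have [] := @dominated_convergence _ _ R mu2 (square rho) (measurable_square rho)
   (fun n z => (f_ n z)%:E) (fun z => (f z)%:E) (cst M%:E).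
- move=> n; apply/measurable_EFinP; apply: measurable_funTS.
  by apply: mD; have [/andP[]] := Dab n.
- by apply/measurable_EFinP; apply: measurable_funTS; exact: mD.
- have := Delta_minus_boundary_negligible t r; apply: negligibleS => z /=.
  move=> nz; apply: contrapT => nb; apply: nz => _.
  have [h1 h2 h3] : [/\ z.1 + z.2 != `|t - r|, z.1 + z.2 != t + r & z.1 - z.2 != t - r].
    by split; apply/eqP => h; apply: nb; [left; left|left; right|right].
  apply/fine_cvgP; split; first by near=> n.
  have hn := indic_Delta_minus_cvg at_ br h1 h2 h3.
  rewrite /f /f_ patchE.
  have cK : duhamel_integrand w p v (a n) (b n) z @[n --> \oo] -->
      duhamel_integrand w p v t r z.
    apply: cvgM; last exact: cvg_cst.
    apply: cvg_E_minus => //; last exact: cvg_cst.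
    by apply: cvgB => //; exact: cvg_cst.
  apply: (@cvg_trans _ ((if z \in Delta_minus t r then duhamel_integrand w p v (a
      n) (b n) z else 0) @[n --> \oo])).
    apply: near_eq_cvg; near=> n.
    by rewrite /= patchE; congr (if _ then _ else _); apply/esym; near: n.
  case: (z \in Delta_minus t r); first exact: cK.
  exact: cvg_cst.
- by apply: measurable_bounded_integrable => //;
    [exact: measurable_square|exact: square_fin|exact: bounded_cst].
- apply/aeW => z n _; rewrite /f_ patchE; case: ifPn => [|_]; last
    by rewrite abse0 lee_fin ltW.
  rewrite inE => zD; rewrite abse_EFin lee_fin ger0_norm ?duhamel_integrand_ge0//.
  have [hT hb] := Dab n.
  exact: (HM v (a n) (b n) z vPhi hT hb (abr n) zD).
- move=> fint _ ff; rewrite fineK; first exact: ff.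
  by apply: integrable_fin_num fint; exact: measurable_square.
Unshelve. all: by end_near. Qed.

End DuhamelContinuity.

(** * Picard iteration in the norm weighted by the supersolution *)

Section Picard.
Context {R : realType}.
Notation mu := (@lebesgue_measure R).
Notation mu2 := (mu \x mu)%E.

(** For [b <= a], division by [a^p] reduces the bound to Bernoulli's inequality
    [1 - u^p <= p (1 - u)] with [u = b / a]; then [a <= m]. *)
Lemma powR_sub_le (p a b m : R) : 1 < p -> 0 <= a <= m -> 0 <= b <= m ->
  `|a `^ p - b `^ p| <= p * (m `^ (p - 1) * `|a - b|).
Proof.
move=> p1; have p0 : 0 < p by rewrite (lt_trans ltr01).
wlog ba : a b / b <= a.
  move=> H ha hb; have [ba|ab] := leP b a; first exact: H.
  by rewrite distrC (distrC a); apply: H => //; exact: ltW.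
move=> /andP[a0 am] /andP[b0 bm].
have [a_eq0|an0] := eqVneq a 0.
  have b_eq0 : b = 0 by apply/eqP; rewrite eq_le b0 -{1}a_eq0 ba.
  by rewrite a_eq0 b_eq0 !subrr normr0 !mulr0.
have ap : 0 < a by rewrite lt0r an0.
rewrite ger0_norm; last by rewrite subr_ge0; apply: powR_monotone => //; exact: ltW.
rewrite ger0_norm ?subr_ge0//.
pose u := b / a.
have u0 : 0 <= u by exact: divr_ge0.
have q0 : 0 < p / (p - 1) by rewrite divr_gt0// subr_gt0.
(* Young's inequality for [u] and [1] with the exponents [p] and [p / (p - 1)] is Bernoulli's
   inequality in disguise. *)
have young : u * 1 <= u `^ p / p + 1 `^ (p / (p - 1)) / (p / (p - 1)).
  apply: conjugate_powR => //; rewrite invf_div.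
  have pn0 : p != 0 by rewrite gt_eqF.
  by rewrite -{1}[p^-1]mul1r -mulrDl addrC subrK mulfV.
have bern : p * u <= u `^ p + (p - 1).
  rewrite powR1 mulr1 mul1r invf_div -mulrDl in young.
  by rewrite mulrC -ler_pdivlMr.
apply: (@le_trans _ _ (p * (a `^ (p - 1) * (a - b)))).
  have bE : b = u * a by rewrite /u divfK.
  have -> : b `^ p = u `^ p * a `^ p by rewrite {1}bE powRM// ltW.
  have -> : a `^ (p - 1) * (a - b) = a `^ p * (1 - u).
    by rewrite -[in RHS](mulr_powRB1 (ltW ap) p0) bE; ring.
  rewrite mulrCA -{1}[a `^ p]mul1r -mulrBl mulrC ler_pM2l ?powR_gt0//.
  lra.
rewrite ler_pM2l//; apply: ler_wpM2r; first by rewrite subr_ge0.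
by apply: powR_monotone => //; rewrite ?subr_ge0 ltW.
Qed.

Lemma halves_absurd (x y z d : R) : x <= d / 2 -> z <= x + y -> y <= d / 2 ->
  d < z / 2 -> 0 < z -> False.
Proof. lra. Qed.

(** Nested intervals: adding or subtracting the tail [2 C / 2^n] makes the sequence decreasing or
    increasing, because that tail is the increment [C / 2^n] plus the next tail. The supremum of the
    lower ends is the limit, and the rate comes with it. *)
Lemma geometric_limit (x : nat -> R) (C : R) : 0 <= C ->
  (forall n, `|x n.+1 - x n| <= C / 2 ^+ n) ->
  exists l, forall n, `|x n - l| <= 2 * C / 2 ^+ n.
Proof.
move=> C0 hx.
pose y n := x n + 2 * C / 2 ^+ n; pose z n := x n - 2 * C / 2 ^+ n.
have E n : 2 * C / 2 ^+ n = C / 2 ^+ n + 2 * C / 2 ^+ n.+1.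
  have : (2 : R) ^+ n != 0 by rewrite expf_eq0 pnatr_eq0 andbF.
  by move=> h; rewrite exprS; field.
have P n : 0 <= 2 * C / 2 ^+ n by rewrite divr_ge0 ?mulr_ge0// exprn_ge0.
have yS n : y n.+1 <= y n.
  by rewrite /y (E n); have := hx n; rewrite ler_norml => /andP[h1 h2]; lra.
have zS n : z n <= z n.+1.
  by rewrite /z (E n); have := hx n; rewrite ler_norml => /andP[h1 h2]; lra.
have yM m k : y (m + k)%N <= y m.
  by elim: k => [|k ih]; rewrite ?addn0// addnS (le_trans (yS _)).
have zM m k : z m <= z (m + k)%N.
  by elim: k => [|k ih]; rewrite ?addn0// addnS (le_trans ih).
have zy m n : z m <= y n.
  have zyk k : z k <= y k by rewrite /z /y; have := P k; lra.
  by apply: le_trans (zM m n) _; apply: le_trans (zyk _) _; rewrite addnC.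
exists (sup (range z)) => n.
have zl : z n <= sup (range z).
  apply: ub_le_sup; last by exists n.
  by exists (y 0%N) => _ [m _ <-].
have ly : sup (range z) <= y n.
  apply: ge_sup; first by exists (z 0%N), 0%N.
  by move=> _ [m _ <-].
by rewrite ler_norml; move: zl ly; rewrite /z /y => zl ly; apply/andP; split; lra.
Qed.

Variables (w : R -> R) (p T eps : R) (uL : R -> R -> R) (Phi : R * R -> R).
Hypothesis cW : continuous (primW w).
Hypothesis p1 : 1 < p.
Notation strip := (strip T).
Hypothesis mPhi : measurable_fun setT Phi.
Hypothesis Phi0 : forall z, strip z -> 0 <= Phi z.
Hypothesis Phi_loc : forall rho : R, exists2 C : R, 0 < C &
  forall z, strip z -> z.1 + z.2 <= rho -> Phi z <= C * z.2.
Hypothesis uL_cont : {within strip, continuous (fun z => uL z.1 z.2)}.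
Hypothesis uL_le : forall t r, strip (t, r) -> eps * `|uL t r| <= Phi (t, r) / 2.
Hypothesis eps0 : 0 <= eps.
Hypothesis Phi_super : forall t r, strip (t, r) ->
  (\int[mu2]_(z in Delta_minus t r) (duhamel_integrand w p Phi t r z)%:E <=
   (Phi (t, r) / p)%:E)%E.

Let adm (v : R * R -> R) := {within strip, continuous v} /\
  forall z, strip z -> `|v z| <= Phi z.

Let step (v : R * R -> R) (z : R * R) : R :=
  eps * uL z.1 z.2 + 2^-1 * duhamel w p v z.1 z.2.

Let p0 : 0 < p. Proof. by rewrite (lt_trans ltr01). Qed.

Let mPhiI t r : measurable_fun (Delta_minus t r) (duhamel_integrand w p Phi t r).
Proof. by apply: measurable_duhamel_integrand => //; exact: measurable_funTS. Qed.

Let Phi_int t r : strip (t, r) ->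
  mu2.-integrable (Delta_minus t r) (EFin \o duhamel_integrand w p Phi t r).
Proof.
move=> tr; apply/integrableP; split.
  by apply/measurable_EFinP; exact: mPhiI.
apply: le_lt_trans (ltry (Phi (t, r) / p)); apply: le_trans (Phi_super tr).
rewrite le_eqVlt; apply/orP; left; apply/eqP; apply: eq_integral => z _ /=.
by rewrite ger0_norm// duhamel_integrand_ge0.
Qed.

Let Phi_superR t r : strip (t, r) -> duhamel w p Phi t r <= Phi (t, r) / p.
Proof.
move=> tr; rewrite -lee_fin /duhamel /Rintegral fineK; first exact: Phi_super.
by apply: integrable_fin_num (Phi_int tr); exact: measurable_Delta_minus.
Qed.

Let adm_int v t r : adm v -> strip (t, r) ->
  mu2.-integrable (Delta_minus t r) (EFin \o duhamel_integrand w p v t r).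
Proof.
move=> [cv vPhi] tr; have [/andP[t0 tT] r0] := tr.
apply: le_integrable (Phi_int tr).
- exact: measurable_Delta_minus.
- apply/measurable_EFinP; apply: measurable_duhamel_integrand => //.
  apply: measurable_funS (Delta_minus_strip tT) _; first exact: measurable_strip.
  by apply: within_continuous_measurable_prod => //; exact: measurable_strip.
- move=> z zD; rewrite /= lee_fin !ger0_norm ?duhamel_integrand_ge0//.
  have zs : strip z by exact: Delta_minus_strip zD.
  apply: ler_wpM2l; first exact: E_minus_ge0.
  apply: ler_wpM2r; first by rewrite invr_ge0 powR_ge0.
  apply: powR_monotone => //; last exact: ltW.
  by rewrite (ger0_norm (Phi0 zs)); exact: vPhi.
Qed.

Let adm_step v : adm v -> adm (step v).
Proof.
move=> av; have [cv vPhi] := av; split.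
  move=> z; apply: cvgD.
    by apply: cvgM; [exact: cvg_cst|exact: uL_cont].
  apply: cvgM; first exact: cvg_cst.
  exact: (duhamel_continuous cW p1 Phi_loc cv vPhi).
case=> t r tr; rewrite /step/=; have [/andP[t0 tT] r0] := tr.
apply: le_trans (ler_normD _ _) _.
rewrite normrM (ger0_norm eps0).
have h1 := uL_le tr.
have h2 : `|duhamel w p v t r| <= Phi (t, r) / p.
  apply: le_trans (Phi_superR tr).
  rewrite ger0_norm; last by apply: Rintegral_ge0 => z _; exact: duhamel_integrand_ge0.
  apply: le_Rintegral; [exact: measurable_Delta_minus|exact: adm_int|exact: Phi_int|].
  move=> z zD; have zs : strip z by exact: Delta_minus_strip zD.
  apply: ler_wpM2l; first exact: E_minus_ge0.
  apply: ler_wpM2r; first by rewrite invr_ge0 powR_ge0.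
  apply: powR_monotone => //; last exact: ltW.
  by rewrite (ger0_norm (Phi0 zs)); exact: vPhi.
have h3 : Phi (t, r) / p <= Phi (t, r).
  by rewrite ler_pdivrMr// ler_peMr ?Phi0// ltW.
rewrite normrM (ger0_norm (_ : 0 <= 2^-1)) ?invr_ge0//.
lra.
Qed.

(** The difference of the [p]-th powers is at most [p Phi^(p-1)] times that of the functions, hence
    at most [c p Phi^p]. The factor [p] is cancelled by the bound [Phi / p] for the source of [Phi],
    so the ratio one half is just the prefactor of the Duhamel term. *)
Let step_contract v1 v2 c : 0 <= c -> adm v1 -> adm v2 ->
  (forall z, strip z -> `|v1 z - v2 z| <= c * Phi z) ->
  forall z, strip z -> `|step v1 z - step v2 z| <= c / 2 * Phi z.
Proof.
move=> c0 a1 a2 h12 [t r] tr; have [/andP[t0 tT] r0] := tr.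
rewrite /step/= opprD addrACA subrr add0r -mulrBr normrM (ger0_norm (_ : 0 <=
    2^-1)) ?invr_ge0//.
rewrite mulrAC [leRHS]mulrC; apply: ler_wpM2l => //.
have mD := measurable_Delta_minus t r.
have i1 := adm_int a1 tr; have i2 := adm_int a2 tr; have iP := Phi_int tr.
rewrite /duhamel -RintegralB//.
apply: (le_trans (le_normr_Rintegral _ _)) => //; first exact: integrableB i1 i2.
have icP : mu2.-integrable (Delta_minus t r)
    (EFin \o (fun z => c * p * duhamel_integrand w p Phi t r z)).
  exact: integrableZl iP.
apply: (@le_trans _ _ (\int[mu2]_(z in Delta_minus t r)
    (c * p * duhamel_integrand w p Phi t r z))).
  apply: le_Rintegral => //; first by apply: integrable_norm; exact: integrableB i1 i2.
  move=> z zD; have zs : strip z by exact: Delta_minus_strip zD.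
  have [_ v1P] := a1; have [_ v2P] := a2.
  rewrite /duhamel_integrand -mulrBr normrM ger0_norm; last exact: E_minus_ge0.
  rewrite [leRHS]mulrCA; apply: ler_wpM2l; first exact: E_minus_ge0.
  rewrite -mulrBl normrM (ger0_norm (_ : 0 <=
      (z.2 `^ (p - 1))^-1)) ?invr_ge0 ?powR_ge0//.
  rewrite [leRHS]mulrA; apply: ler_wpM2r; first by rewrite invr_ge0 powR_ge0.
  have hm (v : R * R -> R) : `|v z| <= Phi z -> 0 <= `|v z| <= Phi z by move=> ->;
      rewrite normr_ge0.
  apply: le_trans (powR_sub_le p1 (hm _ (v1P _ zs)) (hm _ (v2P _ zs))) _.
  rewrite (ger0_norm (Phi0 zs)) mulrAC mulrC; apply: ler_wpM2r; first exact: ltW.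
  rewrite -(mulr_powRB1 (Phi0 zs) p0) mulrC mulrA.
  apply: ler_wpM2r; first exact: powR_ge0.
  by apply: le_trans (ler_dist_dist _ _) _; exact: h12.
rewrite RintegralZl//; have := Phi_superR tr; rewrite /duhamel => h.
apply: (@le_trans _ _ (c * p * (Phi (t, r) / p))).
  by apply: ler_wpM2l => //; rewrite mulr_ge0// ltW.
rewrite le_eqVlt; apply/orP; left; apply/eqP; field.
by rewrite gt_eqF.
Qed.

Let u_ n := iter n step (fun=> 0).

Let adm_u n : adm (u_ n).
Proof.
elim: n => [|n ih]; last exact: adm_step.
split; first by move=> z; exact: cvg_cst.
by move=> z zs; rewrite normr0 Phi0.
Qed.

Let u_diff n z : strip z -> `|u_ n.+1 z - u_ n z| <= 2 ^- n * Phi z.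
Proof.
elim: n z => [|n ih] z zs.
  by rewrite subr0 expr0 invr1 mul1r; have [_] := adm_u 1; exact.
rewrite exprS invfM mulrC [2^-1 * _]mulrC mulrC.
have c0 : 0 <= 2 ^- n :> R by rewrite invr_ge0 exprn_ge0.
exact: (@step_contract (u_ n.+1) (u_ n) _ c0 (adm_u _) (adm_u _) ih z zs).
Qed.

Let u_lim : exists u : R * R -> R,
  forall n z, strip z -> `|u_ n z - u z| <= 2 * Phi z / 2 ^+ n.
Proof.
have H z : exists l, strip z -> forall n, `|u_ n z - l| <= 2 * Phi z / 2 ^+ n.
  have [zs|nzs] := pselect (strip z); last by exists 0.
  have [|l hl] := @geometric_limit (fun n => u_ n z) (Phi z) (Phi0 zs).
    by move=> n; rewrite mulrC; exact: u_diff.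
  by exists l.
have [u hu] := choice H; exists u => n z zs; exact: hu.
Qed.

Theorem picard : exists u, {within strip, continuous u} /\
  forall t r, strip (t, r) ->
    ((u (t, r))%:E = (eps * uL t r)%:E + 2^-1%:E *
      \int[mu2]_(z in Delta_minus t r) (duhamel_integrand w p u t r z)%:E)%E.
Proof.
have [u hu] := u_lim.
have small (c d : R) : 0 <= c -> 0 < d -> exists n : nat, c / 2 ^+ n < d.
  move=> c0 d0.
  have : (c * (2^-1) ^+ n) @[n --> \oo] --> c * 0.
    apply: cvgM; first exact: cvg_cst.
    by apply: cvg_expr; rewrite ger0_norm// invf_lt1// ltr1n.
  rewrite mulr0 => /cvgrPdist_lt /(_ _ d0) [N _ /(_ N (leqnn _))] /=.
  rewrite sub0r normrN ger0_norm; last by rewrite mulr_ge0// exprn_ge0.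
  by rewrite exprVn => h; exists N.
have au : adm u.
  split.
    apply/subspace_continuousP => z zs; apply/cvgrPdist_lt => e e0.
    (* On the unit ball around [z] the sum of the coordinates grows by at most 2 and the radius by
       at most 1, so [K] bounds [Phi] there and the iterates converge uniformly on that ball. *)
    have [C C0 HC] := Phi_loc (z.1 + z.2 + 2).
    pose K := C * (z.2 + 1).
    have z20 : 0 < z.2 by case: zs.
    have K0 : 0 <= K by rewrite mulr_ge0 ?(ltW C0)// addr_ge0// ltW.
    have [n hn] := small (2 * K) (e / 3) (mulr_ge0 (ler0n _ 2) K0) (divr_gt0 e0
        (ltr0n _ 3)).
    have cz := (adm_u n).1; move/subspace_continuousP : cz => /(_ z zs).
    move/cvgrPdist_lt => /(_ (e / 3) (divr_gt0 e0 (ltr0n _ 3))) cz.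
    have near_z : \forall x \near within strip (nbhs z),
        strip x /\ (x.1 + x.2 <= z.1 + z.2 + 2 /\ x.2 <= z.2 + 1).
      rewrite near_withinE; apply/nbhs_ballP; exists 1 => //= x [h1 h2] xs.
      move: h1 h2; rewrite /ball/= !ltr_distlC => /andP[h1 h2] /andP[h3 h4].
      by split => //; split; lra.
    have est x : strip x -> x.1 + x.2 <= z.1 + z.2 + 2 -> x.2 <= z.2 + 1 ->
        `|u_ n x - u x| < e / 3.
      move=> xs x1 x2; apply: le_lt_trans (hu n x xs) _; apply: le_lt_trans hn.
      rewrite ler_pM2r ?invr_gt0 ?exprn_gt0// ler_pM2l//.
      by apply: le_trans (HC x xs x1) _; rewrite /K ler_pM2l.
    near=> x.
    have [xs [x1 x2]] : strip x /\ (x.1 + x.2 <= z.1 + z.2 + 2 /\ x.2 <= z.2 + 1).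
      by near: x.
    have e1 := est x xs x1 x2.
    have e2 : `|u_ n z - u z| < e / 3 by apply: est => //; lra.
    have e3 : `|u_ n z - u_ n x| < e / 3 by near: x.
    rewrite (_ : u z - u x = (u_ n z - u_ n x) - (u_ n z - u z) + (u_ n x - u x));
        last by ring.
    apply: le_lt_trans (ler_normD _ _) _.
    have := ler_normB (u_ n z - u_ n x) (u_ n z - u z).
    lra.
  move=> z zs; apply: contrapT => /negP; rewrite -ltNge => h.
  have Pz := Phi0 zs.
  have gap : 0 < `|u z| - Phi z by rewrite subr_gt0.
  have [n hn] := small (2 * Phi z) (`|u z| - Phi z) (mulr_ge0 (ler0n _ 2) Pz) gap.
  have := hu n z zs; have := (adm_u n).2 z zs; move: hn.
  have := ler_distD (u_ n z) (u z) 0; rewrite !subr0 (distrC (u z)).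
  lra.
exists u; split; first exact: au.1.
move=> t r tr.
(* A positive gap is contradicted by passing through the iterate [n + 1], which is close to [u] by
   convergence and to [step u] by contraction. *)
have fix_u : u (t, r) = step u (t, r).
  apply/eqP; rewrite -subr_eq0 -normr_le0; apply: contrapT => /negP.
  rewrite -ltNge => d0; have Pz := Phi0 tr.
  have [n hn] := small (2 * Phi (t, r)) (`|u (t, r) - step u (t, r)|
      / 2) (mulr_ge0 (ler0n _ 2) Pz) (divr_gt0 d0 (ltr0n _ 2)).
  have cn : 0 <= 2 / 2 ^+ n :> R by rewrite divr_ge0// exprn_ge0.
  have h1 : `|step (u_ n) (t, r) - step u (t, r)| <= 2 / 2 ^+ n / 2 * Phi (t, r).
    apply: (step_contract cn (adm_u n) au _ tr) => z zs.
    by rewrite mulrAC; exact: hu.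
  have h2 := hu n.+1 (t, r) tr.
  have h3 := ler_distD (u_ n.+1 (t, r)) (u (t, r)) (step u (t, r)).
  rewrite distrC in h2.
  have h4 : 2 * Phi (t, r) / 2 ^+ n.+1 = 2 * Phi (t, r) / 2 ^+ n / 2.
    by rewrite exprS invfM; ring.
  rewrite h4 in h2.
  have h5 : 2 / 2 ^+ n / 2 * Phi (t, r) = 2 * Phi (t, r) / 2 ^+ n / 2 by ring.
  rewrite h5 in h1.
  have h6 : `|u_ n.+1 (t, r) - step u (t, r)| <= 2 * Phi (t, r) / 2 ^+ n / 2
      by exact: h1.
  exact: halves_absurd h2 h3 h6 hn d0.
rewrite fix_u /step/= EFinD; congr (_ + _)%E.
rewrite EFinM /duhamel /Rintegral fineK//.
by apply: integrable_fin_num (adm_int au tr); exact: measurable_Delta_minus.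
Unshelve. all: by end_near. Qed.

End Picard.

(** * Damping and free solution *)

Section HalfLine.
Context {R : realType}.
Notation mu := (@lebesgue_measure R).
Implicit Types (f w : R -> R) (x y : R).

(** Extension by the value at 0 turns continuity on the half-line into continuity on the whole
    line. *)
Definition extend_half f y : R := f (Num.max y 0).

Lemma extend_halfE f y : 0 <= y -> extend_half f y = f y.
Proof. by move=> y0; rewrite /extend_half max_l. Qed.

Lemma C0_half_nbhs f x : C0_half f -> 0 <= x ->
  forall e, 0 < e -> exists2 d, 0 < d &
    forall y, 0 <= y -> `|x - y| < d -> `|f x - f y| < e.
Proof.
move=> /subspace_continuousP cf x0 e e0.
have : `[0, +oo[%classic x by rewrite /= in_itv/= x0.
move=> /cf /cvgrPdist_lt /(_ e e0); rewrite near_withinE => /nbhs_ballP[d /= d0 H].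
by exists d => // y y0 xy; apply: H => //=; rewrite in_itv/= y0.
Qed.

Lemma nbhs_C0_half f : (forall x, 0 <= x -> forall e, 0 < e ->
    exists2 d, 0 < d & forall y, 0 <= y -> `|x - y| < d -> `|f x - f y| < e) ->
  C0_half f.
Proof.
move=> H; apply/subspace_continuousP => x; rewrite /= in_itv/= andbT => x0.
apply/cvgrPdist_lt => e e0; have [d d0 hd] := H x x0 e e0.
rewrite near_withinE; apply/nbhs_ballP; exists d => //= y xy.
by rewrite in_itv/= andbT => y0; exact: hd.
Qed.

Lemma extend_half_continuous f : C0_half f -> continuous (extend_half f).
Proof.
move=> cf x; apply/cvgrPdist_lt => e e0.
have m0 y : 0 <= Num.max y 0 by rewrite le_max lexx orbT.
have [d d0 hd] := C0_half_nbhs cf (m0 x) e0.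
apply/nbhs_ballP; exists d => //= y xy; apply: hd => //.
apply: le_lt_trans xy.
have [hx|hx] := leP x 0; have [hy|hy] := leP y 0; rewrite ?(max_l, max_r)//.
- by rewrite subrr normr0.
- by rewrite sub0r normrN (gtr0_norm hy) distrC ger0_norm; lra.
- by rewrite subr0 (gtr0_norm hx) ger0_norm; lra.
Qed.

(** Continuity is obtained at negative arguments too, where [primW] vanishes because the interval is
    empty: on [[- n, n]] it is the integral from [- n] of the extended [w] cut off at 0. *)
Lemma primW_continuous w : C0_half w -> continuous (primW w).
Proof.
move=> cw x.
pose h y := extend_half w y * (\1_(`[0, +oo[%classic) y : R).
pose n := `|x| + 1.
have n1 : 1 <= n by rewrite lerDr.
have mh : measurable_fun setT h.
  apply: measurable_funM; last exact: measurable_indic.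
  by apply: continuous_measurable_fun; exact: extend_half_continuous.
have hi : mu.-integrable `[- n, n] (EFin \o h).
  apply: measurable_bounded_integrable => //.
  - by rewrite /= lebesgue_measure_itv/=; case: ifP => // _; rewrite -EFinB ltry.
  - exact: measurable_funTS.
  - have cn : {within `[- n, n], continuous (fun x => `|extend_half w x|)}.
      by apply: continuous_subspaceT => y; apply: cvg_norm;
          exact: extend_half_continuous.
    have nn : - n <= n by lra.
    have [c _ hc] := EVT_max nn cn.
    exists `|extend_half w c|; split => // M hM y /= yn.
    rewrite /h normrM; apply: le_trans (ltW hM).
    apply: le_trans (hc y yn); rewrite ler_piMr//.
    by rewrite indicE; case: (_ \in _); rewrite ?normr1 ?normr0.
have nn : - n <= n by lra.
have := parameterized_integral_continuous nn hi.
have E y : y \in `[- n, n] -> \int[mu]_(s in `[- n, y]) h s = primW w y.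
  rewrite in_itv/= => /andP[y1 y2].
  rewrite /primW /Rintegral; congr fine.
  rewrite integral_mkcond [RHS]integral_mkcond; apply: eq_integral => s _.
  rewrite !patchE /h indicE !mem_setE !in_itv/= andbT.
  have [s0|s0] := leP 0 s; last by rewrite mulr0; case: ifP.
  by rewrite mulr1 extend_halfE// (_ : - n <= s)//; lra.
have xin : x \in `]- n, n[.
  by rewrite in_itv/= -ltr_norml /n ltrDl.
move=> cont.
have cont' : {within `[- n, n], continuous (primW w)}.
  by apply: subspace_eq_continuous cont => y; rewrite inE/= => /E.
have nlt : - n < n by lra.
by have [ctn _ _] := (continuous_within_itvP (primW w) nlt).1 cont'; exact: ctn.
Qed.

Lemma within_punctured_proper x : 0 <= x ->
  ProperFilter (within `[0, +oo[ (x^')).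
Proof.
move=> x0; apply: Build_ProperFilter_ex => P;
    rewrite /within/= => /nbhs_ballP[d /= d0 H].
exists (x + d / 2); apply: H.
- by rewrite /ball/= opprD addNKr normrN gtr0_norm; lra.
- by rewrite /= gt_eqF; lra.
- by rewrite in_itv/= andbT; lra.
Qed.

Lemma diffquot_half_near f x d : C1_half f -> 0 <= x -> 0 < d ->
  \forall y \near within `[0, +oo[ (x^'), `|derive_half f x - (f y - f x) / (y -
      x)| < d.
Proof.
move=> [cvf _] x0 d0; have := cvf x x0 => /cvg_ex[l hl].
have PF := within_punctured_proper x0.
have -> : derive_half f x = l.
  by apply: cvg_lim => //; exact: norm_hausdorff.
by move/cvgrPdist_lt : hl => /(_ d d0).
Qed.

Lemma C1_half_continuous f : C1_half f -> C0_half f.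
Proof.
move=> C1f; apply: nbhs_C0_half => x x0 e e0.
have := diffquot_half_near C1f x0 ltr01.
rewrite near_withinE => /nbhs_ballP[d /= d0 H].
pose L := `|derive_half f x| + 1.
have L0 : 0 < L by rewrite ltr_wpDl.
exists (Num.min d (e / L)); first by rewrite lt_min d0/= divr_gt0.
move=> y y0; rewrite lt_min => /andP[xyd xye].
have [->|yx] := eqVneq y x; first by rewrite subrr normr0.
have yx0 : y - x != 0 by rewrite subr_eq0.
have hy := H y xyd yx; rewrite /= in_itv/= y0 in hy.
have {hy} := hy isT; set q := (f y - f x) / (y - x) => hy.
have -> : f x - f y = q * (x - y).
  by rewrite /q -(opprB y x) mulrN divfK// opprB.
have qL : `|q| <= L.
  have := ler_distD (derive_half f x) q 0; rewrite !subr0 (distrC q).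
  by rewrite /L; lra.
rewrite normrM; apply: le_lt_trans (_ : L * `|x - y| < e).
  by apply: ler_wpM2r.
by rewrite mulrC -ltr_pdivlMr.
Qed.

Lemma derive_half_mul_id f x : C1_half f -> 0 <= x ->
  derive_half (fun r => r * f r) x = f x + x * derive_half f x.
Proof.
move=> C1f x0; have PF := within_punctured_proper x0.
apply: cvg_lim; first exact: norm_hausdorff.
apply/cvgrPdist_lt => e e0.
have [d1 d10 h1] := C0_half_nbhs (C1_half_continuous C1f) x0 (divr_gt0 e0 (ltr0n _ 2)).
(* The denominator is [x + 1] because [x = 0] is allowed. *)
have ex0 : 0 < e / 2 / (x + 1) by rewrite !divr_gt0//; lra.
have := diffquot_half_near C1f x0 ex0.
rewrite !near_withinE => /nbhs_ballP[d2 /= d20 h2].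
apply/nbhs_ballP; exists (Num.min d1 d2); first by rewrite /= lt_min d10.
move=> y; rewrite /ball/= lt_min => /andP[xy1 xy2] yx; rewrite /= in_itv/= andbT => y0.
have hy1 := h1 y y0 xy1.
have := h2 y xy2 yx; rewrite in_itv/= y0 => /(_ isT) hy2.
have yx0 : y - x != 0 by rewrite subr_eq0.
rewrite (_ : _ - _ = (f x - f y) + x * (derive_half f x - (f y - f x) / (y - x)));
    last by field.
apply: le_lt_trans (ler_normD _ _) _; rewrite normrM (ger0_norm x0).
have : x * `|derive_half f x - (f y - f x) / (y - x)| <= e / 2.
  apply: (@le_trans _ _ ((x + 1) * (e / 2 / (x + 1)))).
    by apply: ler_pM => //; [lra|exact: ltW].
  by rewrite mulrC divfK// gt_eqF//; lra.
lra.
Qed.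

End HalfLine.

Definition asymptotic_damping {R : realType} (m : R) (w : R -> R) :=
  exists r0 delta A : R, [/\ 0 < r0, 0 < delta, 0 < A &
    forall r : R, r0 <= r ->
      `|2 * w r - m / r| <= A * r `^ (- 1 - delta)].

(** * Logarithmic growth of the primitive of the damping *)

Section Damping.
Context {R : realType}.
Notation mu := (@lebesgue_measure R).
Variables (m : R) (w : R -> R).
Hypothesis m0 : 0 <= m.
Hypothesis hwC0 : C0_half w.
Hypothesis hw : asymptotic_damping m w.

(** Comparing with [1 / (1 + y)] instead of [1 / y] makes the expansion valid down to the origin: a
    bounded range is covered by compactness, and far away the two differ by a term of order
    [y^(-2)]. *)
Lemma damping_remainder : exists d K : R, [/\ 0 < d, 0 < K & forall y, 0 <= y ->
  `|w y - m / 2 * (1 + y)^-1| <= K * (1 + y) `^ (- 1 - d)].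
Proof.
have m_ge0 := m0; have [r0 [dl [A [r00 dl0 A0 H]]]] := hw.
(* [d <= 1] lets the error of order [y^(-2)] be absorbed, and [r1 >= 1] makes [y] and [1 + y]
   comparable beyond [r1]. *)
pose d : R := Num.min dl 1; pose r1 : R := Num.max r0 1.
have d0 : 0 < d by rewrite lt_min dl0 ltr01.
have d1 : d <= 1 by rewrite ge_min lexx orbT.
have ddl : d <= dl by rewrite ge_min lexx.
have r11 : 1 <= r1 by rewrite le_max lexx orbT.
have r01 : r0 <= r1 by rewrite le_max lexx.
pose F (y : R) : R := `|extend_half w y - m / 2 * (1 + `|y|)^-1|.
have cF : {within `[0, r1], continuous F}.
  apply: continuous_subspaceT => y; apply: cvg_norm; apply: cvgB.
    exact: extend_half_continuous.
  apply: cvgM; first exact: cvg_cst.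
  apply: cvgV; first by rewrite gt_eqF// ltr_wpDr.
  by apply: cvgD; [exact: cvg_cst|exact: cvg_norm].
have r10 : 0 <= r1 by lra.
have [c _ hc] := EVT_max r10 cF.
pose K1 : R := F c * (1 + r1) `^ (1 + d).
(* The hypothesis controls twice the remainder, and passing from [y] to [1 + y] costs at most
   [4 >= 2^(1 + d)], whence [2 A]; the change of comparison function adds [m]. *)
pose K2 : R := 2 * A + m.
have K10 : 0 <= K1 by rewrite mulr_ge0 ?powR_ge0 ?normr_ge0.
exists d, (K1 + K2 + 1); split => //; first by rewrite /K2; lra.
move=> y y0.
have P0 : 0 < (1 + y) `^ (- 1 - d) by apply: powR_gt0; lra.
have [yr|yr] := leP y r1.
  apply: (@le_trans _ _ (K1 * (1 + y) `^ (-1 - d))); last first.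
    by rewrite ler_pM2r// /K2; lra.
  apply: (@le_trans _ _ (F c)).
    have := hc y; rewrite in_itv/= y0 yr => /(_ isT).
    by rewrite /F extend_halfE// (ger0_norm y0).
  rewrite /K1 -mulrA ler_peMr ?normr_ge0//.
  apply: (@le_trans _ _ ((1 + y) `^ (1 + d) * (1 + y) `^ (- 1 - d))).
    rewrite -powRD_gt0; last lra.
    by rewrite (_ : 1 + d + (-1 - d) = 0) ?powRr0//; ring.
  by rewrite ler_pM2r//; apply: powR_monotone; lra.
have y1 : 1 <= y by lra.
have yp : 0 < y by lra.
have h1 : `|w y - m / 2 / y| <= 2 * A * (1 + y) `^ (-1 - d).
  have := H y (le_trans r01 (ltW yr)).
  have -> : 2 * w y - m / y = 2 * (w y - m / 2 / y) by field; rewrite gt_eqF.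
  rewrite normrM ger0_norm// => h.
  have h2 : y `^ (- 1 - dl) <= y `^ (- 1 - d) by apply: ler_powR => //; lra.
  have h3 : y `^ (- 1 - d) <= 4 * (1 + y) `^ (- 1 - d).
    apply: (@le_trans _ _ ((2^-1 * (1 + y)) `^ (- 1 - d))).
      by apply: powR_antitone; lra.
    rewrite powRM; [|lra|lra]; apply: ler_wpM2r; first exact: ltW.
    rewrite -powR_inv1// -powRrM mulN1r.
    apply: (@le_trans _ _ (2 `^ 2%:R)); first by apply: ler_powR; lra.
    by rewrite powR_mulrn//; lra.
  have := ler_wpM2l (ltW A0) (le_trans h2 h3).
  lra.
have h2 : `|m / 2 / y - m / 2 * (1 + y)^-1| <= m * (1 + y) `^ (- 1 - d).
  have e : m / 2 / y - m / 2 * (1 + y)^-1 = m / 2 * (y * (1 + y))^-1.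
    by field; rewrite !gt_eqF//; lra.
  rewrite e ger0_norm; last by rewrite !mulr_ge0// ?invr_ge0; nra.
  rewrite -mulrA; apply: ler_wpM2l => //.
  apply: (@le_trans _ _ ((1 + y) `^ (- 2%:R))).
    rewrite powR_invn; last lra.
    rewrite -invfM lef_pV2 ?posrE; [|nra|].
      by rewrite expr2; nra.
    by rewrite exprn_gt0//; lra.
  by apply: ler_powR; lra.
have := ler_distD (m / 2 / y) (w y) (m / 2 * (1 + y)^-1).
rewrite /K2 !mulrDl mul1r.
have : 0 <= K1 * (1 + y) `^ (-1 - d) by rewrite mulr_ge0// ltW.
lra.
Qed.

Lemma damping_le : exists2 K : R, 0 < K &
  forall y, 0 <= y -> `|w y| <= K * (1 + y)^-1.
Proof.
have m_ge0 := m0; have [d [K [d0 K0 H]]] := damping_remainder.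
exists (K + m / 2); first by apply: ltr_wpDr => //; lra.
move=> y y0; have := ler_distD (m / 2 * (1 + y)^-1) (w y) 0.
rewrite !subr0 => h; apply: le_trans h _; rewrite mulrDl; apply: lerD.
  apply: le_trans (H y y0) _; rewrite ler_pM2l// -powR_inv1; last lra.
  by apply: ler_powR; lra.
by rewrite ger0_norm// mulr_ge0 ?invr_ge0//; lra.
Qed.

(** The remainder is integrable at infinity, with integral at most [K / d], and the leading part
    integrates to the logarithm. *)
Lemma primW_log : exists2 K : R, 0 < K &
  forall r, 0 <= r -> `|primW w r - m / 2 * ln (1 + r)| <= K.
Proof.
have m_ge0 := m0; have [d [K [d0 K0 H]]] := damping_remainder.
exists (K / d); first exact: divr_gt0.
move=> r r0.
have cinv : {within `[0, r], continuous (fun y : R => (1 + `|y|)^-1)}.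
  apply: continuous_subspaceT => y.
  apply: cvgV; first by rewrite gt_eqF// ltr_wpDr.
  by apply: cvgD; [exact: cvg_cst|exact: cvg_norm].
have i1 : mu.-integrable `[0, r] (EFin \o extend_half w).
  apply: continuous_compact_integrable; first exact: segment_compact.
  by apply: continuous_subspaceT; exact: extend_half_continuous.
have i2 : mu.-integrable `[0, r] (EFin \o (fun y : R => (1 + `|y|)^-1)).
  apply: continuous_compact_integrable => //; exact: segment_compact.
have i3 : mu.-integrable `[0, r] (EFin \o (fun y : R => m / 2 * (1 + `|y|)^-1)).
  exact: integrableZl i2.
have e1 : primW w r = \int[mu]_(y in `[0, r]) extend_half w y.
  apply: eq_Rintegral => y; rewrite inE/= in_itv/= => /andP[y0 _].
  by rewrite extend_halfE.
have e2 : m / 2 * ln (1 + r) = \int[mu]_(y in `[0, r]) (m / 2 * (1 + `|y|)^-1).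
  rewrite RintegralZl//; congr (_ * _).
  rewrite /Rintegral.
  have -> : (\int[mu]_(y in `[0%R, r]) ((1 + `|y|)^-1)%:E =
             \int[mu]_(y in `[0%R, r]) ((1 + y) `^ (-1))%:E)%E.
    apply: eq_integral => y; rewrite inE/= in_itv/= => /andP[y0 _].
    by rewrite powR_inv1; [rewrite ger0_norm|lra].
  by rewrite integral_inv_shift ?addr0// ln1 subr0.
rewrite e1 e2 -RintegralB//.
apply: le_trans (le_normr_Rintegral _ _) _ => //; first exact: integrableB i1 i3.
rewrite -lee_fin /Rintegral fineK; last first.
  apply: integrable_fin_num => //.
  by apply: (@integrable_norm _ _ _ mu); exact: integrableB i1 i3.
apply: (@le_trans _ _ (K%:E * \int[mu]_(y in `[0%R, r]) ((1 + y) `^ (- 1 - d))%:E)%E).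
  apply: ge0_le_integralZ => //.
  - apply: measurableT_comp => //; apply: measurable_funB.
      apply: measurable_funTS; apply: continuous_measurable_fun.
      exact: extend_half_continuous.
    by have /integrableP[/measurable_EFinP] := i3.
  - exact: measurable_bracketD.
  - exact: ltW.
  - by move=> y _; exact: powR_ge0.
  - move=> y; rewrite /= in_itv/= => /andP[y0 _].
    by rewrite normr_ge0 extend_halfE// (ger0_norm y0); exact: H.
rewrite integral_powR_shift//; last lra.
rewrite -EFinM lee_fin ler_pM2l// (_ : - 1 - d + 1 = - d); last by ring.
rewrite addr0 powR1 invrN !mulrN opprK addrC.
have : 0 <= (1 + r) `^ (- d) / d by rewrite divr_ge0 ?powR_ge0// ltW.
by rewrite mul1r; lra.
Qed.

Lemma expR_primW : exists2 K : R, 0 < K & forall r, 0 <= r ->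
  expR (- primW w r) <= K * (1 + r) `^ (- (m / 2)) /\
  expR (primW w r) <= K * (1 + r) `^ (m / 2).
Proof.
have m_ge0 := m0; have [K K0 H] := primW_log; exists (expR K); first exact: expR_gt0.
move=> r r0; have := H r r0; rewrite ler_norml => /andP[h1 h2].
have r1 : 1 + r != 0 by rewrite gt_eqF//; lra.
by rewrite /powR (negbTE r1) -!expRD !ler_expR mulNr; split; lra.
Qed.

(** The middle factor is evaluated at a point [s] between 0 and [y], and [m >= 0] allows [1 + s] to
    be replaced by [1 + y]. Its two powers [m / 2], against one power [- m / 2] from the last
    factor, leave a single power [m / 2] of [1 + y]. *)
Lemma E_minus_bracket : exists2 K : R, 0 < K & forall t r y,
  0 <= r -> 0 <= y -> 0 <= y - t + r <= 2 * y ->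
  E_minus w t r y <= K * ((1 + r) `^ (- (m / 2)) * (1 + y) `^ (m / 2)).
Proof.
have m_ge0 := m0; have [K K0 H] := expR_primW.
exists (K * (K * K) * K); first by rewrite !mulr_gt0.
move=> t r y r0 y0 /andP[s0 sy].
pose s : R := (y - t + r) / 2.
have s00 : 0 <= s by rewrite divr_ge0.
have sy' : s <= y by rewrite /s ler_pdivrMr//; lra.
have [h1 _] := H r r0; have [h2 _] := H y y0; have [_ h3] := H s s00.
rewrite /E_minus -/s (_ : 2 * primW w s = primW w s + primW w s); last by ring.
rewrite expRD.
have h4 : expR (primW w s) <= K * (1 + y) `^ (m / 2).
  apply: le_trans h3 _; rewrite ler_pM2l//.
  apply: powR_monotone; [exact: ltW (bracket_gt0 s00)|by rewrite lerD2l|].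
  by rewrite divr_ge0.
apply: (@le_trans _ _ (K * (1 + r) `^ (- (m / 2)) *
    ((K * (1 + y) `^ (m / 2)) * (K * (1 + y) `^ (m / 2))) *
    (K * (1 + y) `^ (- (m / 2))))).
  apply: ler_pM; rewrite ?mulr_ge0 ?expR_ge0//.
  apply: ler_pM; rewrite ?mulr_ge0 ?expR_ge0//.
  by apply: ler_pM; rewrite ?expR_ge0.
have yy : (1 + y) `^ (m / 2) * (1 + y) `^ (- (m / 2)) = 1.
  by rewrite -(powRD_gt0 _ _ (bracket_gt0 y0)) subrr powRr0.
set a := (1 + y) `^ (m / 2) in yy *; set b := (1 + y) `^ _ in yy *.
set c := (1 + r) `^ _.
rewrite (_ : K * c * (K * a * (K * a)) * (K * b) =
    K * (K * K) * K * (c * a) * (a * b)); last by ring.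
by rewrite yy mulr1.
Qed.

End Damping.

(** * Cauchy data in the representation formula *)

Section FreeSolution.
Context {R : realType}.
Notation mu := (@lebesgue_measure R).
Variables (m kappa : R) (w f0 f1 : R -> R).
Hypothesis m0 : 0 <= m.
Hypothesis mkappa : m / 2 < kappa.
Hypothesis hwC0 : C0_half w.
Hypothesis hw : asymptotic_damping m w.
Hypothesis hf0C1 : C1_half f0.
Hypothesis hf1C0 : C0_half f1.
Hypothesis hf0 : forall r : R, 0 <= r -> `|f0 r| <= japanese r `^ (- kappa).
Hypothesis hf1 : forall r : R, 0 <= r ->
     `|derive_half f0 r| + `|f1 r| <= japanese r `^ (- kappa - 1).

Let phi (r : R) := r * f0 r.
Let psi (r : R) := r * f1 r.

(* A globally continuous function agreeing with [psi + phi' + w phi] on the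
   half-line. *)
Definition cauchy_density (y : R) : R :=
  Num.max y 0 * extend_half f1 y +
  (extend_half f0 y + Num.max y 0 * extend_half (derive_half f0) y) +
  extend_half w y * (Num.max y 0 * extend_half f0 y).

Lemma max0_continuous : continuous (fun y : R => Num.max y 0).
Proof.
move=> x; apply: (@continuous_max _ _ (fun y : R => y) (fun=> 0)).
  exact: cvg_id.
exact: cvg_cst.
Qed.

Lemma cauchy_densityE y : 0 <= y ->
  cauchy_density y = psi y + derive_half phi y + w y * phi y.
Proof.
move=> y0; rewrite /cauchy_density !extend_halfE// max_l//.
by rewrite /phi derive_half_mul_id.
Qed.

Lemma cauchy_density_continuous : continuous cauchy_density.
Proof.
have c1 := extend_half_continuous hf1C0.
have c0 := extend_half_continuous (C1_half_continuous hf0C1).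
have cd := extend_half_continuous hf0C1.2.
have cw := extend_half_continuous hwC0.
move=> x; have cm := @max0_continuous x.
apply: cvgD; last first.
  by apply: cvgM; [exact: cw|apply: cvgM; [exact: cm|exact: c0]].
apply: cvgD; first by apply: cvgM; [exact: cm|exact: c1].
apply: cvgD; first exact: c0.
by apply: cvgM; [exact: cm|exact: cd].
Qed.

Lemma japanese_powR_le (c r : R) : 0 <= c -> 0 <= r ->
  japanese r `^ (- c) <= 2 `^ c * (1 + r) `^ (- c).
Proof.
move=> c0 r0; have h : 2^-1 * (1 + r) <= japanese r.
  rewrite -[leLHS]ger0_norm; last by rewrite mulr_ge0//; lra.
  rewrite -sqrtr_sqr /japanese ler_wsqrtr//; nra.
have -> : 2 `^ c = (2^-1 : R) `^ (- c).
  by rewrite -[2^-1]powR_inv1// -powRrM mulN1r opprK.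
rewrite -powRM; [|lra|lra].
by apply: powR_antitone => //; lra.
Qed.

(** The factor [y] in [phi] and [psi] costs one power of [1 + y], which is regained from the faster
    decay of [f1] and of the derivative of [f0], and in the term [w phi] from the decay of [w]. *)
Lemma data_le : exists2 K : R, 0 < K & forall y, 0 <= y ->
  `|f0 y| <= K * (1 + y) `^ (- kappa) /\
  `|cauchy_density y| <= K * (1 + y) `^ (- kappa).
Proof.
have m_ge0 := m0; have mk := mkappa.
have [Kw Kw0 Hw] := damping_le m0 hwC0 hw.
pose a : R := 2 `^ kappa; pose b : R := 2 `^ (kappa + 1).
have a0 : 0 < a by exact: powR_gt0.
have b0 : 0 < b by exact: powR_gt0.
exists (b + a + b + Kw * a); first by rewrite !addr_gt0// mulr_gt0.
move=> y y0; pose P : R := (1 + y) `^ (- kappa).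
have P0 : 0 < P by apply: powR_gt0; lra.
have h0 : `|f0 y| <= a * P.
  by apply: le_trans (hf0 y0) _; apply: japanese_powR_le => //; lra.
have h1 : `|derive_half f0 y| + `|f1 y| <= b * (1 + y) `^ (- (kappa + 1)).
  apply: le_trans (hf1 y0) _; rewrite (_ : - kappa - 1 = - (kappa + 1)); last by ring.
  by apply: japanese_powR_le => //; lra.
have hP : y * (1 + y) `^ (- (kappa + 1)) <= P.
  apply: (@le_trans _ _ ((1 + y) * (1 + y) `^ (- (kappa + 1)))).
    by apply: ler_wpM2r; [exact: powR_ge0|lra].
  rewrite mul_powR_succ; last lra.
  by rewrite (_ : 1 + - (kappa + 1) = - kappa) //; ring.
have n1 : 0 <= `|derive_half f0 y| by [].
have n2 : 0 <= `|f1 y| by [].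
have bP : b * (y * (1 + y) `^ (- (kappa + 1))) <= b * P by rewrite ler_pM2l.
have h2 : y * `|f1 y| <= b * P.
  apply: le_trans bP; rewrite mulrCA; apply: ler_wpM2l => //; lra.
have h3 : y * `|derive_half f0 y| <= b * P.
  apply: le_trans bP; rewrite mulrCA; apply: ler_wpM2l => //; lra.
have h4 : `|w y| * (y * `|f0 y|) <= Kw * a * P.
  apply: (@le_trans _ _ (Kw * (1 + y)^-1 * (y * (a * P)))).
    apply: ler_pM; rewrite ?mulr_ge0//; first exact: Hw.
    by apply: ler_wpM2l.
  rewrite (_ : _ * _ * _ = Kw * (a * P) * (y / (1 + y))); last by ring.
  rewrite -[leRHS]mulr1; apply: ler_pM.
  - by apply: mulr_ge0; [exact: ltW|apply: mulr_ge0; exact: ltW].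
  - by rewrite divr_ge0//; lra.
  - by rewrite mulrA.
  - by rewrite ler_pdivrMr ?mul1r; lra.
have aP0 : 0 < a * P by exact: mulr_gt0.
have bP0 : 0 < b * P by exact: mulr_gt0.
have kP0 : 0 < Kw * a * P by rewrite !mulr_gt0.
split; first by rewrite -/P !mulrDl; lra.
rewrite /cauchy_density !extend_halfE// max_l// -/P !mulrDl.
apply: le_trans (ler_normD _ _) _.
rewrite !normrM (ger0_norm y0); apply: lerD => //.
apply: le_trans (ler_normD _ _) _; rewrite -addrA; apply: lerD.
  by rewrite normrM (ger0_norm y0).
apply: le_trans (ler_normD _ _) _; apply: lerD => //.
by rewrite normrM (ger0_norm y0).
Qed.

(* The boundary term vanishes on the light cone since [phi 0 = 0], so that no
   case distinction is left. *)
Lemma u_L_split t r : u_L w phi psi t r =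
  2^-1 * \int[mu]_(y in `[`|t - r|, t + r]) (E_minus w t r y * cauchy_density y) +
  E_minus w t r (r - t) * (Num.max (r - t) 0 * extend_half f0 (r - t)).
Proof.
rewrite /u_L; congr (2^-1 * _ + _).
  apply: eq_Rintegral => y; rewrite inE/= in_itv/= => /andP[y0 _].
  by rewrite cauchy_densityE//; exact: le_trans y0.
rewrite /chi /phi; case: ifPn => [rt|]; first by rewrite mul1r extend_halfE// max_l.
by rewrite -ltNge => rt; rewrite !mul0r max_r ?ltW// mul0r mulr0.
Qed.

End FreeSolution.

(** * Decay and continuity of the free solution *)

Section FreeSolutionBound.
Context {R : realType}.
Notation mu := (@lebesgue_measure R).
Variables (m kappa : R) (w f0 f1 : R -> R).
Hypothesis m0 : 0 <= m.
Hypothesis mkappa : m / 2 < kappa.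
Hypothesis hwC0 : C0_half w.
Hypothesis hw : asymptotic_damping m w.
Hypothesis hf0C1 : C1_half f0.
Hypothesis hf1C0 : C0_half f1.
Hypothesis hf0 : forall r : R, 0 <= r -> `|f0 r| <= japanese r `^ (- kappa).
Hypothesis hf1 : forall r : R, 0 <= r ->
     `|derive_half f0 r| + `|f1 r| <= japanese r `^ (- kappa - 1).

Let phi (r : R) := r * f0 r.
Let psi (r : R) := r * f1 r.
Let cd := cauchy_density w f0 f1.
Let cW : continuous (primW w). Proof. exact: primW_continuous. Qed.
Let ccd : continuous cd. Proof. exact: cauchy_density_continuous. Qed.

Let light_integrand_continuous t r : continuous (fun y => E_minus w t r y * cd y).
Proof.
move=> y; apply: cvgM; last exact: ccd.
by apply: cvg_E_minus; [exact: cW|exact: cvg_cst|exact: cvg_cst|exact: cvg_id].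
Qed.

(** The kernel and the data combine to [(1 + y)^(m / 2 - kappa)], which is [(1 + y)^(-1 - nu)]; this
    identity is the origin of [nu], and the bracket integral turns it into the weight of rate
    [nu]. *)
Lemma u_L_le s : admissible (kappa - m / 2 - 1) s -> exists2 C : R, 0 < C &
  forall t r, 0 <= t -> 0 < r -> `|u_L w phi psi t r| <=
    C * ((1 + r) `^ (- (m / 2)) * coneweight (kappa - m / 2 - 1) s t r).
Proof.
set nu := kappa - m / 2 - 1 => adm; have m_ge0 := m0; have mk := mkappa.
have [K1 K10 HE] := E_minus_bracket m0 hwC0 hw.
have [K2 K20 HD] := data_le m0 mkappa hwC0 hw hf0 hf1.
have [K3 K30 HI] := integral_bracket_admissible adm.
have [s0 snu hs] := adm.
have nus : nu <= s by case: hs => [/ltW|[->]].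
exists (K1 * K2 * K3 + K1 * K2 * 2); first by rewrite addr_gt0 ?mulr_gt0.
move=> t r t0 r0; have r_ge0 := ltW r0.
pose A : R := t + r; pose B : R := `|t - r|.
have B0 : 0 <= B by exact: normr_ge0.
have B1 : r - t <= B by rewrite /B distrC ler_norm.
have B2 : t - r <= B by exact: ler_norm.
have BA : B <= A by exact: dist_le_add.
have AB : A - B <= 2 * r by exact: add_sub_dist_le.
pose P : R := (1 + r) `^ (- (m / 2)).
have A0 : 0 <= A by exact: le_trans BA.
have P0 : 0 < P by apply: powR_gt0; exact: bracket_gt0.
pose H : R := coneweight nu s t r.
pose Q : R := (1 + A) `^ (- 1 - nu + s) * (1 + B) `^ (- s).
have Q0 : 0 <= Q by apply: mulr_ge0; exact: powR_ge0.
have HQ : H = r * Q by rewrite /H /coneweight -mulrA.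
have first_le : `|\int[mu]_(y in `[B, A]) (E_minus w t r y * cd y)| <=
    2 * (K1 * K2 * K3 * (P * H)).
  have iL : mu.-integrable `[B, A] (EFin \o (fun y => E_minus w t r y * cd y)).
    apply: continuous_compact_integrable; first exact: segment_compact.
    by apply: continuous_subspaceT; exact: light_integrand_continuous.
  apply: le_trans (le_normr_Rintegral _ iL) _ => //.
  rewrite -lee_fin /Rintegral fineK; last first.
    apply: integrable_fin_num => //.
    by apply: (@integrable_norm _ _ _ mu); exact: iL.
  apply: (@le_trans _ _ ((K1 * K2 * P)%:E * \int[mu]_(y in `[B,
      A]) ((1 + y) `^ (- 1 - nu))%:E)%E).
    apply: ge0_le_integralZ => //.
    - apply: measurableT_comp => //; apply: measurable_funTS.
      by apply: continuous_measurable_fun; exact: light_integrand_continuous.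
    - exact: measurable_bracketD.
    - by rewrite !mulr_ge0// ltW.
    - by move=> y _; exact: powR_ge0.
    - move=> y; rewrite /= in_itv/= => /andP[y1 y2]; rewrite normr_ge0/=.
      have y0 : 0 <= y by exact: le_trans y1.
      rewrite normrM (ger0_norm (E_minus_ge0 _ _ _ _)).
      have [_ hcd] := HD y y0.
      have hE : E_minus w t r y <= K1 * (P * (1 + y) `^ (m / 2)).
        by apply: HE => //; apply/andP; split; lra.
      apply: le_trans (ler_pM (E_minus_ge0 _ _ _ _) (normr_ge0 _) hE hcd) _.
      rewrite (_ : - 1 - nu = m / 2 + - kappa); last by rewrite /nu; ring.
      rewrite (powRD_gt0 _ _ (bracket_gt0 y0)).
      by rewrite le_eqVlt; apply/orP; left; apply/eqP; ring.
  have k0 : (0 <= (K1 * K2 * P)%:E)%E by rewrite lee_fin !mulr_ge0// ltW.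
  apply: le_trans (lee_wpmul2l k0 (HI A B B0 BA)) _.
  rewrite -EFinM lee_fin HQ -mulrA -/Q.
  have h : (A - B) * Q <= 2 * r * Q by apply: ler_wpM2r.
  have k : 0 <= K1 * K2 * P * K3 by rewrite !mulr_ge0// ltW.
  have := ler_wpM2l k h; rewrite /Q.
  set x := (A - B) * _; set z := 2 * r * _.
  move=> hx; rewrite -mulrA -[(A - B) * _ * _]mulrA -/x !mulrA in hx *.
  by apply: le_trans hx _; rewrite le_eqVlt; apply/orP; left; apply/eqP;
      rewrite /z; ring.
have second_le : `|E_minus w t r (r - t) * (Num.max (r - t) 0 * extend_half f0 (r -
    t))| <= K1 * K2 * 2 * (P * H).
  have [rt|rt] := leP 0 (r - t); last first.
    rewrite mul0r mulr0 normr0; apply: mulr_ge0; first by rewrite !mulr_ge0// ltW.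
    by apply: mulr_ge0; [exact: ltW|rewrite HQ mulr_ge0].
  rewrite extend_halfE// normrM (ger0_norm (E_minus_ge0 _ _ _ _)) normrM (ger0_norm rt).
  have [hf _] := HD _ rt.
  have hE : E_minus w t r (r - t) <= K1 * (P * (1 + (r - t)) `^ (m / 2)).
    by apply: HE => //; apply/andP; split; lra.
  apply: (@le_trans _ _ (K1 * (P * (1 + (r - t)) `^ (m / 2)) * ((r - t) * (K2 * (1
      + (r - t)) `^ (- kappa))))).
    apply: ler_pM => //; first exact: E_minus_ge0.
      by apply: mulr_ge0.
    by apply: ler_wpM2l.
  have BE : B = r - t by rewrite /B distrC ger0_norm.
  have e1 : (1 + (r - t)) `^ (m / 2) * (1 + (r - t)) `^ (- kappa) =
      (1 + B) `^ (- (1 + nu - s)) * (1 + B) `^ (- s).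
    rewrite -BE -!(powRD_gt0 _ _ (bracket_gt0 B0)); congr (_ `^ _); rewrite /nu; ring.
  (* The boundary term lives on [t <= r], where [B = r - t <= r]: monotonicity of [x (1 + x)^(-e)]
     replaces [B] by [r], and [1 + r] is at least half of [1 + A]. *)
  have e2 : (r - t) * (1 + B) `^ (- (1 + nu - s)) <= 2 * r * (1 + A) `^ (- 1 - nu + s).
    rewrite -BE; apply: (@le_trans _ _ (r * (1 + r) `^ (- (1 + nu - s)))).
      by apply: mul_powR1D_mono; [exact: B0|rewrite BE; lra|lra].
    rewrite -[leRHS]mulrA mulrCA; apply: ler_wpM2l => //.
    apply: (@le_trans _ _ ((2^-1 * (1 + A)) `^ (- (1 + nu - s)))).
      by apply: powR_antitone; rewrite /A; lra.
    rewrite powRM ?invr_ge0 ?(ltW (bracket_gt0 A0))//.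
    rewrite (_ : - 1 - nu + s = - (1 + nu - s)); last by ring.
    apply: ler_wpM2r; first exact: powR_ge0.
    rewrite -powR_inv1// -powRrM mulN1r opprK.
    by apply: ler1_powR => //; lra.
  have := ler_wpM2r (powR_ge0 (1 + B) (- s)) e2.
  have k : 0 <= K1 * K2 * P by rewrite !mulr_ge0// ltW.
  move=> /(ler_wpM2l k) h; rewrite HQ /Q.
  apply: le_trans (_ : _ <= K1 * K2 * P * ((r - t) * (1 + B) `^ (- (1 + nu - s)) *
      (1 + B) `^ (- s))) _.
    rewrite -[(r - t) * _ * _]mulrA -e1 le_eqVlt; apply/orP; left; apply/eqP; ring.
  by apply: le_trans h _; rewrite le_eqVlt; apply/orP; left; apply/eqP; ring.
rewrite (u_L_split _ _ hf0C1) -/cd -/A -/B mulrDl.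
apply: le_trans (ler_normD _ _) _; apply: lerD => //.
rewrite normrM ger0_norm ?invr_ge0// mulrC ler_pdivrMr// mulrC.
exact: first_le.
Qed.

(** Bounded convergence again, the moving interval being an indicator on the fixed [[0, rho]] that
    converges except at the two limiting endpoints. *)
Lemma u_L_continuous T :
  {within strip T, continuous (fun z => u_L w phi psi z.1 z.2)}.
Proof.
apply/subspace_continuousP => -[t r] [/= /andP[t0 tT] r0].
apply: cvg_within_seq => a b Dab /= at_ br.
rewrite [X in _ --> X](u_L_split w f1 hf0C1 t r) -/cd.
rewrite (_ : (fun n => u_L w phi psi (a n) (b n)) = (fun n =>
  2^-1 * \int[mu]_(y in `[`|a n - b n|, a n + b n]) (E_minus w (a n) (b n) y * cd y) +
  E_minus w (a n) (b n) (b n - a n) *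
    (Num.max (b n - a n) 0 * extend_half f0 (b n - a n)))); last first.
  by apply/funext => n; rewrite (u_L_split w f1 hf0C1).
apply: cvgD; last first.
  have c_ : b n - a n @[n --> \oo] --> r - t by exact: cvgB.
  apply: cvgM; first exact: cvg_E_minus.
  apply: cvgM.
    exact: (cvg_comp _ _ c_ (@max0_continuous R (r - t))).
  have cf0 := extend_half_continuous (C1_half_continuous hf0C1).
  exact: (cvg_comp _ _ c_ (cf0 (r - t))).
apply: cvgM; first exact: cvg_cst.
have [Mb Mb0 hMb] : exists2 Mb : R, 0 < Mb & forall n, b n <= Mb.
  have [/= M0 [_ HM]] : bounded_fun b by apply: cvg_seq_bounded; apply/cvg_ex; exists r.
  exists (`|M0| + 1); first by apply: ltr_wpDl.
  move=> n; apply: le_trans (ler_norm _) _; apply: (HM (`|M0| + 1)) => //.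
  by apply: le_lt_trans (ler_norm _) _; rewrite ltrDl.
pose rho : R := T + Mb + r.
pose good (s q : R) := [/\ 0 <= s, 0 < q & s + q <= rho].
have gab n : good (a n) (b n).
  have [/andP[h0 h1] h2] := Dab n; have h3 := hMb n.
  by split => //; move: h1 => /= h1; rewrite /rho; lra.
have gtr : good t r by split => //; rewrite /rho; lra.
have [K K0 HK] := E_minus_bounded cW rho.
have rho0 : 0 <= rho by rewrite /rho; lra.
have cn : {within `[0, rho], continuous (fun x => `|cd x|)}.
  by apply: continuous_subspaceT => x; apply: cvg_norm; exact: ccd.
have [c _ hc] := EVT_max rho0 cn.
pose M : R := K * `|cd c|.
pose I (s q : R) : set R := `[`|s - q|, s + q]%classic.
pose F (s q y : R) : R := ((fun y => E_minus w s q y * cd y) \_ (I s q)) y.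
have IQ s q : good s q -> I s q `<=` `[0, rho]%classic.
  move=> [s0 q0 sq] y; rewrite /I/= !in_itv/= => /andP[y1 y2].
  by rewrite (le_trans y2 sq) (le_trans _ y1).
have E s q : good s q ->
    \int[mu]_(y in `[`|s - q|, s + q]) (E_minus w s q y * cd y) =
    fine (\int[mu]_(y in `[0%R, rho]) (F s q y)%:E)%E.
  move=> gsq; rewrite /Rintegral; congr fine.
  transitivity (\int[mu]_(y in `[0%R, rho] `&` I s q) (E_minus w s q y * cd y)%:E)%E.
    by rewrite (setIidr (IQ s q gsq)).
  rewrite integral_mkcondr; apply: eq_integral => y _.
  by rewrite /F !patchE; case: ifP.
have mF s q : measurable_fun setT (F s q).
  apply/(measurable_restrictT _ _).1; first exact: measurable_itv.
  apply: measurable_funTS; apply: continuous_measurable_fun.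
  exact: light_integrand_continuous.
have FM s q y : good s q -> `|F s q y| <= M.
  move=> gsq; have [s0 q0 sq] := gsq; rewrite /F patchE.
  case: ifPn => [|_]; last by rewrite normr0 mulr_ge0// ltW.
  rewrite inE => Iy; have := IQ s q gsq y Iy; rewrite /= in_itv/= => yr.
  have /andP[y0 yrho] := yr.
  move: Iy; rewrite /I/= in_itv/= => /andP[y1 y2].
  have n1 : s - q <= `|s - q| by exact: ler_norm.
  have hq : - rho <= q <= rho by apply/andP; split; lra.
  have hy : - rho <= y <= rho by apply/andP; split; lra.
  have hs : - rho <= (y - s + q) / 2 <= rho by apply/andP; split; lra.
  have /andP[e0 eK] := HK s q y hq hy hs.
  rewrite normrM (ger0_norm e0) /M; apply: ler_pM => //.
  by apply: hc; rewrite in_itv.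
rewrite (E t r gtr).
rewrite (_ : (fun n => \int[mu]_(y in `[`|a n - b n|, a n + b n])
    (E_minus w (a n) (b n) y * cd y)) =
  (fun n => fine (\int[mu]_(y in `[0%R, rho]) (F (a n) (b n) y)%:E)%E)); last first.
  by apply/funext => n; rewrite (E _ _ (gab n)).
apply: fine_cvg.
have [] := @dominated_convergence _ _ R mu `[0, rho]%classic (measurable_itv _)
   (fun n y => (F (a n) (b n) y)%:E) (fun y => (F t r y)%:E) (cst M%:E).
- by move=> n; apply/measurable_EFinP; apply: measurable_funTS; exact: mF.
- by apply/measurable_EFinP; apply: measurable_funTS; exact: mF.
- have N : mu.-negligible ([set `|t - r|] `|` [set t + r]).
    by apply: negligibleU; apply/negligibleP => //; exact: lebesgue_measure_set1.
  apply: negligibleS N => y /= ny; apply: contrapT => nb; apply: ny => _.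
  have [h1 h2] : y != `|t - r| /\ y != t + r.
    by split; apply/eqP => h; apply: nb; [left|right].
  apply/fine_cvgP; split; first by near=> n.
  have cs : a n + b n @[n --> \oo] --> t + r by exact: cvgD.
  have ca : `|a n - b n| @[n --> \oo] --> `|t - r| by apply: cvg_norm; exact: cvgB.
  have hn : \forall n \near \oo, (y \in I (a n) (b n)) = (y \in I t r).
    have k1 := cvg_compare_near ca h1; have k2 := cvg_compare_near cs h2.
    near=> n.
    have [e1 _] : ((`|a n - b n| < y) = (`|t - r| < y)) /\ ((y < `|a n - b n|) =
        (y < `|t - r|)) by near: n.
    have [e2 _] : ((a n + b n < y) = (t + r < y)) /\ ((y < a n + b n) =
        (y < t + r)) by near: n.
    have e3 : (y < `|a n - b n|) = (y < `|t - r|) by near: n; apply: filterS k1 => ? [].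
    by rewrite /I !mem_setE !in_itv/= !(leNgt _ y) !(leNgt y) e2 e3.
  rewrite /F patchE.
  have cK : E_minus w (a n) (b n) y * cd y @[n --> \oo] --> E_minus w t r y * cd y.
    by apply: cvgM; [apply: cvg_E_minus => //; exact: cvg_cst|exact: cvg_cst].
  apply: (@cvg_trans _ ((if y \in I t r then E_minus w (a n) (b n) y * cd y else 0)
      @[n --> \oo])).
    apply: near_eq_cvg; near=> n.
    by rewrite /= patchE; congr (if _ then _ else _); apply/esym; near: n.
  case: (y \in I t r); first exact: cK.
  exact: cvg_cst.
- apply: measurable_bounded_integrable => //; last exact: bounded_cst.
  by rewrite /= lebesgue_measure_itv/=; case: ifP => // _; rewrite -EFinB ltry.
- by apply/aeW => y n _; rewrite abse_EFin lee_fin; exact: FM.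
- move=> fint _ ff; rewrite fineK; first exact: ff.
  by apply: integrable_fin_num fint.
Unshelve. all: by end_near. Qed.

End FreeSolutionBound.

(** * Weighted nonlinear estimates *)

Section Nonlinear.
Context {R : realType}.
Notation mu := (@lebesgue_measure R).
Notation mu2 := (mu \x mu)%E.
Variables (m p : R) (w : R -> R).
Hypothesis m0 : 0 <= m.
Hypothesis p1 : 1 < p.
Hypothesis hwC0 : C0_half w.
Hypothesis hw : asymptotic_damping m w.

(* [radial_exp] is the power of [1 + y] left by [E_minus], [|u|^p] and
   [y^(1 - p)] once a factor [y / (1 + t + r)] is split off from [u]. *)
Definition radial_exp : R := 1 - (p - 1) * (m / 2).
(** Chosen so that [- p + radial_exp = - 1 - source_rate], the power of [1 + al] that reaches the
    outer integral when [a = s]. *)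
Definition source_rate : R := p - 1 - radial_exp.

Definition weight a s (z : R * R) : R :=
  (1 + z.2) `^ (- (m / 2)) * coneweight a s z.1 z.2.

(** The argument is in sheared variables: [z.2 - z.1] is the radius and [2 * z.1 - z.2] the distance
    to the cone. The absolute values keep all brackets positive on the whole plane. *)
Definition cone_integrand a s (z : R * R) : R :=
  (1 + `|z.2|) `^ (p * (- 1 - a + s)) *
  ((1 + `|z.2 - z.1|) `^ radial_exp * (1 + `|2 * z.1 - z.2|) `^ (- (p * s))).

Lemma coneweight_ge0 a s t r : 0 <= r -> 0 <= @coneweight R a s t r.
Proof.
by move=> r0; rewrite /coneweight; apply: mulr_ge0; [apply: mulr_ge0|];
    rewrite ?powR_ge0.
Qed.

Lemma weight_ge0 a s z : 0 <= z.2 -> 0 <= weight a s z.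
Proof. by move=> z0; apply: mulr_ge0; [exact: powR_ge0|exact: coneweight_ge0]. Qed.

Lemma measurable_weight a s : measurable_fun setT (weight a s).
Proof.
have m1 := @measurable_fst _ _ R R; have m2 := @measurable_snd _ _ R R.
have mP (g : R * R -> R) (c : R) : measurable_fun setT g ->
    measurable_fun setT (fun z => (1 + g z) `^ c).
  move=> mg; apply: (measurableT_comp (measurable_powR c)).
  by apply: measurable_funD.
apply: measurable_funM; first exact: mP.
apply: measurable_funM; last first.
  by apply: mP; apply: measurableT_comp => //; exact: measurable_funB.
apply: measurable_funM; first exact: m2.
by apply: mP; exact: measurable_funD.
Qed.

Lemma measurable_cone_integrand a s : measurable_fun setT (cone_integrand a s).
Proof.
have m1 := @measurable_fst _ _ R R; have m2 := @measurable_snd _ _ R R.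
apply: measurable_funM; first exact: measurable_bracket.
apply: measurable_funM; apply: measurable_bracket; first exact: measurable_funB.
by apply: measurable_funB => //; exact: measurable_funM.
Qed.

Lemma cone_integrand_ge0 a s z : 0 <= cone_integrand a s z.
Proof. by apply: mulr_ge0; [|apply: mulr_ge0]; exact: powR_ge0. Qed.

(** The factor [y^p] of the source loses [y^(p-1)], and the remaining [y] is at most [1 + y]. With
    the power [m / 2] of the kernel and [- p m / 2] of the source this makes up [radial_exp]. *)
Lemma duhamel_weight_pointwise : exists2 K : R, 0 < K & forall a s t r z,
  0 <= t -> 0 < r -> Delta_minus t r z ->
  duhamel_integrand w p (weight a s) t r z <=
  K * (1 + r) `^ (- (m / 2)) * cone_integrand a s (z.1, z.1 + z.2).
Proof.
have [K K0 HE] := E_minus_bracket m0 hwC0 hw.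
exists K => // a s t r [sg y] t0 r0 [/= z1 z2 /andP[z3 z4] z5].
have m_ge0 := m0; have p_gt1 := p1.
have n1 : t - r <= `|t - r| by exact: ler_norm.
have hE : E_minus w (t - sg) r y <= K * ((1 + r) `^ (- (m / 2)) * (1 + y) `^ (m / 2)).
  by apply: HE; [exact: ltW|exact: ltW|apply/andP; split; lra].
have y1 : 0 < 1 + y by lra.
have al0 : 0 < sg + y by exact: addr_gt0.
rewrite /duhamel_integrand /cone_integrand /=.
have -> : sg + y - sg = y by ring.
have -> : 2 * sg - (sg + y) = sg - y by ring.
rewrite (ger0_norm (weight_ge0 a s (z := (sg, y)) (ltW z2))).
rewrite (ger0_norm (ltW al0)) (ger0_norm (ltW z2)).
rewrite /weight /coneweight /=.
set Y := 1 + y in y1 *; set A := 1 + (sg + y); set B := 1 + `|sg - y|.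
have A0 : 0 < A by rewrite /A; lra.
have B0 : 0 < B by rewrite /B ltr_wpDr.
have -> : (Y `^ (- (m / 2)) * (y * A `^ (- 1 - a + s) * B `^ (- s))) `^ p =
   Y `^ (- (m / 2) * p) * (y `^ p * A `^ (p * (- 1 - a + s)) * B `^ (- (p * s))).
  have h1 := powR_ge0 Y (- (m / 2)); have h2 := powR_ge0 A (- 1 - a + s).
  have h3 := powR_ge0 B (- s); have h4 := mulr_ge0 (ltW z2) h2.
  rewrite (powRM p h1 (mulr_ge0 h4 h3)) (powRM p h4 h3) (powRM p (ltW z2) h2).
  by rewrite -!powRrM (mulrC p (- 1 - a + s)) (mulrC p s) (mulNr s p).
have yp : y `^ p = y * y `^ (p - 1).
  by rewrite mulr_powRB1; [|exact: ltW|lra].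
have yp0 : y `^ (p - 1) != 0 by rewrite gt_eqF// powR_gt0.
rewrite yp; set X := A `^ _; set Z := B `^ _.
have -> : Y `^ (- (m / 2) * p) * (y * y `^ (p - 1) * X * Z) / y `^ (p - 1) =
    y * Y `^ (- (m / 2) * p) * (X * Z) by field.
apply: (@le_trans _ _ (K * ((1 + r) `^ (- (m / 2)) * Y `^ (m / 2)) * (y * Y `^ (-
    (m / 2) * p) * (X * Z)))).
  apply: ler_wpM2r => //.
  by rewrite !mulr_ge0 ?powR_ge0// ltW.
rewrite (_ : K * _ * _ = K * (1 + r) `^ (- (m / 2)) * (X * (y * (Y `^ (m / 2) * Y
    `^ (- (m / 2) * p)) * Z))); last by ring.
rewrite -powRD_gt0//.
apply: ler_wpM2l; first by rewrite mulr_ge0 ?powR_ge0// ltW.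
apply: ler_wpM2l; first exact: powR_ge0.
apply: ler_wpM2r; first exact: powR_ge0.
have -> : radial_exp = 1 + (m / 2 + - (m / 2) * p) by rewrite /radial_exp; ring.
rewrite -mul_powR_succ//; apply: ler_wpM2r; first exact: powR_ge0.
by rewrite /Y; lra.
Qed.

Lemma duhamel_weight_le : exists2 K : R, 0 < K & forall a s t r (h : R -> R),
  0 <= t -> 0 < r -> measurable_fun setT h ->
  (forall al, `|t - r| <= al <= t + r ->
   (\int[mu]_(sg in `[0%R, Num.min al t])
     ((1 + `|al - sg|) `^ radial_exp * (1 + `|2 * sg - al|) `^ (- (p * s)))%:E <=
     (h al)%:E)%E) ->
  (\int[mu2]_(z in Delta_minus t r) (duhamel_integrand w p (weight a s) t r z)%:E <=
   (K * (1 + r) `^ (- (m / 2)))%:E *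
   \int[mu]_(al in `[(`|t - r|)%R, (t + r)%R])
     ((1 + `|al|) `^ (p * (- 1 - a + s)) * h al)%:E)%E.
Proof.
have [K K0 HK] := duhamel_weight_pointwise; exists K => // a s t r h t0 r0 mh Hh.
have m1 := @measurable_fst _ _ R R; have m2 := @measurable_snd _ _ R R.
have msh : measurable_fun setT (fun z : R * R => (z.1, z.1 + z.2)).
  by apply/measurable_fun_pair => //; exact: measurable_funD.
apply: (@le_trans _ _ ((K * (1 + r) `^ (- (m / 2)))%:E *
   \int[mu2]_(z in Delta_minus t r) (cone_integrand a s (z.1, (z.1 + z.2)%R))%:E)%E).
  apply: ge0_le_integralZ.
  - exact: measurable_Delta_minus.
  - apply: measurable_duhamel_integrand; first exact: primW_continuous.
    by apply: measurable_funTS; exact: measurable_weight.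
  - apply: measurable_funTS.
    exact: (measurableT_comp (measurable_cone_integrand a s) msh).
  - by rewrite mulr_ge0 ?powR_ge0// ltW.
  - by move=> z _; exact: cone_integrand_ge0.
  - by move=> z zD; rewrite duhamel_integrand_ge0/=; exact: HK.
apply: lee_wpmul2l; first by rewrite lee_fin mulr_ge0 ?powR_ge0// ltW.
apply: (@integral_Delta_minus_le _ (cone_integrand a s) _ t r t0 r0
          (measurable_cone_integrand a s) (cone_integrand_ge0 a s)).
  by apply: measurable_funM => //; exact: measurable_bracket.
move=> al hal; rewrite /cone_integrand/= EFinM.
have P0 : 0 <= (1 + `|al|) `^ (p * (- 1 - a + s)) by exact: powR_ge0.
have P0' := P0; rewrite -lee_fin in P0'.
apply: (le_trans _ (lee_wpmul2l P0' (Hh al hal))).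
apply: ge0_le_integralZ => //.
- apply: measurable_funM; first exact: measurable_cst.
  apply: measurable_funM; apply: measurable_bracket; first exact: measurable_funB.
  by apply: measurable_funB => //; exact: measurable_funM.
- apply: measurable_funM; apply: measurable_bracket; first exact: measurable_funB.
  by apply: measurable_funB => //; exact: measurable_funM.
- by move=> sg _; rewrite lexx andbT !mulr_ge0 ?powR_ge0.
Qed.

End Nonlinear.

(** * Decay of the nonlinear term *)

Section NonlinearEstimates.
Context {R : realType}.
Notation mu := (@lebesgue_measure R).
Notation mu2 := (mu \x mu)%E.
Variables (m p : R) (w : R -> R).
Hypothesis m0 : 0 <= m.
Hypothesis p1 : 1 < p.
Hypothesis hwC0 : C0_half w.
Hypothesis hw : asymptotic_damping m w.
Hypothesis e1 : - 1 < radial_exp m p.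
Notation q := (source_rate m p).
Notation e := (radial_exp m p).

(** The difference [A - B] is twice the smaller of [t] and [r]. If that is [r], the bracket [1 + A]
    is paid by [T]; if it is [t], then [t <= r] and [t r <= r T] suffice. *)
Lemma light_cone_length (t r T : R) : 0 <= t -> t <= T -> 0 < r -> 1 <= T ->
  (t + r - `|t - r|) * (1 + (t + r)) <= 6 * (r * T).
Proof.
move=> t0 tT r0 T1.
have rT : r <= r * T by rewrite ler_peMr// ltW.
have tr : t * r <= r * T by rewrite mulrC ler_pM2l.
have [rt|rt] := leP r t.
  have -> : `|t - r| = t - r by rewrite ger0_norm// subr_ge0.
  have rr : r * r <= r * t by rewrite ler_pM2l.
  nra.
have -> : `|t - r| = r - t by rewrite distrC ger0_norm// subr_ge0 ltW.
have tt : t * t <= t * r by apply: ler_wpM2l => //; exact: ltW.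
nra.
Qed.

(** Used with [x = 1 + al] and [y] the smaller of [al] and [t]. For [x <= T] the bound [y <= x]
    leaves [x^(2 - e0)], at most [T^(2 - e0)]; for [x > T] the bound [y <= T] and
    [x^(-e0) <= T^(-e0)] give the second term, with less decay but a factor [1 / T]. *)
Lemma time_gain (a x y e0 T : R) : 1 <= x -> 1 <= T -> 0 <= e0 <= 2 ->
  0 <= y -> y <= x -> y <= T ->
  x `^ (- e0 - a) * y <= T `^ (2 - e0) * (x `^ (- 1 - a) + T^-1 * x `^ (- a)).
Proof.
move=> x1 T1 /andP[e0_ge0 e02] y0 yx yT.
have x0 : 0 < x by lra.
have T0 : 0 < T by lra.
have [xT|xT] := leP x T.
  apply: (@le_trans _ _ (T `^ (2 - e0) * x `^ (- 1 - a))); last first.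
    apply: ler_wpM2l; first exact: powR_ge0.
    by rewrite lerDl mulr_ge0 ?powR_ge0// invr_ge0 ltW.
  apply: (@le_trans _ _ (x `^ (2 - e0) * x `^ (- 1 - a))); last first.
    by apply: ler_wpM2r; [exact: powR_ge0|apply: powR_monotone; lra].
  rewrite -powRD_gt0// (_ : 2 - e0 + (- 1 - a) = 1 + (- e0 - a)); last by ring.
  rewrite -mul_powR_succ// mulrC.
  by apply: ler_wpM2r => //; exact: powR_ge0.
apply: (@le_trans _ _ (T `^ (2 - e0) * (T^-1 * x `^ (- a)))); last first.
  by apply: ler_wpM2l; [exact: powR_ge0|rewrite lerDr powR_ge0].
rewrite mulrA -(powR_inv1 (ltW T0)) -powRD_gt0//.
rewrite (_ : 2 - e0 + -1 = 1 + - e0); last by ring.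
rewrite -mul_powR_succ// powRD_gt0// mulrAC.
apply: ler_wpM2r; first exact: powR_ge0.
rewrite mulrC; apply: ler_pM => //; first exact: powR_ge0.
by apply: powR_antitone; lra.
Qed.

(** The sigma-integral gains the smaller of [al] and [t], and the collected power of [1 + al] is
    [- e0 - a] with [e0 = 1 + q + (p - 1) a]. Trading this gain for [T^(2 - e0)] returns the same
    rate [a]; the constants [2 K3] and [6] come from the two terms of [time_gain]. *)
Lemma nonlinear_lt1 (a s : R) : admissible a s -> p * s < 1 ->
  0 <= 1 + q + (p - 1) * a <= 2 -> exists2 C : R, 0 < C &
  forall T t r : R, 1 <= T -> 0 <= t -> t <= T -> 0 < r ->
  (\int[mu2]_(z in Delta_minus t r) (duhamel_integrand w p (weight m a s) t r z)%:E <=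
   (C * (T `^ (1 - q - (p - 1) * a) * weight m a s (t, r)))%:E)%E.
Proof.
move=> adm ps1 he0; have p_gt1 := p1; have m_ge0 := m0; have e_gt := e1.
have [s0 sa hs] := adm.
have as_ : a <= s by case: hs => [/ltW|[->]].
have th01 : 0 <= p * s < 1 by rewrite ps1 andbT mulr_ge0//; lra.
have [th0 _] := andP th01.
have [K K0 HK] := duhamel_weight_le m0 p1 hwC0 hw.
have [C1 C10 H1] := coneJ_lt1 th01.
have [C2 C20 H2] := integral_cone_le e_gt th0.
have [K3 K30 H3] := integral_bracket_admissible adm.
pose D : R := C2 * (C1 + 1).
have D0 : 0 < D by rewrite mulr_gt0// addr_gt0.
exists (K * D * (2 * K3 + 6)); first by rewrite !mulr_gt0// addr_gt0 ?mulr_gt0.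
move=> T t r T1 t0 tT r0.
pose A : R := t + r; pose B : R := `|t - r|.
have B0 : 0 <= B by exact: normr_ge0.
have BA : B <= A by exact: dist_le_add (ltW r0).
pose h (al : R) : R := D * (Num.min al t * (1 + `|al|) `^ (e - p * s)).
have mh : measurable_fun setT h.
  apply: measurable_funM; first exact: measurable_cst.
  apply: measurable_funM; last exact: measurable_bracket.
  by apply: measurable_minr.
have inner (al : R) : B <= al <= A ->
   (\int[mu]_(sg in `[0%R, Num.min al t])
     ((1 + `|al - sg|) `^ e * (1 + `|2 * sg - al|) `^ (- (p * s)))%:E <=
     (h al)%:E)%E.
  move=> /andP[Bal alA]; have al0 : 0 <= al by exact: le_trans Bal.
  have mn0 : 0 <= Num.min al t by rewrite le_min al0 t0.
  have mnal : Num.min al t <= al by rewrite ge_min lexx.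
  apply: le_trans (H2 al _ _ mn0 mnal (H1 al _ mn0 mnal)) _.
  rewrite lee_fin /h /D (ger0_norm al0) (powRD_gt0 e (- (p * s)) (_ : 0 < 1 + al));
      last exact: bracket_gt0.
  by rewrite le_eqVlt; apply/orP; left; apply/eqP; ring.
apply: le_trans (HK a s t r h t0 r0 mh inner) _.
have KP0 : 0 <= K * (1 + r) `^ (- (m / 2)) by rewrite mulr_ge0 ?powR_ge0// ltW.
have KP0' := KP0; rewrite -lee_fin in KP0'.
pose Q : R := (1 + A) `^ (- 1 - a + s) * (1 + B) `^ (- s).
have Q0 : 0 <= Q by apply: mulr_ge0; exact: powR_ge0.
pose G : R := T `^ (1 - q - (p - 1) * a).
have G0 : 0 <= G by exact: powR_ge0.
have T0 : 0 < T by exact: lt_le_trans T1.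
suff main : (\int[mu]_(al in `[B, A]) ((1 + `|al|) `^ (p * (- 1 - a + s)) * h al)%:E <=
    (D * G * (2 * K3 + 6) * (r * Q))%:E)%E.
  apply: le_trans (lee_wpmul2l KP0' main) _.
  rewrite -EFinM lee_fin /weight /coneweight/= -/A -/B -/G.
  rewrite le_eqVlt; apply/orP; left; apply/eqP; rewrite /Q; ring.
have mI : measurable (`[B, A] : set R) by exact: measurable_itv.
apply: (@le_trans _ _ ((D * G)%:E * \int[mu]_(al in `[B, A])
    ((1 + al) `^ (- 1 - a) + T^-1 * (1 + al) `^ (- a))%:E)%E).
  apply: ge0_le_integralZ => //.
  - apply: measurable_funM; first exact: measurable_bracket.
    exact: measurable_funTS.
  - apply: measurable_funD; first exact: measurable_bracketD.
    by apply: measurable_funM => //; exact: measurable_bracketD.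
  - by rewrite mulr_ge0// ltW.
  - move=> al _; apply: addr_ge0; first exact: powR_ge0.
    by rewrite mulr_ge0 ?powR_ge0// invr_ge0 ltW.
  - move=> al; rewrite /= in_itv/= => /andP[Bal alA].
    have al0 : 0 <= al by exact: le_trans Bal.
    have mn0 : 0 <= Num.min al t by rewrite le_min al0 t0.
    have h0 : 0 <= h al by apply: mulr_ge0; [exact: ltW|rewrite mulr_ge0 ?powR_ge0].
    rewrite mulr_ge0 ?powR_ge0//= /h (ger0_norm al0).
    rewrite (_ : _ * _ = D * ((1 + al) `^ (p * (- 1 - a + s)) * (1 + al) `^ (e - p
        * s) * Num.min al t)); last by ring.
    rewrite -[leRHS]mulrA ler_pM2l// -(powRD_gt0 _ _ (bracket_gt0 al0)).
    rewrite (_ : p * (- 1 - a + s) + (e - p * s) = - (1 + q + (p - 1) * a) - a);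
        last first.
      by rewrite /source_rate; ring.
    rewrite /G (_ : 1 - q - (p - 1) * a = 2 - (1 + q + (p - 1) * a)); last by ring.
    apply: time_gain => //; first by rewrite lerDl.
      by apply: (@le_trans _ _ al); [rewrite ge_min lexx|rewrite lerDr].
    by apply: le_trans tT; rewrite ge_min lexx orbT.
have DG0 : 0 <= D * G by rewrite mulr_ge0// ltW.
have DG0' := DG0; rewrite -lee_fin in DG0'.
suff main : (\int[mu]_(al in `[B, A])
    ((1 + al) `^ (- 1 - a) + T^-1 * (1 + al) `^ (- a))%:E <=
        ((2 * K3 + 6) * (r * Q))%:E)%E.
  apply: le_trans (lee_wpmul2l DG0' main) _.
  by rewrite -EFinM lee_fin le_eqVlt; apply/orP; left; apply/eqP; ring.
under eq_integral do rewrite EFinD.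
rewrite ge0_integralD//; last 4 first.
- by move=> al _; rewrite lee_fin powR_ge0.
- by apply/measurable_EFinP; exact: measurable_bracketD.
- by move=> al _; rewrite lee_fin mulr_ge0 ?powR_ge0// invr_ge0 ltW.
- by apply/measurable_EFinP; apply: measurable_funM => //; exact: measurable_bracketD.
have AB2 : A - B <= 2 * r by exact: add_sub_dist_le.
have k1 : (\int[mu]_(al in `[B, A]) ((1 + al) `^ (- 1 - a))%:E <=
    (2 * K3 * (r * Q))%:E)%E.
  apply: le_trans (H3 A B B0 BA) _; rewrite lee_fin -[X in K3 * X]mulrA -/Q.
  rewrite (_ : 2 * K3 * (r * Q) = K3 * (2 * r * Q)); last by ring.
  by rewrite ler_pM2l//; exact: ler_wpM2r.
have k2 : (\int[mu]_(al in `[B, A]) (T^-1 * (1 + al) `^ (- a))%:E <=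
    (6 * (r * Q))%:E)%E.
  (* [(1 + al)^(-a)] is split into the powers [- s] and [s - a], estimated at [B] and at [A]. The
     remaining [(A - B) (1 + A) / T] is at most [6 r]. *)
  apply: (@le_trans _ _ ((T^-1 * ((1 + B) `^ (- s) * (1 + A) `^ (s - a)))%:E *
      \int[mu]_(al in `[B, A]) 1%:E)%E).
    apply: ge0_le_integralZ => //.
    - by apply: measurable_funM => //; exact: measurable_bracketD.
    - by apply: mulr_ge0; [rewrite invr_ge0 ltW|apply: mulr_ge0; exact: powR_ge0].
    - move=> al; rewrite /= in_itv/= => /andP[Bal alA].
      rewrite mulr_ge0 ?powR_ge0 ?invr_ge0 ?(ltW T0)//= mulr1 ler_pM2l ?invr_gt0//.
      have -> : (1 + al) `^ (- a) = (1 + al) `^ (- s) * (1 + al) `^ (s - a).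
        by rewrite -(powRD_gt0 _ _ (bracket_gt0 (le_trans B0 Bal)));
            congr (_ `^ _); ring.
      apply: ler_pM; rewrite ?powR_ge0//.
        by apply: powR_antitone; rewrite ?bracket_gt0 ?lerD2l ?oppr_le0.
      apply: powR_monotone; rewrite ?lerD2l ?subr_ge0//.
      exact: ltW (bracket_gt0 (le_trans B0 Bal)).
  rewrite integral_cst//= lebesgue_measure_itv/= lte_fin mul1e.
  have -> : (if B < A then (A%:E - B%:E)%E else 0%E) = (A - B)%:E.
    case: ifPn => //; rewrite -leNgt => AB.
    by rewrite (_ : A = B) ?subrr//; apply/eqP; rewrite eq_le AB BA.
  rewrite -EFinM lee_fin.
  have L := light_cone_length t0 tT r0 T1; rewrite -/A -/B in L.
  have A1 : 0 < 1 + A by apply: bracket_gt0; exact: le_trans BA.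
  have -> : (1 + A) `^ (s - a) = (1 + A) * (1 + A) `^ (- 1 - a + s).
    by rewrite mul_powR_succ//; congr (_ `^ _); ring.
  rewrite [leLHS](_ : _ = T^-1 * ((A - B) * (1 + A)) * Q); last by rewrite /Q; ring.
  rewrite mulrA; apply: ler_wpM2r => //.
  by rewrite mulrC ler_pdivrMr// -mulrA.
by apply: le_trans (leeD k1 k2) _; rewrite -EFinD lee_fin le_eqVlt; apply/orP;
    left; apply/eqP; ring.
Qed.

(** With both exponents equal to [a] the bracket in [t + r] has exponent [-1], so the power of
    [1 + al] is [- 1 - q] whatever [a] is. As [p a >= 1], the part near the axis costs no more than
    a constant, the [1] in [1 + J]. Leaving [J] open covers a bounded and a logarithmic cone
    integral, and the restriction [k <= t] permits a bound by [log T]. *)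
Lemma nonlinear_ge1 (a s : R) : admissible q s -> 1 <= p * a ->
  exists2 C : R, 0 < C & forall J t r : R, 0 <= J -> 0 <= t -> 0 < r ->
  (forall al k : R, 0 <= k -> k <= al -> k <= t ->
    (\int[mu]_(y in `[0%R, k]) ((1 + `|2 * y - al|) `^ (- (p * a)))%:E <= J%:E)%E) ->
  (\int[mu2]_(z in Delta_minus t r) (duhamel_integrand w p (weight m a a) t r z)%:E <=
   (C * ((1 + J) * weight m q s (t, r)))%:E)%E.
Proof.
move=> adm pa1; have p_gt1 := p1; have m_ge0 := m0; have e_gt := e1.
have th0 : 0 <= p * a by lra.
have [K K0 HK] := duhamel_weight_le m0 p1 hwC0 hw.
have [C2 C20 H2] := integral_cone_le e_gt th0.
have [K3 K30 H3] := integral_bracket_admissible adm.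
exists (K * C2 * (2 * K3)); first by rewrite !mulr_gt0.
move=> J t r J0 t0 r0 HJ.
pose A : R := t + r; pose B : R := `|t - r|.
have B0 : 0 <= B by exact: normr_ge0.
have BA : B <= A by exact: dist_le_add (ltW r0).
pose h (al : R) : R := C2 * ((1 + J) * (1 + `|al|) `^ e).
have mh : measurable_fun setT h.
  by do 2 (apply: measurable_funM; first exact: measurable_cst);
      exact: measurable_bracket.
have inner (al : R) : B <= al <= A ->
   (\int[mu]_(sg in `[0%R, Num.min al t])
     ((1 + `|al - sg|) `^ e * (1 + `|2 * sg - al|) `^ (- (p * a)))%:E <=
     (h al)%:E)%E.
  move=> /andP[Bal alA]; have al0 : 0 <= al by exact: le_trans Bal.
  have mn0 : 0 <= Num.min al t by rewrite le_min al0 t0.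
  have mnal : Num.min al t <= al by rewrite ge_min lexx.
  have mnt : Num.min al t <= t by rewrite ge_min lexx orbT.
  apply: le_trans (H2 al _ _ mn0 mnal (HJ al _ mn0 mnal mnt)) _.
  rewrite lee_fin /h (ger0_norm al0) ler_pM2l// mulrDl mul1r addrC mulrC.
  apply: lerD; last by rewrite mulrC.
  apply: (@le_trans _ _ ((1 + al) * (1 + al) `^ (e - p * a))).
    by rewrite mulrC; apply: ler_wpM2r; [exact: powR_ge0|apply: le_trans mnal _;
        rewrite lerDr].
  rewrite mul_powR_succ ?bracket_gt0//.
  by apply: ler_powR; [rewrite lerDl|lra].
apply: le_trans (HK a a t r h t0 r0 mh inner) _.
have KP0 : 0 <= K * (1 + r) `^ (- (m / 2)) by rewrite mulr_ge0 ?powR_ge0// ltW.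
have KP0' := KP0; rewrite -lee_fin in KP0'.
pose Q : R := (1 + A) `^ (- 1 - q + s) * (1 + B) `^ (- s).
have Q0 : 0 <= Q by apply: mulr_ge0; exact: powR_ge0.
have CJ : 0 <= C2 * (1 + J) by rewrite mulr_ge0 ?addr_ge0// ltW.
suff main : (\int[mu]_(al in `[B, A]) ((1 + `|al|) `^ (p * (- 1 - a + a)) * h al)%:E <=
    (C2 * (1 + J) * (2 * K3 * (r * Q)))%:E)%E.
  apply: le_trans (lee_wpmul2l KP0' main) _.
  rewrite -EFinM lee_fin /weight /coneweight/= -/A -/B.
  rewrite le_eqVlt; apply/orP; left; apply/eqP; rewrite /Q; ring.
have CJ' := CJ; rewrite -lee_fin in CJ'.
have AB2 : A - B <= 2 * r by exact: add_sub_dist_le.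
have k1 : (\int[mu]_(al in `[B, A]) ((1 + al) `^ (- 1 - q))%:E <=
    (2 * K3 * (r * Q))%:E)%E.
  apply: le_trans (H3 A B B0 BA) _; rewrite lee_fin -[X in K3 * X]mulrA -/Q.
  rewrite (_ : 2 * K3 * (r * Q) = K3 * (2 * r * Q)); last by ring.
  by rewrite ler_pM2l//; exact: ler_wpM2r.
rewrite EFinM; apply: (le_trans _ (lee_wpmul2l CJ' k1)).
apply: ge0_le_integralZ => //.
- apply: measurable_funM; first exact: measurable_bracket.
  exact: measurable_funTS.
- exact: measurable_bracketD.
- by move=> al _; exact: powR_ge0.
- move=> al; rewrite /= in_itv/= => /andP[Bal alA].
  have al0 : 0 <= al by exact: le_trans Bal.
  have h0 : 0 <= h al.
    by rewrite /h mulrA; apply: mulr_ge0 => //; exact: powR_ge0.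
  rewrite mulr_ge0 ?powR_ge0//= /h (ger0_norm al0).
  rewrite (_ : _ * _ = C2 * (1 + J) * ((1 + al) `^ (p * (- 1 - a + a)) * (1 + al)
      `^ e)); last by ring.
  rewrite -(powRD_gt0 _ _ (bracket_gt0 al0)).
  rewrite (_ : p * (- 1 - a + a) + e = - 1 - q) //.
  by rewrite /source_rate; ring.
Qed.

End NonlinearEstimates.

(** * Lifespan *)

Section Lifespan.
Context {R : realType}.
Notation mu := (@lebesgue_measure R).
Notation mu2 := (mu \x mu)%E.
Variables (m kappa p : R) (w f0 f1 : R -> R).
Hypothesis m0 : 0 <= m.
Hypothesis mkappa : m / 2 < kappa.
Hypothesis hwC0 : C0_half w.
Hypothesis hw : asymptotic_damping m w.
Hypothesis hf0C1 : C1_half f0.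
Hypothesis hf1C0 : C0_half f1.
Hypothesis hf0 : forall r : R, 0 <= r -> `|f0 r| <= japanese r `^ (- kappa).
Hypothesis hf1 : forall r : R, 0 <= r ->
     `|derive_half f0 r| + `|f1 r| <= japanese r `^ (- kappa - 1).
Hypothesis p1 : 1 < p.

Notation phi := (fun r : R => r * f0 r).
Notation psi := (fun r : R => r * f1 r).
Notation q := (source_rate m p).
Notation nu := (kappa - m / 2 - 1).

Let p0 : 0 < p. Proof. exact: lt_trans p1. Qed.
Let cW : continuous (primW w). Proof. exact: primW_continuous. Qed.

Lemma weight_le_radius a s z : admissible a s -> 0 <= z.1 -> 0 < z.2 ->
  weight m a s z <= z.2.
Proof.
move=> [s0 sa _] z1 z2; have m_ge0 := m0; have z20 := ltW z2.
rewrite /weight /coneweight mulrC -!mulrA.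
have k1 : (1 + z.2) `^ (- (m / 2)) <= 1 by apply: powR_le1; lra.
have k2 : (1 + (z.1 + z.2)) `^ (- 1 - a + s) <= 1 by apply: powR_le1; lra.
have k3 : (1 + `|z.1 - z.2|) `^ (- s) <= 1.
  by apply: powR_le1; rewrite ?oppr_le0// lerDl.
have := powR_ge0 (1 + z.2) (- (m / 2)).
have := powR_ge0 (1 + (z.1 + z.2)) (- 1 - a + s).
have := powR_ge0 (1 + `|z.1 - z.2|) (- s).
set x1 := _ `^ _ in k1 *; set x2 := _ `^ _ in k2 *; set x3 := _ `^ _ in k3 *.
move=> h3 h2 h1; rewrite ler_piMr//; apply: mulr_ile1 => //.
  exact: mulr_ge0.
exact: mulr_ile1.
Qed.

Lemma lifespan_ge_supersolution (T eps : R) (Phi : R * R -> R) :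
  0 < T -> 0 <= eps -> measurable_fun setT Phi ->
  (forall z, strip T z -> 0 <= Phi z) ->
  (exists2 C : R, 0 < C & forall z, strip T z -> Phi z <= C * z.2) ->
  (forall t r, strip T (t, r) -> eps * `|u_L w phi psi t r| <= Phi (t, r) / 2) ->
  (forall t r, strip T (t, r) ->
    (\int[mu2]_(z in Delta_minus t r) (duhamel_integrand w p Phi t r z)%:E <=
     (Phi (t, r) / p)%:E)%E) ->
  (T%:E <= lifespan w phi psi p eps)%E.
Proof.
move=> T0 eps0 mPhi Phi0 [C C0 HC] HuL Hduh.
have cuL : {within strip T, continuous (fun z => u_L w phi psi z.1 z.2)}.
  exact: u_L_continuous.
have [|u [cu eu]] := picard cW p1 mPhi Phi0 _ cuL HuL eps0 Hduh.
  by move=> rho; exists C => // z zs _; exact: HC.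
apply: ereal_sup_ubound; exists T => //; split => //; exists u; split => // t r ht r0.
exact: eu.
Qed.

Lemma duhamel_integrand_scale (c : R) (v : R * R -> R) t r z : 0 <= c ->
  duhamel_integrand w p (fun z => c * v z) t r z =
  c `^ p * duhamel_integrand w p v t r z.
Proof.
move=> c0; rewrite /duhamel_integrand normrM (ger0_norm c0) powRM//; ring.
Qed.

Lemma duhamel_integrand_add_le (v1 v2 : R * R -> R) t r z :
  0 <= v1 z -> 0 <= v2 z ->
  duhamel_integrand w p (fun z => v1 z + v2 z) t r z <=
  2 `^ p * (duhamel_integrand w p v1 t r z + duhamel_integrand w p v2 t r z).
Proof.
move=> h1 h2; rewrite /duhamel_integrand.
rewrite [leRHS](_ : _ = E_minus w (t - z.1) r z.2 *
  (2 `^ p * (`|v1 z| `^ p + `|v2 z| `^ p) / z.2 `^ (p - 1))); last by ring.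
apply: ler_wpM2l; first exact: E_minus_ge0.
apply: ler_wpM2r; first by rewrite invr_ge0 powR_ge0.
rewrite !ger0_norm ?addr_ge0//.
wlog h12 : v1 v2 h1 h2 / v1 z <= v2 z.
  move=> H; have [le|le] := leP (v1 z) (v2 z); first exact: H.
  by rewrite addrC (addrC (v1 z `^ p)); apply: H => //; exact: ltW.
apply: (@le_trans _ _ ((2 * v2 z) `^ p)).
  by apply: powR_monotone; [rewrite addr_ge0|lra|exact: ltW].
rewrite powRM//; apply: ler_wpM2l; first exact: powR_ge0.
by rewrite lerDr powR_ge0.
Qed.

Lemma measurable_duhamel_Delta (v : R * R -> R) t r : measurable_fun setT v ->
  measurable_fun (Delta_minus t r) (duhamel_integrand w p v t r).
Proof.
by move=> mv; apply: measurable_duhamel_integrand => //; exact: measurable_funTS.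
Qed.

Lemma integral_duhamel_scale (c : R) (v : R * R -> R) t r : 0 <= c ->
  measurable_fun setT v ->
  (\int[mu2]_(z in Delta_minus t r) (duhamel_integrand w p (fun z => (c * v z)%R) t
      r z)%:E <=
   (c `^ p)%:E * \int[mu2]_(z in Delta_minus t r) (duhamel_integrand w p v t r z)%:E)%E.
Proof.
move=> c0 mv; apply: ge0_le_integralZ.
- exact: measurable_Delta_minus.
- by apply: measurable_duhamel_Delta; apply: measurable_funM.
- exact: measurable_duhamel_Delta.
- exact: powR_ge0.
- by move=> z _; exact: duhamel_integrand_ge0.
- by move=> z _; rewrite duhamel_integrand_ge0/= duhamel_integrand_scale.
Qed.

Lemma integral_duhamel_add (v1 v2 : R * R -> R) t r :
  measurable_fun setT v1 -> measurable_fun setT v2 ->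
  (forall z, Delta_minus t r z -> 0 <= v1 z) ->
  (forall z, Delta_minus t r z -> 0 <= v2 z) ->
  (\int[mu2]_(z in Delta_minus t r) (duhamel_integrand w p (fun z => (v1 z + v2
      z)%R) t r z)%:E <=
   (2 `^ p)%:E * (\int[mu2]_(z in Delta_minus t r) (duhamel_integrand w p v1 t r z)%:E +
    \int[mu2]_(z in Delta_minus t r) (duhamel_integrand w p v2 t r z)%:E))%E.
Proof.
move=> mv1 mv2 h1 h2.
rewrite -ge0_integralD; last 5 first.
- exact: measurable_Delta_minus.
- by move=> z _; rewrite lee_fin duhamel_integrand_ge0.
- by apply/measurable_EFinP; exact: measurable_duhamel_Delta.
- by move=> z _; rewrite lee_fin duhamel_integrand_ge0.
- by apply/measurable_EFinP; exact: measurable_duhamel_Delta.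
under [in leRHS]eq_integral do rewrite -EFinD.
apply: ge0_le_integralZ.
- exact: measurable_Delta_minus.
- by apply: measurable_duhamel_Delta; exact: measurable_funD.
- by apply: measurable_funD; exact: measurable_duhamel_Delta.
- exact: powR_ge0.
- by move=> z _; rewrite addr_ge0 ?duhamel_integrand_ge0.
- move=> z zD; rewrite duhamel_integrand_ge0/=.
  by apply: duhamel_integrand_add_le; [exact: h1|exact: h2].
Qed.

Hypothesis e1 : - 1 < radial_exp m p.

(** Since [1 + q + (p - 1) nu = (p - 1) kappa], the source of the weight of rate [nu] is
    [T^(2 - (p - 1) kappa)] times that weight, so one amplitude proportional to [eps] closes the
    argument; the exponent of [T] is [gamma_F]. *)
Lemma lifespan_one_level : p * nu < 1 -> 0 <= (p - 1) * kappa <= 2 ->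
  exists2 K : R, 0 < K & forall eps T : R, 0 < eps -> 1 <= T ->
  K * (eps `^ (p - 1) * T `^ (2 - (p - 1) * kappa)) <= 1 ->
  (T%:E <= lifespan w phi psi p eps)%E.
Proof.
move=> pnu hk; have m_ge0 := m0; have mk := mkappa; have p_gt1 := p1.
(* [s] has to satisfy [nu < s < 1 / p] and [0 <= s <= 1 + nu]. *)
pose s : R := Num.max ((nu + p^-1) / 2) 0.
have pV0 : 0 < p^-1 by rewrite invr_gt0.
have pV1 : p^-1 < 1 by rewrite invf_lt1.
have nup : nu < p^-1 by rewrite -(ltr_pM2l p0) mulfV ?gt_eqF.
have ps1 : p * s < 1.
  rewrite -(ltr_pM2l pV0) mulKf ?gt_eqF// mulr1 /s gt_max pV0 andbT; lra.
have adm : admissible nu s.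
  split; first by rewrite /s le_max lexx orbT.
    by rewrite /s ge_max; apply/andP; split; lra.
  by left; rewrite /s lt_max; apply/orP; left; lra.
have [Cu Cu0 Hu] := u_L_le m0 mkappa hwC0 hw hf0C1 hf1C0 hf0 hf1 adm.
have ek : 1 + q + (p - 1) * nu = (p - 1) * kappa.
  by rewrite /source_rate /radial_exp; ring.
have hk' : 0 <= 1 + q + (p - 1) * nu <= 2 by rewrite ek.
have [Cn Cn0 Hn] := nonlinear_lt1 m0 p1 hwC0 hw e1 adm ps1 hk'.
(* Twice the constant of the free solution, so that [u_L] takes exactly half of the
   supersolution. *)
pose M : R := 2 * Cu.
have M0 : 0 < M by rewrite mulr_gt0.
exists (p * Cn * M `^ (p - 1)); first by rewrite !mulr_gt0// powR_gt0.
move=> eps T eps0 T1 small.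
have c0 : 0 < M * eps by rewrite mulr_gt0.
have T0 : 0 < T by lra.
apply: (@lifespan_ge_supersolution T eps (fun z => M * eps * weight m nu s z)) => //.
- exact: ltW.
- by apply: measurable_funM => //; exact: measurable_weight.
- move=> z [_ z2]; apply: mulr_ge0; first exact: ltW.
  by apply: weight_ge0; exact: ltW.
- exists (M * eps) => // z [/andP[z1 _] z2]; rewrite ler_pM2l//.
  exact: weight_le_radius.
- move=> t r [/= /andP[t0 tT] r0].
  rewrite (_ : M * eps * _ / 2 = eps * (Cu * weight m nu s (t, r))); last first.
    by rewrite /M; field.
  by rewrite ler_pM2l//; exact: Hu.
- move=> t r [/= /andP[t0 tT] r0].
  have mw := @measurable_weight R m nu s.
  apply: le_trans (integral_duhamel_scale t r (ltW c0) mw) _.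
  have k0 : (0 <= ((M * eps) `^ p)%:E)%E by rewrite lee_fin powR_ge0.
  apply: le_trans (lee_wpmul2l k0 (Hn T t r T1 t0 (ltW tT) r0)) _.
  rewrite -EFinM lee_fin.
  have W0 : 0 <= weight m nu s (t, r) by apply: weight_ge0; exact: ltW.
  rewrite (_ : 1 - q - (p - 1) * nu = 2 - (p - 1) * kappa); last by rewrite -ek; ring.
  rewrite -(mulr_powRB1 (ltW c0) p0) (powRM _ (ltW M0) (ltW eps0)).
  rewrite [leLHS](_ : _ = (p * Cn * M `^ (p - 1) *
     (eps `^ (p - 1) * T `^ (2 - (p - 1) * kappa))) * (M * eps * weight m nu s (t,
         r) / p)).
    apply: ler_piMl => //.
    by rewrite divr_ge0 ?(ltW p0)// mulr_ge0// ltW.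
  by field; rewrite gt_eqF.
Qed.

(** Both sources are absorbed by the slow part of the supersolution, each taking half of its share
    [N W / p]. The gains [D0] and [D1] stay abstract so that all four cases with [p nu >= 1] are
    served at once. *)
Lemma lifespan_two_level (s : R) : 1 <= p * nu -> admissible q s ->
  exists2 K : R, 0 < K & forall eps T D0 D1 : R, 0 < eps -> 0 < T ->
  0 < D0 -> 0 < D1 ->
  (forall t r, strip T (t, r) ->
    (\int[mu2]_(z in Delta_minus t r) (duhamel_integrand w p (weight m nu nu) t r
        z)%:E <=
     (D0 * weight m q s (t, r))%:E)%E) ->
  (forall t r, strip T (t, r) ->
    (\int[mu2]_(z in Delta_minus t r) (duhamel_integrand w p (weight m q s) t r z)%:E <=
     (D1 * weight m q s (t, r))%:E)%E) ->
  K * (eps `^ (p * (p - 1)) * D0 `^ (p - 1) * D1) <= 1 ->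
  (T%:E <= lifespan w phi psi p eps)%E.
Proof.
move=> pnu admq; have m_ge0 := m0; have mk := mkappa; have p_gt1 := p1.
have nu0 : 0 < nu by rewrite -(pmulr_rgt0 _ p0); lra.
have adm : admissible nu nu by split; [exact: ltW|lra|right].
have [Cu Cu0 Hu] := u_L_le m0 mkappa hwC0 hw hf0C1 hf1C0 hf0 hf1 adm.
pose M : R := 2 * Cu.
have M0 : 0 < M by rewrite mulr_gt0.
have P0 : 0 < 2 `^ p :> R by exact: powR_gt0.
(* Makes the source of the free part, [2^p (M eps)^p D0], equal to [N / (2 p)]; the factor [2^p]
   comes from the power of a sum. *)
pose L : R := 2 * p * 2 `^ p * M `^ p.
have Mp0 : 0 < M `^ p by exact: powR_gt0.
have L0 : 0 < L by rewrite !mulr_gt0.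
exists (2 * p * 2 `^ p * L `^ (p - 1)); first by rewrite !mulr_gt0 ?powR_gt0.
move=> eps T D0 D1 eps0 T0 D00 D10 H0 H1 small.
have c0 : 0 < M * eps by rewrite mulr_gt0.
have ep0 : 0 < eps `^ p by exact: powR_gt0.
pose N : R := L * eps `^ p * D0.
have N0 : 0 < N by rewrite !mulr_gt0.
have Np : 2 * p * 2 `^ p * N `^ (p - 1) * D1 <= 1.
  apply: le_trans small; rewrite le_eqVlt; apply/orP; left; apply/eqP.
  rewrite /N (powRM _ (mulr_ge0 (ltW L0) (ltW ep0)) (ltW D00)).
  by rewrite (powRM _ (ltW L0) (ltW ep0)) -powRrM; ring.
apply: (@lifespan_ge_supersolution T eps
  (fun z => M * eps * weight m nu nu z + N * weight m q s z)) => //.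
- exact: ltW.
- apply: measurable_funD; apply: measurable_funM => //; exact: measurable_weight.
- move=> z [_ z2]; apply: addr_ge0; apply: mulr_ge0; rewrite ?(ltW c0) ?(ltW N0)//;
    by apply: weight_ge0; exact: ltW.
- exists (M * eps + N); first exact: addr_gt0.
  move=> z [/andP[z1 _] z2]; rewrite mulrDl; apply: lerD; rewrite ler_pM2l//;
    exact: weight_le_radius.
- move=> t r [/= /andP[t0 tT] r0].
  apply: (@le_trans _ _ (M * eps * weight m nu nu (t, r) / 2)).
    rewrite (_ : M * eps * _ / 2 = eps * (Cu * weight m nu nu (t, r))); last first.
      by rewrite /M; field.
    by rewrite ler_pM2l//; exact: Hu.
  rewrite ler_pM2r// lerDl mulr_ge0 ?(ltW N0)//.
  by apply: weight_ge0; exact: ltW.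
- move=> t r tr; have [/= /andP[t0 tT] r0] := tr.
  have mw0 := @measurable_weight R m nu nu; have mw1 := @measurable_weight R m q s.
  pose v1 z := M * eps * weight m nu nu z; pose v2 z := N * weight m q s z.
  have mv1 : measurable_fun setT v1 by apply: measurable_funM.
  have mv2 : measurable_fun setT v2 by apply: measurable_funM.
  have v10 z : Delta_minus t r z -> 0 <= v1 z.
    by move=> [_ z2 _ _]; rewrite mulr_ge0 ?(ltW c0)// weight_ge0// ltW.
  have v20 z : Delta_minus t r z -> 0 <= v2 z.
    by move=> [_ z2 _ _]; rewrite mulr_ge0 ?(ltW N0)// weight_ge0// ltW.
  apply: le_trans (integral_duhamel_add mv1 mv2 v10 v20) _.
  have W0 : 0 <= weight m nu nu (t, r) by apply: weight_ge0; exact: ltW.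
  have W1 : 0 <= weight m q s (t, r) by apply: weight_ge0; exact: ltW.
  have k0 : (0 <= ((M * eps) `^ p)%:E)%E by rewrite lee_fin powR_ge0.
  have k1 : (0 <= (N `^ p)%:E)%E by rewrite lee_fin powR_ge0.
  have k2 : (0 <= (2 `^ p)%:E :> \bar R)%E by rewrite lee_fin powR_ge0.
  have g0 := le_trans (integral_duhamel_scale t r (ltW c0) mw0) (lee_wpmul2l k0 (H0
      t r tr)).
  have g1 := le_trans (integral_duhamel_scale t r (ltW N0) mw1) (lee_wpmul2l k1 (H1
      t r tr)).
  apply: le_trans (lee_wpmul2l k2 (leeD g0 g1)) _.
  rewrite -(EFinM ((M * eps) `^ p)) -(EFinM (N `^ p)) -EFinD -EFinM lee_fin.
  set W := weight m q s (t, r) in W1 *.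
  apply: (@le_trans _ _ (N * W / p)); last first.
    rewrite ler_pM2r ?invr_gt0// lerDr mulr_ge0//; exact: ltW.
  have h1 : 2 `^ p * ((M * eps) `^ p * (D0 * W)) = N * W / p / 2.
    rewrite (powRM _ (ltW M0) (ltW eps0)) /N /L; field.
    by rewrite gt_eqF.
  have h2 : 2 `^ p * (N `^ p * (D1 * W)) <= N * W / p / 2.
    rewrite -(mulr_powRB1 (ltW N0) p0).
    rewrite [leLHS](_ : _ = (2 * p * 2 `^ p * N `^ (p - 1) * D1) * (N * W / p / 2)).
      apply: ler_piMl => //.
      by rewrite !divr_ge0 ?(ltW p0)// mulr_ge0// ltW.
    by field; rewrite gt_eqF.
  by rewrite mulrDr h1; lra.
Qed.

End Lifespan.

(** * Critical exponent and choice of the existence time *)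

Section Scalars.
Context {R : realType}.

(** The factor [1 + J] of the source estimate with the logarithmic cone integral as [J]. *)
Definition log_growth (T : R) : R := 1 + 2 * ln (1 + T).

Lemma log_growth_gt0 T : 0 <= T -> 0 < log_growth T.
Proof. by move=> T0; rewrite /log_growth ltr_wpDr// mulr_ge0// ln_ge0//; lra. Qed.

(** Eliminating the quadratic term between [gamma_S p n] and [gamma_S (p_S n) n = 0] shows that
    [gamma_S p n] has the sign of [p_S n - p] for positive [p]. The root [x] is given by the
    quadratic formula, as a witness for the choice in [p_S]. *)
Lemma p_S_gamma_S (n p : R) : 1 < n -> 0 < p_S n /\
  (p_S n - p) * (2 + (n - 1) * (p_S n * p)) = p_S n * gamma_S p n.
Proof.
move=> n1.
pose D : R := (n + 1) ^+ 2 + 8 * (n - 1); pose S := Num.sqrt D.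
have D0 : 0 <= D by rewrite addr_ge0 ?sqr_ge0// mulr_ge0//; lra.
pose x : R := (n + 1 + S) / (2 * (n - 1)).
have x0 : 0 < x.
  by rewrite divr_gt0 ?mulr_gt0//; [rewrite ltr_wpDr ?sqrtr_ge0//|]; lra.
have gx : gamma_S x n = 0.
  have -> : gamma_S x n = (D - S ^+ 2) / (4 * (n - 1)).
    by rewrite /gamma_S /x /D; field; rewrite gt_eqF//; lra.
  by rewrite /S sqr_sqrtr// subrr mul0r.
have xE := (p_SP n1 x0).1 gx.
rewrite -xE; split => //.
transitivity (x * gamma_S p n - p * gamma_S x n); first by rewrite /gamma_S; ring.
by rewrite gx mulr0 subr0.
Qed.

Lemma powR_rootK (L g : R) : 0 < L -> 0 < g -> (L `^ (- g^-1)) `^ g = L^-1.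
Proof.
by move=> L0 g0; rewrite -powRrM mulNr mulVf ?gt_eqF// powR_inv1// ltW.
Qed.

Lemma powR_root_le (L g y : R) : 0 < L -> 0 < g -> 0 < y ->
  y <= L `^ (- g^-1) -> L * y `^ g <= 1.
Proof.
move=> L0 g0 y0 yL.
have : y `^ g <= L^-1.
  by rewrite -(powR_rootK L0 g0); apply: powR_monotone => //; exact: ltW.
by rewrite -(ler_pM2l L0) mulfV// gt_eqF.
Qed.

(** [C] solves [K C^g = 1], which makes the condition an equality at [T = C eps^(-x/g)]. If this
    time is below 1, then [T = 1] is taken and [eps0] ensures the condition. *)
Lemma power_time (K x g : R) : 0 < K -> 0 < x -> 0 < g ->
  exists C eps0 : R, [/\ 0 < C, 0 < eps0 & forall eps, 0 < eps -> eps <= eps0 ->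
    exists T, [/\ 1 <= T, K * (eps `^ x * T `^ g) <= 1 &
                  C * eps `^ (- (x / g)) <= T]].
Proof.
move=> K0 x0 g0; pose C := K `^ (- g^-1).
exists C, (K `^ (- x^-1)); split; [exact: powR_gt0|exact: powR_gt0|].
move=> eps eps0 epsK; pose X := C * eps `^ (- (x / g)).
exists (Num.max 1 X); split; rewrite ?le_max ?lexx ?orbT//.
have [X1|X1] := leP X 1.
  by rewrite powR1 mulr1; exact: powR_root_le.
have X0 : 0 < X by rewrite mulr_gt0 ?powR_gt0.
rewrite /X powRM ?powR_ge0// /C powR_rootK// -powRrM mulNr divfK ?gt_eqF//.
rewrite [leLHS](_ : _ = K / K * (eps `^ x * eps `^ (- x))); last by ring.
by rewrite mulfV ?gt_eqF// -powRD_gt0// subrr powRr0 mulr1.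
Qed.

Lemma exp_time (K x : R) : 0 < K -> 0 < x ->
  exists C eps0 : R, [/\ 0 < C, 0 < eps0 & forall eps, 0 < eps -> eps <= eps0 ->
    1 <= expR (C * eps `^ (- x)) /\
    K * (eps `^ x * log_growth (expR (C * eps `^ (- x)))) <= 1].
Proof.
(* With [X = C eps^(-x)] one has [log_growth (expR X) <= 3 + 2 X]: the choice of [C] gives
   [2 K C = 1/2], and [eps0] makes [3 K eps^x] at most [1/2]. *)
move=> K0 x0; pose C := (4 * K)^-1.
have C0 : 0 < C by rewrite invr_gt0 mulr_gt0.
have K60 : 0 < 6 * K by rewrite mulr_gt0.
exists C, ((6 * K) `^ (- x^-1)); split => //; first exact: powR_gt0.
move=> eps eps0 epsK.
have h := powR_root_le K60 x0 eps0 epsK.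
pose X := C * eps `^ (- x).
have X0 : 0 <= X by rewrite mulr_ge0 ?powR_ge0// ltW.
have E1 : 1 <= expR X by rewrite -expR0 ler_expR.
split => //; rewrite -/X.
have ln_le : ln (1 + expR X) <= 1 + X.
  rewrite -[1 + X]expRK ler_ln ?posrE ?addr_gt0 ?expR_gt0//.
  rewrite expRD; have : 2 * expR X <= expR 1 * expR X.
    by rewrite ler_pM2r ?expR_gt0//; have := expR_ge1Dx (1 : R); lra.
  by lra.
have ex0 : 0 < eps `^ x by exact: powR_gt0.
have eX : eps `^ x * X = C.
  by rewrite /X powRN mulrCA mulfV ?mulr1// gt_eqF.
apply: (@le_trans _ _ (K * (3 * eps `^ x + 2 * (eps `^ x * X)))).
  rewrite ler_pM2l// /log_growth.
  have : eps `^ x * ln (1 + expR X) <= eps `^ x * (1 + X) by rewrite ler_pM2l.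
  lra.
rewrite eX /C; have -> : K * (3 * eps `^ x + 2 * (4 * K)^-1) =
    6 * K * eps `^ x / 2 + 1 / 2.
  by field; rewrite gt_eqF.
lra.
Qed.

Lemma ln2_ge : 2^-1 <= ln 2 :> R.
Proof.
have : ln (1 + - 2^-1 : R) <= - 2^-1 by apply: le_ln1Dx; lra.
have -> : 1 + - 2^-1 = 2^-1 :> R by field.
by rewrite lnV ?posrE// lerN2.
Qed.

(** The equation of [b] raised to the power [g], half of [gamma_S], reads
    [b^g (log(1 + b))^(p-1) = eps^(-p(p-1))], so the condition holds at a small multiple of [b]. The
    constant 4 absorbs the summand 1 of [log_growth], by [ln (1 + b) >= 1/2]. *)
Lemma b_crit_time (K p n g : R) : 0 < K -> 1 < p -> 0 < g ->
  gamma_S p n = 2 * g ->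
  exists C eps0 : R, [/\ 0 < C, 0 < eps0 & forall eps, 0 < eps -> eps <= eps0 ->
    exists T, [/\ 1 <= T,
      K * (eps `^ (p * (p - 1)) * log_growth T `^ (p - 1) * T `^ g) <= 1 &
      C * b_crit p n eps <= T]].
Proof.
move=> K0 p1 g0 gE; pose x : R := p * (p - 1).
have x0 : 0 < x by rewrite mulr_gt0//; lra.
pose L : R := K * 4 `^ (p - 1).
have L0 : 0 < L by rewrite mulr_gt0// powR_gt0.
pose C : R := Num.min 1 (L `^ (- g^-1)).
have C0 : 0 < C by rewrite lt_min ltr01 powR_gt0.
have C1 : C <= 1 by rewrite ge_min lexx.
exists C, (L `^ (- x^-1)); split => //; first exact: powR_gt0.
move=> eps eps0 epsL; set b := b_crit p n eps.
exists (Num.max 1 (C * b)); split; rewrite ?le_max ?lexx ?orbT//.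
have ln21 : ln 2 <= 1 :> R.
  by have -> : (2 : R) = 1 + 1 by []; apply: le_ln1Dx; lra.
have [Cb1|Cb1] := leP (C * b) 1.
  rewrite powR1 mulr1; apply: le_trans (powR_root_le L0 x0 eps0 epsL).
  rewrite /L -mulrA ler_pM2l// mulrC; apply: ler_wpM2r; first exact: powR_ge0.
  apply: powR_monotone; [|rewrite /log_growth|lra].
    exact: ltW (log_growth_gt0 _).
  by have -> : 1 + 1 = 2 :> R by []; lra.
have b_ge0 : 0 <= b by rewrite -(pmulr_rge0 _ C0); lra.
have b1 : 1 < b by apply: (lt_le_trans Cb1); rewrite ler_piMl.
have b0 : 0 < b by lra.
(* If the equation had no solution, [get] would return the default 0, contrary to [b > 1]. Hence [b]
   satisfies the equation without a separate existence proof. *)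
have [_ bE] : 0 < b /\ b * ln (1 + b) `^ (2 * (p - 1) / gamma_S p n)
      = eps `^ (- (2 * p * (p - 1) / gamma_S p n)).
  apply: (@getPex _ [set b : R | 0 < b /\ b * ln (1 + b) `^ (2 * (p - 1) / gamma_S p n)
      = eps `^ (- (2 * p * (p - 1) / gamma_S p n))]).
  apply: contrapT => nex; have : b = 0 by apply: getPN => y hy; apply: nex; exists y.
  by move=> b00; rewrite b00 ltxx in b0.
pose l : R := ln (1 + b).
have l2 : 2^-1 <= l by apply: le_trans ln2_ge _; rewrite ler_ln ?posrE; lra.
have l0 : 0 < l by lra.
have key : b `^ g * l `^ (p - 1) = eps `^ (- x).
  have := congr1 (fun y => y `^ g) bE.
  rewrite powRM ?powR_ge0 ?(ltW b0)// -!powRrM gE -/l.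
  have -> : 2 * (p - 1) / (2 * g) * g = p - 1 by field; rewrite gt_eqF.
  by have -> : - (2 * p * (p - 1) / (2 * g)) * g = - x by rewrite /x; field;
      rewrite gt_eqF.
have Tb : C * b <= b by rewrite ler_piMl// ltW.
have lg : log_growth (C * b) <= 4 * l.
  have : ln (1 + C * b) <= l by rewrite ler_ln ?posrE; lra.
  by rewrite /log_growth; lra.
have Cg : L * C `^ g <= 1.
  by apply: powR_root_le => //; rewrite ge_min lexx orbT.
apply: le_trans Cg.
have lg0 : 0 <= log_growth (C * b) by apply: ltW; apply: log_growth_gt0; lra.
apply: (@le_trans _ _ (K * (eps `^ x * (4 * l) `^ (p - 1) * (C * b) `^ g))).
  rewrite ler_pM2l//; apply: ler_wpM2r; first exact: powR_ge0.
  apply: ler_wpM2l; first exact: powR_ge0.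
  by apply: powR_monotone => //; lra.
rewrite (powRM _ (ltW C0) (ltW b0)) (powRM _ (ler0n _ 4) (ltW l0)) /L.
rewrite (_ : _ * _ = K * 4 `^ (p - 1) * C `^ g * (eps `^ x * (b `^ g * l `^ (p -
    1)))); last by ring.
by rewrite key powRN mulfV ?mulr1// gt_eqF// powR_gt0.
Qed.

End Scalars.

(** * Sources in the critical and subcritical cases *)

Section Final.
Context {R : realType}.
Notation mu := (@lebesgue_measure R).
Notation mu2 := (mu \x mu)%E.
Variables (m kappa p : R) (w f0 f1 : R -> R).
Hypothesis m0 : 0 <= m.
Hypothesis mkappa : m / 2 < kappa.
Hypothesis hwC0 : C0_half w.
Hypothesis hw : asymptotic_damping m w.
Hypothesis hf0C1 : C1_half f0.
Hypothesis hf1C0 : C0_half f1.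
Hypothesis hf0 : forall r : R, 0 <= r -> `|f0 r| <= japanese r `^ (- kappa).
Hypothesis hf1 : forall r : R, 0 <= r ->
     `|derive_half f0 r| + `|f1 r| <= japanese r `^ (- kappa - 1).
Hypothesis p1 : 1 < p.
Hypothesis e1 : - 1 < radial_exp m p.

Notation phi := (fun r : R => r * f0 r).
Notation psi := (fun r : R => r * f1 r).
Notation q := (source_rate m p).
Notation nu := (kappa - m / 2 - 1).

(** The function [l] records the gain in [T] of the sigma-integral: constant, logarithmic or a
    power. *)
Definition source_bound (s : R) (v : R * R -> R) (l : R -> R) : Prop :=
  exists2 c : R, 0 < c & forall T t r : R, 1 <= T -> strip T (t, r) ->
  (\int[mu2]_(z in Delta_minus t r) (duhamel_integrand w p v t r z)%:E <=
   (c * l T * weight m q s (t, r))%:E)%E.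

Lemma source_bound_gt1 a s : admissible q s -> 1 < p * a ->
  source_bound s (weight m a a) (fun=> 1).
Proof.
move=> adm pa; have [C1 C10 H1] := coneJ_gt1 pa.
have [C C0 HC] := nonlinear_ge1 m0 p1 hwC0 hw e1 adm (ltW pa).
exists (C * (1 + C1)); first by rewrite mulr_gt0// addr_gt0.
move=> T t r T1 [/= /andP[t0 tT] r0]; rewrite mulr1 -mulrA.
by apply: HC => //; [exact: ltW|move=> al k k0 kal _; exact: H1].
Qed.

Lemma source_bound_eq1 a s : admissible q s -> p * a = 1 ->
  source_bound s (weight m a a) log_growth.
Proof.
move=> adm pa; have pa1 : 1 <= p * a by rewrite pa.
have [C C0 HC] := nonlinear_ge1 m0 p1 hwC0 hw e1 adm pa1.
exists C => // T t r T1 [/= /andP[t0 tT] r0]; rewrite /log_growth -mulrA.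
apply: HC => //; first by rewrite mulr_ge0// ln_ge0//; lra.
move=> al k k0 kal kt; rewrite pa; apply: le_trans (coneJ_eq1 k0 kal) _.
by rewrite lee_fin ler_pM2l// ler_ln ?posrE; lra.
Qed.

Lemma source_bound_lt1 s : admissible q s -> p * s < 1 ->
  0 <= 1 + p * q <= 2 ->
  source_bound s (weight m q s) (fun T => T `^ (1 - p * q)).
Proof.
move=> adm ps hq.
have eq_ : 1 + q + (p - 1) * q = 1 + p * q by ring.
have hq' : 0 <= 1 + q + (p - 1) * q <= 2 by rewrite eq_.
have [C C0 HC] := nonlinear_lt1 m0 p1 hwC0 hw e1 adm ps hq'.
exists C => // T t r T1 [/= /andP[t0 tT] r0]; rewrite -mulrA.
rewrite (_ : 1 - p * q = 1 - q - (p - 1) * q); last by ring.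
by apply: HC => //; exact: ltW.
Qed.

Lemma lifespan_source_bound s (l0 l1 : R -> R) : 1 <= p * nu -> admissible q s ->
  (forall T, 1 <= T -> 0 < l0 T) -> (forall T, 1 <= T -> 0 < l1 T) ->
  source_bound s (weight m nu nu) l0 -> source_bound s (weight m q s) l1 ->
  exists2 K : R, 0 < K & forall eps T : R, 0 < eps -> 1 <= T ->
  K * (eps `^ (p * (p - 1)) * l0 T `^ (p - 1) * l1 T) <= 1 ->
  (T%:E <= lifespan w phi psi p eps)%E.
Proof.
move=> pnu adm l00 l10 [c0 c00 H0] [c1 c10 H1].
have [K K0 HK] := lifespan_two_level m0 mkappa hwC0 hw hf0C1 hf1C0 hf0 hf1 p1 pnu adm.
exists (K * c0 `^ (p - 1) * c1); first by rewrite !mulr_gt0// powR_gt0.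
move=> eps T eps0 T1 small; have T0 : 0 < T by lra.
apply: (HK eps T (c0 * l0 T) (c1 * l1 T) eps0 T0).
- by rewrite mulr_gt0// l00.
- by rewrite mulr_gt0// l10.
- by move=> t r tr; exact: H0.
- by move=> t r tr; exact: H1.
- apply: le_trans small; rewrite (powRM _ (ltW c00) (ltW (l00 T T1))).
  by rewrite le_eqVlt; apply/orP; left; apply/eqP; ring.
Qed.

End Final.

Unset Implicit Arguments.

Theorem theorem2p3 (R : realType) (mu kappa p : R) (w f0 f1 : R -> R)
  (hmu : 0 <= mu) (hkappa : mu / 2 < kappa)
  (hwC0 : C0_half w) (hwC1 : C1_pos w)
  (hw : exists r0 delta A : R, [/\ 0 < r0, 0 < delta, 0 < A &
     forall r : R, r0 <= r ->
       `|2 * w r - mu / r| <= A * r `^ (- 1 - delta)])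
  (hf0C1 : C1_half f0) (hf1C0 : C0_half f1)
  (hf0 : forall r : R, 0 <= r -> `|f0 r| <= japanese r `^ (- kappa))
  (hf1 : forall r : R, 0 <= r ->
     `|derive_half f0 r| + `|f1 r| <= japanese r `^ (- kappa - 1))
  (hp : (1 < p /\ p <= p_S (3 + mu)) \/ (1 < p /\ p < p_F kappa)) :
  let phi := fun r : R => r * f0 r in
  let psi := fun r : R => r * f1 r in
  let nu := kappa - mu / 2 - 1 in
  exists C eps0 : R, [/\ 0 < C, 0 < eps0 &
    forall eps : R, 0 < eps -> eps <= eps0 ->
      let T := lifespan w phi psi p eps in
      [/\ p = p_S (3 + mu), 1 < p * nu &
          ((expR (C * eps `^ (- (p * (p - 1)))))%:E <= T)%E] \/
      [/\ 1 < p, p < p_S (3 + mu), 1 < p * nu &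
          ((C * eps `^ (- (2 * p * (p - 1) / gamma_S p (3 + mu))))%:E
             <= T)%E] \/
      [/\ p = p_S (3 + mu), p * nu = 1 &
          ((expR (C * eps `^ (- (p - 1))))%:E <= T)%E] \/
      [/\ 1 < p, p < p_S (3 + mu), p * nu = 1 &
          ((C * b_crit p (3 + mu) eps)%:E <= T)%E] \/
      [/\ 1 < p, p < p_F kappa, p * nu < 1 &
          ((C * eps `^ (- ((p - 1) / gamma_F p kappa)))%:E <= T)%E]].
Proof.
move=> phi psi nu.
have p1 : 1 < p by case: hp => [[]|[]].
have p0 : 0 < p by lra.
have k0 : 0 < kappa by apply: le_lt_trans hkappa; rewrite divr_ge0.
pose q : R := source_rate mu p.
have n1 : 1 < 3 + mu by lra.
have [P0 PE] := p_S_gamma_S p n1.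
set P := p_S (3 + mu) in P0 PE hp *.
have F0 : 0 < 2 + (3 + mu - 1) * (P * p).
  by rewrite ltr_wpDr// mulr_ge0//; [lra|rewrite mulr_ge0// ltW].
have gS : gamma_S p (3 + mu) = 2 * (1 - p * q).
  by rewrite /gamma_S /q /source_rate /radial_exp; field.
(* This identity links the two alternatives of the hypothesis: if [p nu < 1], then [p <= p_S] forces
   [p < p_F], and if [p nu >= 1], then [p < p_F] forces [p < p_S]. *)
have gF : p * gamma_F p kappa = (1 - p * q) + (p - 1) * (1 - p * nu).
  by rewrite /gamma_F /q /nu /source_rate /radial_exp; field.
have pFE : (p < p_F kappa) = (0 < gamma_F p kappa).
  rewrite /p_F /gamma_F -ltrBlDl ltr_pdivlMr// [in RHS]subr_gt0.
  by [].
have hS : (p < P) = (0 < 1 - p * q).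
  rewrite -subr_gt0 -(pmulr_lgt0 _ F0) PE gS pmulr_rgt0// pmulr_rgt0//.
have hSe : 1 - p * q = 0 -> p = P.
  move=> h; apply/esym/eqP; rewrite -subr_eq0.
  have /eqP : (P - p) * (2 + (3 + mu - 1) * (P * p)) = 0 by rewrite PE gS h !mulr0.
  by rewrite mulf_eq0 (gt_eqF F0) orbF.
have hp' : 0 <= 1 - p * q \/ 0 < gamma_F p kappa.
  case: hp => [[_ pP]|[_]]; last by rewrite pFE; right.
  left; have : 0 <= P * gamma_S p (3 + mu) by rewrite -PE mulr_ge0 ?subr_ge0// ltW.
  by rewrite pmulr_rge0// gS pmulr_rge0.
have [pnu|pnu] := ltP (p * nu) 1.
  have gF0 : 0 < gamma_F p kappa.
    case: hp' => // h; rewrite -(pmulr_rgt0 _ p0) gF ltr_wpDl// mulr_gt0//; lra.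
  have ek : (p - 1) * kappa <= 2 by move: gF0; rewrite /gamma_F; lra.
  have e1 : - 1 < radial_exp mu p.
    have : (p - 1) * (mu / 2) < (p - 1) * kappa by rewrite ltr_pM2l//; lra.
    by rewrite /radial_exp; lra.
  have hk : 0 <= (p - 1) * kappa <= 2 by rewrite ek andbT mulr_ge0//; lra.
  have [K K0 HK] := lifespan_one_level hmu hkappa hwC0 hw hf0C1 hf1C0 hf0 hf1 p1 e1
      pnu hk.
  have pm1 : 0 < p - 1 by lra.
  have [C [eps0 [C0 eps00 HC]]] := power_time K0 pm1 gF0.
  exists C, eps0; split => // eps epsp epsle T; do 4 right.
  split => //; first by rewrite pFE.
  have [S [S1 HS CS]] := HC eps epsp epsle.
  by apply: le_trans (HK eps S epsp S1 HS); rewrite lee_fin.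
have pq : 0 <= 1 - p * q.
  case: hp' => // h; have : 0 < p * gamma_F p kappa by exact: mulr_gt0.
  have : (p - 1) * (1 - p * nu) <= 0 by rewrite mulr_ge0_le0//; lra.
  rewrite gF; lra.
have q1 : q < 1 by rewrite -(ltr_pM2l p0) mulr1; lra.
have e1 : - 1 < radial_exp mu p by move: q1; rewrite /q /source_rate; lra.
have qE : q = p - 2 + (p - 1) * (mu / 2) by rewrite /q /source_rate /radial_exp; ring.
have pm0 : 0 <= (p - 1) * (mu / 2) by rewrite mulr_ge0//; lra.
have q_gt : - 1 < q by rewrite qE; lra.
(* Because [q >= p - 2] and [1 + p (p - 2) = (p - 1)^2]. *)
have pq_ge : 0 <= 1 + p * q.
  have : p * (p - 2) <= p * q by rewrite ler_pM2l// qE; lra.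
  have : 0 <= (p - 1) ^+ 2 by exact: sqr_ge0.
  by rewrite expr2; lra.
have x0 : 0 < p * (p - 1) by rewrite mulr_gt0//; lra.
have logp (T : R) : 1 <= T -> 0 < log_growth T by move=> T1; apply: log_growth_gt0; lra.
have sub_s : 0 < 1 - p * q -> exists s, admissible q s /\ p * s < 1.
  move=> h; pose s : R := Num.max ((q + p^-1) / 2) 0; exists s.
  have pV0 : 0 < p^-1 by rewrite invr_gt0.
  have pV1 : p^-1 < 1 by rewrite invf_lt1.
  have qp : q < p^-1 by rewrite -(ltr_pM2l p0) mulfV ?gt_eqF//; lra.
  split; last first.
    rewrite -(ltr_pM2l pV0) mulKf ?gt_eqF// mulr1 /s gt_max pV0 andbT; lra.
  split; first by rewrite /s le_max lexx orbT.
    by rewrite /s ge_max; apply/andP; split; lra.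
  by left; rewrite /s lt_max; apply/orP; left; lra.
have crit_s : 1 - p * q = 0 -> admissible q q /\ p * q = 1.
  move=> h; have pq1 : p * q = 1 by lra.
  have q0 : 0 < q by rewrite -(pmulr_rgt0 _ p0) pq1.
  by split => //; split; [exact: ltW|lra|right].
have pow_pos (g T : R) : 1 <= T -> 0 < T `^ g by move=> T1; apply: powR_gt0; lra.
have one_pos (T : R) : 1 <= T -> 0 < (fun=> 1 : R) T by [].
have [pq0|pqn0] := eqVneq (1 - p * q) 0.
  have pP := hSe pq0; have [adm pq1] := crit_s pq0.
  have B1 := source_bound_eq1 hmu hwC0 hw p1 e1 adm pq1.
  have [pnu1|pnu1] := ltP 1 (p * nu).
    have B0 := source_bound_gt1 hmu hwC0 hw p1 e1 adm pnu1.
    have [K K0 HK] := lifespan_source_bound hmu hkappa hwC0 hw hf0C1 hf1C0 hf0 hf1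
        p1 pnu adm one_pos logp B0 B1.
    have [C [eps0 [C0 eps00 HC]]] := exp_time K0 x0.
    exists C, eps0; split => // eps epsp epsle T; left; split => //.
    have [S1 HS] := HC eps epsp epsle.
    by apply: HK => //; rewrite powR1 mulr1.
  have pnu_1 : p * nu = 1 by apply/eqP; rewrite eq_le pnu1 pnu.
  have B0 := source_bound_eq1 hmu hwC0 hw p1 e1 adm pnu_1.
  have [K K0 HK] := lifespan_source_bound hmu hkappa hwC0 hw hf0C1 hf1C0 hf0 hf1 p1
      pnu adm logp logp B0 B1.
  (* With two logarithms the smallness condition is a full [p]-th power, so its root is a condition
     with [eps^(p-1)] and a single logarithm. *)
  have K'0 : 0 < K `^ p^-1 by exact: powR_gt0.
  have pm1 : 0 < p - 1 by lra.
  have [C [eps0 [C0 eps00 HC]]] := exp_time K'0 pm1.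
  exists C, eps0; split => // eps epsp epsle T; do 2 right; left; split => //.
  have [S1 HS] := HC eps epsp epsle.
  apply: HK => //; move: HS; set S := expR _ in S1 *; set l := log_growth S => HS.
  have l0 : 0 < l by exact: logp.
  have -> : K * (eps `^ (p * (p - 1)) * l `^ (p - 1) * l) =
      (K `^ p^-1 * (eps `^ (p - 1) * l)) `^ p.
    rewrite powRM ?powR_ge0//; last by rewrite mulr_ge0 ?powR_ge0// ltW.
    rewrite powRM ?powR_ge0//; last exact: ltW.
    rewrite -!powRrM mulVf ?gt_eqF// powRr1 ?(ltW K0)//.
    rewrite -(mulr_powRB1 (ltW l0) p0) (mulrC (p - 1) p); ring.
  apply: (@le_trans _ _ (1 `^ p)); last by rewrite powR1.
  apply: powR_monotone => //; last exact: ltW.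
  by rewrite !mulr_ge0 ?powR_ge0// ltW.
have pq0 : 0 < 1 - p * q by rewrite lt_neqAle eq_sym pqn0.
have pP : p < P by rewrite hS.
have [s [adm ps1]] := sub_s pq0.
have hq2 : 0 <= 1 + p * q <= 2 by rewrite pq_ge/=; lra.
have B1 := source_bound_lt1 hmu hwC0 hw p1 e1 adm ps1 hq2.
have [pnu1|pnu1] := ltP 1 (p * nu).
  have B0 := source_bound_gt1 hmu hwC0 hw p1 e1 adm pnu1.
  have [K K0 HK] := lifespan_source_bound hmu hkappa hwC0 hw hf0C1 hf1C0 hf0 hf1 p1
      pnu adm one_pos (pow_pos (1 - p * q)) B0 B1.
  have [C [eps0 [C0 eps00 HC]]] := power_time K0 x0 pq0.
  exists C, eps0; split => // eps epsp epsle T; right; left; split => //.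
  have [S [S1 HS CS]] := HC eps epsp epsle.
  apply: le_trans (HK eps S epsp S1 _); last by rewrite powR1 mulr1.
  rewrite lee_fin gS (_ : 2 * p * (p - 1) / _ = p * (p - 1) / (1 - p * q))//.
  by field; rewrite gt_eqF//; lra.
have pnu_1 : p * nu = 1 by apply/eqP; rewrite eq_le pnu1 pnu.
have B0 := source_bound_eq1 hmu hwC0 hw p1 e1 adm pnu_1.
have [K K0 HK] := lifespan_source_bound hmu hkappa hwC0 hw hf0C1 hf1C0 hf0 hf1 p1
    pnu adm logp (pow_pos (1 - p * q)) B0 B1.
have [C [eps0 [C0 eps00 HC]]] := b_crit_time K0 p1 pq0 gS.
exists C, eps0; split => // eps epsp epsle T; do 3 right; left; split => //.
have [S [S1 HS CS]] := HC eps epsp epsle.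
by apply: le_trans (HK eps S epsp S1 HS); rewrite lee_fin.
Qed.
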